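(* Let $L$ be an honest time satisfying condition $(\mathbf{A})$: $\mathbb{P}[L=T]=0$ for every $(\mathcal{F}_t)$-stopping time $T$. Write $A=A^L$. Let $\varphi:\mathbb{R}_+\to\mathbb{R}$ be continuous with $\int_0^\infty|\varphi(x)|e^{-x}\,dx<\infty$ and $\int_0^\infty x|\varphi(x)|e^{-x}\,dx<\infty$, and let $M^\varphi_t=\mathbb{E}[\varphi(A_\infty)\mid\mathcal{F}_t]$. Then $$\mathbb{E}[M^\varphi_L]=\int_0^\infty\!\!\int_0^\infty e^{-x}e^{-y}\varphi(x+y)\,dx\,dy=\mathbb{E}[\varphi(\mathbf{e}_1+\mathbf{e}_2)]=\int_0^\infty e^{-x}x\,\varphi(x)\,dx,$$ where $\mathbf{e}_1$ and $\mathbf{e}_2$ are two independent random variables following the standard exponential distribution, whereas $$\mathbb{E}[M^\varphi_\infty]=\int_0^\infty e^{-x}\varphi(x)\,dx=\mathbb{E}[\varphi(\mathbf{e}_1)].$$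
   Context: $(\Omega,\mathcal{F},(\mathcal{F}_t)_{t\ge0},\mathbb{P})$ is a filtered probability space satisfying the usual hypotheses; martingales are taken càdlàg. An honest time is a random time $L:\Omega\to\mathbb{R}_+$ which is the end of an $(\mathcal{F}_t)$-optional set $\Gamma$, $L=\sup\{t:(t,\omega)\in\Gamma\}$; it is assumed that $\mathbb{P}[L=0]=\mathbb{P}[L=\infty]=0$. $A^L$ is the $(\mathcal{F}_t)$ dual optional projection of $1_{\{L\le t\}}$ (the increasing right-continuous adapted process with $\mathbb{E}[\int_0^\infty H_s\,dA^L_s]=\mathbb{E}[H_L]$ for all bounded optional $H$). *)

(* Defs.v *)
From HB Require Import structures.
From mathcomp Require Import all_boot all_order all_algebra.
From mathcomp Require Import all_classical all_reals all_analysis.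
From mathcomp Require Import measurable_realfun.

Set Implicit Arguments.
Unset Strict Implicit.
Unset Printing Implicit Defensive.

Import Order.TTheory GRing.Theory Num.Theory.
Import numFieldNormedType.Exports.

Local Open Scope classical_set_scope.
Local Open Scope ring_scope.

(* Time is the half-line [0, +oo[ of R. Filtrations and processes are indexed
   by R, and every condition below only concerns indices t >= 0. *)

Record usual_filtration d (T : measurableType d) (R : realType)
    (P : probability T R) (F : R -> set_system T) : Prop := UsualFiltration {
  filtration_sigma_algebra : forall t : R, 0 <= t -> sigma_algebra setT (F t) ;
  filtration_measurable : forall t : R, 0 <= t -> F t `<=` measurable ;
  filtration_nondecreasing : forall s t : R, 0 <= s -> s <= t -> F s `<=` F t ;
  filtration_right_continuous : forall t : R, 0 <= t ->
    \bigcap_(s in [set s | t < s]) F s `<=` F t ;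
  (* The negligible sets are all the subsets of null events: with
     [filtration_measurable] this includes the completeness of P. *)
  filtration_complete : forall N, P.-negligible N -> F 0 N }.

Definition measurable_wrt (T : Type) (R : realType) (G : set_system T)
    (X : T -> R) : Prop :=
  forall U : set R, measurable U -> G (X @^-1` U).

Definition adapted (T : Type) (R : realType) (F : R -> set_system T)
    (X : R -> T -> R) : Prop :=
  forall t : R, 0 <= t -> measurable_wrt (F t) (X t).

Definition cadlag (T : Type) (R : realType) (X : R -> T -> R) : Prop :=
  forall w,
    (forall t : R, 0 <= t -> X s w @[s --> t^'+] --> X t w) /\
    (forall t : R, 0 < t -> cvg (X s w @[s --> t^'-])).

Definition time_domain (T : Type) (R : realType) : set (R * T) :=
  [set p | 0 <= p.1].
Arguments time_domain : clear implicits.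

Definition optional_sigma_algebra (T : Type) (R : realType)
    (F : R -> set_system T) : set_system (R * T) :=
  <<s time_domain T R,
    [set B | exists X : R -> T -> R, [/\ adapted F X, cadlag X &
       exists2 U : set R, measurable U &
         B = time_domain T R `&` [set p | U (X p.1 p.2)]]] >>.

Definition optional_process (T : Type) (R : realType)
    (F : R -> set_system T) (H : R -> T -> R) : Prop :=
  forall U : set R, measurable U ->
    optional_sigma_algebra F (time_domain T R `&` [set p | U (H p.1 p.2)]).

Definition bounded_process (T : Type) (R : realType) (H : R -> T -> R) : Prop :=
  exists C : R, forall (t : R) w, 0 <= t -> `|H t w| <= C.

Definition stopping_time (T : Type) (R : realType)
    (F : R -> set_system T) (tau : T -> \bar R) : Prop :=
  (forall w, (0 <= tau w)%E) /\
  (forall t : R, 0 <= t -> F t [set w | (tau w <= t%:E)%E]).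

(* The supremum is taken in [0, +oo], so that sup set0 = 0. *)
Definition end_of_set (T : Type) (R : realType) (Gamma : set (R * T))
    (w : T) : \bar R :=
  ereal_sup ([set 0%E] `|` [set t%:E | t in [set t | Gamma (t, w)]]).

Definition honest_time d (T : measurableType d) (R : realType)
    (F : R -> set_system T) (L : T -> \bar R) : Prop :=
  measurable_fun setT L /\
  exists2 Gamma, optional_sigma_algebra F Gamma &
    forall w, L w = end_of_set Gamma w.

Definition avoids_stopping_times d (T : measurableType d) (R : realType)
    (P : probability T R) (F : R -> set_system T) (L : T -> \bar R) : Prop :=
  forall tau, stopping_time F tau -> P [set w | L w = tau w] = 0%E.

(* H_L on the event {L < oo}, and 0 outside. *)
Definition at_time (T : Type) (R : realType) (H : R -> T -> R)
    (L : T -> \bar R) (w : T) : R :=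
  if L w is t%:E then H t w else 0.

(* The path of A at w is the function A w. It vanishes before time 0, which is
   the convention A_{0-} = 0: the measure dA_s gives the mass A_0 to {0}. *)
Record dual_optional_projection d (T : measurableType d) (R : realType)
    (P : probability T R) (F : R -> set_system T) (L : T -> \bar R)
    (A : T -> cumulative R R) : Prop := DualOptionalProjection {
  dual_proj_before0 : forall w (t : R), t < 0 -> A w t = 0 ;
  dual_proj_adapted : adapted F (fun t w => A w t) ;
  dual_projE : forall H, optional_process F H -> bounded_process H ->
    (\int[P]_w \int[lebesgue_stieltjes_measure (A w)]_(s in `[0%R, +oo[)
        (H s w)%:E = 'E_P[at_time H L])%E }.

(* Terminal value, meaningful at those w where the path converges in R. *)
Definition at_infty (T : Type) (R : realType) (X : R -> T -> R) (w : T) : R :=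
  lim (X t w @[t --> +oo]).

Definition cond_expectation d (T : measurableType d) (R : realType)
    (P : probability T R) (G : set_system T) (X Y : T -> R) : Prop :=
  [/\ measurable_wrt G Y, P.-integrable setT (EFin \o Y) &
      forall B, G B ->
        (\int[P]_(w in B) (Y w)%:E = \int[P]_(w in B) (X w)%:E)%E].

(* M is the cadlag version of the martingale E[X | F_t]. *)
Definition closed_martingale d (T : measurableType d) (R : realType)
    (P : probability T R) (F : R -> set_system T) (X : T -> R)
    (M : R -> T -> R) : Prop :=
  cadlag M /\ forall t : R, 0 <= t -> cond_expectation P (F t) X (M t).

Definition standard_exponential d (T : measurableType d) (R : realType)
    (P : probability T R) (e : {RV P >-> R}) : Prop :=
  forall U : set R, measurable U ->
    distribution P e U = exponential_prob 1 U.

Definition independent_RV d (T : measurableType d) (R : realType)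
    (P : probability T R) (X Y : {RV P >-> R}) : Prop :=
  forall U V : set R, measurable U -> measurable V ->
    (P (X @^-1` U `&` Y @^-1` V) = P (X @^-1` U) * P (Y @^-1` V))%E.

(* Main.v *)
Require Import Defs.
From HB Require Import structures.
From mathcomp Require Import all_boot all_order all_algebra.
From mathcomp Require Import all_classical all_reals all_analysis.
From mathcomp Require Import measurable_realfun.
From mathcomp Require Import ring lra.

Set Implicit Arguments.
Unset Strict Implicit.
Unset Printing Implicit Defensive.

Import Order.TTheory GRing.Theory Num.Theory.
Import numFieldNormedType.Exports.

Local Open Scope classical_set_scope.
Local Open Scope ring_scope.

(** Write [A_L] for the value of the dual projection [A] at the honest time, and
    [X] for [phi] of the limit of [A].

    The measure [dA] does not charge the times after [L], so that the limit of
    [A] is almost surely [A_L]. The reason is that the time elapsed since the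
    last visit to the optional set that ends at [L] is a cadlag adapted process
    [H], zero at [L] and positive afterwards: the expectation of the integral
    of [H] against [dA] is that of [H_L], which is zero. The delicate point is
    that the last visit before a time [t] is known at time [t]. This is
    measurable projection: in the strip of times at most [t] an optional set is
    a Suslin set over rectangles with a compact side, the compact side can be
    projected away, and complete sigma-algebras are stable under the Suslin
    operation ([suslin_projection], [suslin_measurable], [elapsed_process],
    [le_terminal]).

    The law of [A_L] follows from the integrands [1_(A_s < a)]. Along a path,
    [A] grows from 0 to about [min(a, A_L)] while it stays below [a]: at most
    this much for the integrand itself, at least this much when the integrand
    is delayed by a positive lag. The two expectations given by the dual
    projection are P(A_L < a) and P(A_(L - lag) < a), and as the lag vanishes
    they differ only on the event that [L] is the first time at which [A]
    reaches [a], a stopping time, hence avoided. So P(A_L < a) is the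
    expectation of [min(a, A_L)] ([terminal_lt]). In terms of the tail function
    [h] this says that [1 - h a] is the integral of [h] from 0 to [a], and [A_L] is
    standard exponential ([exponential_lawP]).

    The expectation of [M_L] is that of the integral of [M] against [dA], and
    since [dA_s] is known at time [s] and [M_s] is the conditional expectation
    of [X], it should be that of [X * A_L] ([expectation_at_end]). As [M] is not
    bounded, one works with truncations of [(M + c)^+]: Fatou's lemma along
    grids, then the conditional Jensen inequality on each cell, bound the
    expectation of [(M_L + c)^+] by that of [(X + c)^+ * A_L]. The mean of [A_L]
    is at most 1, so letting [c] go to infinity gives one inequality, and [- M]
    gives the other. Finally [M] converges to [X] at infinity by Doob's maximal
    inequality, because [A] is constant after [L] and [X] is therefore a limit
    in mean of variables of the past ([closed_martingale_cvg],
    [terminal_approximation]).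

    It remains to integrate [x * phi x] and [phi x] against the exponential
    density; the former is also the integral of [phi] against the law of a sum
    of two independent exponential variables, by Tonelli's theorem
    ([exponential_double]). *)

(** * Suslin sets *)

Section sigma_algebra_closure.
Context {T : Type} {G : set_system T}.
Hypothesis sG : sigma_algebra setT G.

Lemma sigma_algebraC A : G A -> G (~` A).
Proof. by rewrite -setTD; case: sG => _ + _; exact. Qed.

Lemma sigma_algebraT : G setT.
Proof. by rewrite -setC0; apply: sigma_algebraC; case: sG. Qed.

Lemma sigma_algebra_bigcap (A : nat -> set T) :
  (forall n, G (A n)) -> G (\bigcap_n A n).
Proof.
move=> GA; rewrite -[X in G X]setCK setC_bigcap; apply: sigma_algebraC.
by case: sG => _ _; apply=> n; exact: sigma_algebraC.
Qed.

Lemma sigma_algebraI A B : G A -> G B -> G (A `&` B).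
Proof.
move=> GA GB.
rewrite (_ : A `&` B = \bigcap_n (if n is 0%N then A else B)).
  by apply: sigma_algebra_bigcap => -[].
by apply/seteqP; split=> [x [Ax Bx] [|n]//|x ABx]; split; [exact: (ABx 0%N)|exact: (ABx 1%N)].
Qed.

Lemma sigma_algebraU A B : G A -> G B -> G (A `|` B).
Proof.
move=> GA GB; rewrite -[X in G X]setCK setCU; apply: sigma_algebraC.
by apply: sigma_algebraI; exact: sigma_algebraC.
Qed.

Lemma sigma_algebra_implies (P : Prop) A : G A -> G [set x | P -> A x].
Proof.
move=> GA; have [p|np] := pselect P.
  by rewrite (_ : [set _ | _] = A)//; apply/seteqP; split=> x //= /(_ p).
rewrite (_ : [set _ | _] = setT); first exact: sigma_algebraT.
by apply/seteqP; split=> x //= _ /np.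
Qed.

Lemma sigma_algebra_and (P : Prop) A : G A -> G [set x | P /\ A x].
Proof.
move=> GA; have [p|np] := pselect P.
  by rewrite (_ : [set _ | _] = A)//; apply/seteqP; split=> [x []|].
rewrite (_ : [set _ | _] = set0); first by case: sG.
by apply/seteqP; split=> x []//.
Qed.

Lemma sigma_algebra_forall (A : nat -> set T) :
  (forall n, G (A n)) -> G [set x | forall n, A n x].
Proof.
move=> /sigma_algebra_bigcap; congr G.
by apply/seteqP; split=> x //= H n; [exact: H|move=> _; exact: H].
Qed.

Lemma sigma_algebra_exists (I : countType) (A : I -> set T) :
  (forall i, G (A i)) -> G [set x | exists i, A i x].
Proof.
move=> GA.
rewrite (_ : [set _ | _] = \bigcup_n (if unpickle n is Some i then A i else set0)).
  by case: sG => G0 _; apply=> n; case: unpickle.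
apply/seteqP; split=> [x [i Ai]|x [n _]].
  by exists (pickle i) => //; rewrite pickleK.
by case: unpickle => // i Aix; exists i.
Qed.

End sigma_algebra_closure.

(** Dependent choice. It serves twice: to choose the bounds of a Suslin scheme
    one coordinate after the other, and to follow an infinite branch in
    Koenig's lemma. *)
Lemma branch_exists (Q : seq nat -> Prop) :
  Q [::] -> (forall s, Q s -> exists v, Q (rcons s v)) ->
  exists m : nat -> nat, forall k, Q (mkseq m k).
Proof.
move=> Q0 QS.
have /choice[f fP] : forall s, exists v, Q s -> Q (rcons s v).
  by move=> s; have [/QS[v Qv]|nQ] := pselect (Q s); [exists v|exists 0%N].
pose pre k := iter k (fun s => rcons s (f s)) [::].
exists (fun k => f (pre k)) => k.
have preE : pre k = mkseq (fun k => f (pre k)) k.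
  by elim: k => // k IH; rewrite mkseqS -IH.
by rewrite -preE; elim: {preE} k => //= k; exact: fP.
Qed.

(** The sets of a scheme are indexed by whole branches instead of finite
    sequences. Continuity in the branch makes this equivalent to the classical
    Suslin operation, and no length has to be tracked when schemes are
    combined. *)
Definition finitary {Y : Type} (K : (nat -> nat) -> set Y) :=
  forall s, exists c, forall s',
    (forall i, (i < c)%N -> s' i = s i) -> K s' = K s.

Definition suslin {Y : Type} (B : set_system Y) (S : set Y) :=
  exists K : nat -> (nat -> nat) -> set Y,
    [/\ forall n s, B (K n s), forall n, finitary (K n) &
        S = [set y | exists s, forall n, K n s y]].

Lemma suslin_base {Y : Type} (B : set_system Y) S : B S -> suslin B S.
Proof.
move=> BS; exists (fun _ _ => S); split=> //; first by move=> n s; exists 0%N.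
by apply/seteqP; split=> y /=; [exists id|move=> [_ /(_ 0%N)]].
Qed.

(** The first coordinate of the branch selects the set of the union. *)
Lemma suslin_bigcup {Y : Type} (B : set_system Y) (S : nat -> set Y) :
  (forall j, suslin B (S j)) -> suslin B (\bigcup_j S j).
Proof.
move=> /choice[K KP].
exists (fun n s => K (s 0%N) n (fun i => s i.+1)); split.
- by move=> n s; case: (KP (s 0%N)).
- move=> n s; have [_ /(_ n (fun i => s i.+1))[c cP] _] := KP (s 0%N).
  exists c.+1 => s' ss'; rewrite ss'//; apply: cP => i ic; exact: ss'.
apply/seteqP; split=> [y [j _]|y [s Ks]].
  case: (KP j) => _ _ -> [s Ks]; exists (fun i => if i is i'.+1 then s i' else j).
  exact: Ks.
by exists (s 0%N) => //; case: (KP (s 0%N)) => _ _ ->; exists (fun i => s i.+1).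
Qed.

(** A pairing function lets one branch carry one branch for each of the sets. *)
Lemma suslin_bigcap {Y : Type} (B : set_system Y) (S : nat -> set Y) :
  (forall j, suslin B (S j)) -> suslin B (\bigcap_j S j).
Proof.
move=> /choice[K KP].
pose dec N : nat * nat := odflt (0, 0)%N (unpickle N).
have decK p : dec (pickle p) = p by rewrite /dec pickleK.
exists (fun N s => K (dec N).1 (dec N).2 (fun i => s (pickle ((dec N).1, i)))); split.
- by move=> N s; case: (KP (dec N).1).
- move=> N s; set j := (dec N).1; set n := (dec N).2.
  have [_ /(_ n (fun i => s (pickle (j, i))))[c cP] _] := KP j.
  exists (\max_(i < c) (pickle (j, nat_of_ord i)).+1)%N => s' ss'.
  apply: cP => i ic; apply: ss'.
  exact: (@leq_bigmax _ (fun i : 'I_c => (pickle (j, nat_of_ord i)).+1) (Ordinal ic)).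
apply/seteqP; split=> [y Sy|y [s Ks] j _].
  have /choice[s sP] : forall j, exists s, forall n, K j n s y.
    by move=> j; have := Sy j Logic.I; case: (KP j) => _ _ ->.
  exists (fun N => s (dec N).1 (dec N).2) => N.
  rewrite (_ : (fun _ => _) = s (dec N).1)//.
  by apply/funext => i; rewrite decK.
case: (KP j) => _ _ ->; exists (fun i => s (pickle (j, i))) => n.
by have := Ks (pickle (j, n)); rewrite decK.
Qed.

Section suslin_measurable.
Context d (T : measurableType d) (R : realType) (P : probability T R).
Variable G : set_system T.
Hypotheses (sG : sigma_algebra setT G) (Gm : G `<=` measurable).
Hypothesis G_negligible : forall N, P.-negligible N -> G N.
Implicit Types (S : set T) (a : \bar R) (s t m : nat -> nat).

Let outer_gt a S := forall B, G B -> S `<=` B -> (a < P B)%E.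

(** Outer measures are continuous from below: covers of the successive sets are
    made increasing by intersecting each of them with all the later ones. *)
Lemma outer_gt_bigcup a (S : nat -> set T) :
  (forall i j, (i <= j)%N -> S i `<=` S j) ->
  outer_gt a (\bigcup_j S j) -> exists j, outer_gt a (S j).
Proof.
move=> ndS; apply: contraPP => /forallNP nS.
have /choice[B BP] : forall j, exists B, [/\ G B, S j `<=` B & (P B <= a)%E].
  move=> j; have /existsNP[B /not_implyP[GB /not_implyP[SB /negP]]] := nS j.
  by rewrite -leNgt => PB; exists B.
pose C j := \bigcap_i B (j + i)%N.
have GC j : G (C j).
  by apply: (sigma_algebra_bigcap sG) => i; case: (BP (j + i)%N).
have CB j : C j `<=` B j by move=> x /(_ 0%N Logic.I); rewrite addn0.
have SC j : S j `<=` C j.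
  move=> x Sx i _; have [_ + _] := BP (j + i)%N; apply.
  by apply: ndS Sx; rewrite leq_addr.
have ndC : {homo C : n m / (n <= m)%N >-> (n <= m)%O}.
  move=> n p np; apply/subsetPset => x Cx i _.
  by have := Cx (p - n + i)%N Logic.I; rewrite addnA subnKC.
have GUC : G (\bigcup_j C j) by case: sG => _ _; exact.
move=> /(_ _ GUC (subset_bigcup (fun j _ => SC j))); apply/negP.
rewrite -leNgt.
have cP := nondecreasing_cvg_mu (fun i => Gm (GC i)) (Gm GUC) ndC (mu := P).
rewrite -(cvg_lim _ cP)//; apply: lime_le; first by apply/cvg_ex; eexists; exact: cP.
apply: nearW => n /=; have [_ _] := BP n; apply: le_trans.
by apply: le_measure; rewrite ?inE; [exact: Gm|apply: Gm; case: (BP n)|exact: CB].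
Qed.

Section scheme.
Variable E : nat -> (nat -> nat) -> set T.
Hypotheses (GE : forall n s, G (E n s)) (finE : forall n, finitary (E n)).

Let decided N s n := forall s', (forall i, (i < N)%N -> s' i = s i) -> E n s' = E n s.

(** Only the constraints that the first [N] coordinates decide are kept. The
    result depends on finitely many coordinates, so that countable unions over
    branches become available. *)
Let approx N s := [set w | forall n, (n < N)%N -> decided N s n -> E n s w].

Let approxE N s s' : (forall i, (i < N)%N -> s' i = s i) -> approx N s' = approx N s.
Proof.
suff H u v : (forall i, (i < N)%N -> u i = v i) -> approx N u `<=` approx N v.
  by move=> ss'; apply/seteqP; split; apply: H => // i /ss'.
move=> uv w wu n nN dn; have uvn := dn _ uv; rewrite -uvn; apply: wu => //.
by move=> u' u'u; rewrite uvn; apply: dn => i iN; rewrite u'u// uv.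
Qed.

Let approxS N s : approx N.+1 s `<=` approx N s.
Proof.
move=> w wN n nN dn; apply: wN; first exact: leqW.
by move=> s' ss'; apply: dn => i /leqW; exact: ss'.
Qed.

Let le_approx N N' s : (N <= N')%N -> approx N' s `<=` approx N s.
Proof.
move=> /subnKC <-; elim: (N' - N)%N => [|k IH]; first by rewrite addn0.
by rewrite addnS => w /approxS; exact: IH.
Qed.

Let approx_all s w : (forall N, approx N s w) -> forall n, E n s w.
Proof.
move=> H n; have [c cP] := finE n s.
apply: (H (maxn c n.+1)); first by rewrite leq_maxr.
by move=> s' ss'; apply: cP => i ic; apply: ss'; rewrite leq_max ic.
Qed.

Let bounded_approx m N := [set w | exists2 s, forall i, (s i <= m i)%N & approx N s w].

Let G_bounded_approx m N : G (bounded_approx m N).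
Proof.
rewrite (_ : bounded_approx m N = [set w | exists u : seq nat,
    (forall i, (nth 0%N u i <= m i)%N) /\ approx N (nth 0%N u) w]).
  apply: (sigma_algebra_exists sG) => u; apply: (sigma_algebra_and sG).
  apply: (sigma_algebra_forall sG) => n; apply: (sigma_algebra_implies sG).
  exact: (sigma_algebra_implies sG).
apply/seteqP; split=> [w [s sm sw]|w [u [um uw]]]; last by exists (nth 0%N u).
exists (mkseq s N); split.
  move=> i; have [iN|Ni] := ltnP i N; first by rewrite nth_mkseq.
  by rewrite nth_default// size_mkseq.
by rewrite (approxE (s := s))// => i iN; rewrite nth_mkseq.
Qed.

(** Koenig's lemma: bounds on the coordinates make the tree of approximations
    finitely branching, and it has nodes at every depth. *)
Let koenig m w : (forall N, bounded_approx m N w) -> exists s, forall n, E n s w.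
Proof.
move=> H.
pose Q (u : seq nat) := forall N, exists s, [/\ forall i, (i < size u)%N -> s i = nth 0%N u i,
  forall i, (s i <= m i)%N & approx N s w].
have Q0 : Q [::] by move=> N; have [s sm sw] := H N; exists s.
have QS u : Q u -> exists v, Q (rcons u v).
  move=> Qu; apply: contrapT => /forallNP nQ.
  have /choice[N NP] : forall v, exists N, ~ exists s,
     [/\ forall i, (i < size (rcons u v))%N -> s i = nth 0%N (rcons u v) i,
      forall i, (s i <= m i)%N & approx N s w].
    by move=> v; apply/existsNP; exact: nQ.
  have [s [su sm sw]] := Qu (\max_(v < (m (size u)).+1) N v)%N.
  apply: (NP (s (size u))); exists s; split=> //.
    move=> i; rewrite size_rcons ltnS leq_eqVlt nth_rcons => /predU1P[->|iu].
      by rewrite ltnn eqxx.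
    by rewrite iu; exact: su.
  apply: le_approx sw; have sl : (s (size u) < (m (size u)).+1)%N by rewrite ltnS.
  exact: (@leq_bigmax _ (fun v : 'I_ _ => N v) (Ordinal sl)).
have [s sQ] := branch_exists Q0 QS.
exists s; apply: approx_all => N; have [s' [s's _ s'w]] := sQ N N.
rewrite -(approxE (s' := s'))// => i iN.
by rewrite s's ?size_mkseq// nth_mkseq.
Qed.

Let S := [set w | exists s, forall n, E n s w].

(** Each coordinate in turn is bounded without losing the outer measure above
    [a]. The branches are then confined to a compact set, on which Koenig's
    lemma shows that the intersection of the approximations lies inside [S]. *)
Let inner_approx a : outer_gt a S -> exists B, [/\ G B, B `<=` S & (a <= P B)%E].
Proof.
move=> aS.
pose Sb (u : seq nat) :=
  [set w | exists s, (forall i, (i < size u)%N -> (s i <= nth 0%N u i)%N) /\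
                     forall n, E n s w].
have [m mP] : exists m, forall k, outer_gt a (Sb (mkseq m k)).
  apply: (branch_exists (Q := fun u => outer_gt a (Sb u))).
    by move=> B GB SB; apply: aS => // w [s ws]; apply: SB; exists s.
  move=> u au; have ndu i j : (i <= j)%N -> Sb (rcons u i) `<=` Sb (rcons u j).
    move=> ij w [s [su sw]]; exists s; split=> // k; have := su k.
    rewrite !size_rcons !nth_rcons => + ks => /(_ ks).
    case: ifP => // _; case: ifP => // _ /leq_trans; exact.
  apply: outer_gt_bigcup ndu _ => B GB UB; apply: au => // w [s [su sw]].
  apply: UB; exists (s (size u)) => //; exists s; split=> // i.
  rewrite size_rcons ltnS leq_eqVlt nth_rcons => /predU1P[->|iu].
    by rewrite ltnn eqxx.
  by rewrite iu; exact: su.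
exists (\bigcap_N bounded_approx m N); split.
- by apply: (sigma_algebra_bigcap sG) => N; exact: G_bounded_approx.
- by move=> w H; apply: (@koenig m w) => N; exact: H.
have ni : {homo bounded_approx m : n p / (n <= p)%N >-> (p <= n)%O}.
  move=> n p np; apply/subsetPset => w [s sm sw]; exists s => //.
  exact: le_approx sw.
have cP := nonincreasing_cvg_mu (mu := P) (F := bounded_approx m)
  (le_lt_trans (probability_le1 P (Gm (G_bounded_approx m 0%N))) (ltry 1)) (fun i => Gm (G_bounded_approx m i))
  (Gm (sigma_algebra_bigcap sG (G_bounded_approx m))) ni.
rewrite -(cvg_lim _ cP)//; apply: lime_ge; first by apply/cvg_ex; eexists; exact: cP.
apply: nearW => N /=; apply/ltW/(mP N); first exact: G_bounded_approx.
move=> w [s [sm sw]]; exists (fun i => if (i < N)%N then s i else 0%N).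
  move=> i; case: ifP => // iN; have := sm i; rewrite size_mkseq nth_mkseq//; exact.
rewrite (approxE (s := s)); last by move=> i ->.
by move=> n _ _; exact: sw.
Qed.

(** The best cover of [S] and the best subset of [S] have the same probability,
    so [S] differs from a member of [G] by a negligible set. *)
Lemma scheme_measurable : G S.
Proof.
pose V := [set P B | B in [set B | G B /\ S `<=` B]].
pose a := ereal_inf V.
have a0 : (0 <= a)%E by apply: le_ereal_inf_tmp => _ [B _ <-].
have a1 : (a <= 1)%E.
  rewrite -(probability_setT P); apply: ereal_inf_lbound; exists setT => //.
  by split=> //; exact: sigma_algebraT.
have afin : a \is a fin_num by rewrite ge0_fin_numE// (le_lt_trans a1)// ltry.
have /choice[Vo VoP] : forall n : nat, exists B, [/\ G B, S `<=` B & (P B <= a + (n.+1%:R^-1)%:E)%E].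
  move=> n; have n0 : (0 < (n.+1%:R^-1 : R)) by rewrite invr_gt0.
  have [_ [B [GB SB] <-] Ba] := lb_ereal_inf_adherent n0 afin.
  by exists B; split=> //; exact: ltW.
have /choice[Vi ViP] : forall n : nat, exists B, [/\ G B, B `<=` S & (a - (n.+1%:R^-1)%:E <= P B)%E].
  move=> n; apply: inner_approx => B GB SB.
  apply: (@lt_le_trans _ _ a); last by apply: ereal_inf_lbound; exists B.
  by rewrite -(fineK afin) -EFinB lte_fin gtrBl invr_gt0.
pose Bo := \bigcap_n Vo n; pose Bi := \bigcup_n Vi n.
have GBo : G Bo by apply: (sigma_algebra_bigcap sG) => n; case: (VoP n).
have GBi : G Bi by case: sG => _ _; apply=> n; case: (ViP n).
have BiS : Bi `<=` S by move=> w [n _]; case: (ViP n) => _ + _; exact.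
have SBo : S `<=` Bo by move=> w Sw n _; case: (VoP n) => _ + _; exact.
have n_e (e : R) : 0 < e -> exists n : nat, n.+1%:R^-1 <= e.
  by move=> e0; have [n _ /(_ n (leqnn n))/ltW] := near_infty_natSinv_lt (PosNum e0); exists n.
have PBo : (P Bo <= a)%E.
  apply/lee_addgt0Pr => e /n_e[n ne]; have [GVo _ Von] := VoP n.
  apply: (@le_trans _ _ (P (Vo n))).
    by apply: le_measure; rewrite ?inE; [exact: Gm|exact: Gm|exact: bigcap_inf].
  by rewrite (le_trans Von)// leeD2l// lee_fin.
have PBi : (a <= P Bi)%E.
  apply/lee_addgt0Pr => e /n_e[n ne]; have [GVi _ Vin] := ViP n.
  rewrite -leeBlDr//; apply: (@le_trans _ _ (P (Vi n))).
    by rewrite (le_trans _ Vin)// leeB// lee_fin.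
  by apply: le_measure; rewrite ?inE; [exact: Gm|exact: Gm|exact: bigcup_sup].
have Pio : P (Bo `\` Bi) = 0%E.
  apply/eqP; rewrite eq_le measure_ge0 andbT measureD//=; [|exact: Gm..|]; last first.
    by rewrite (le_lt_trans (probability_le1 _ _)) ?ltry//; exact: Gm.
  rewrite setIidr; last exact: subset_trans SBo.
  rewrite leeBlDr ?add0e; first exact: le_trans PBi.
  by apply: fin_num_measure; exact: Gm.
rewrite (_ : S = Bi `|` (S `\` Bi)); last first.
  by apply/seteqP; split=> [w Sw|w [/BiS|[]]//]; have [|] := pselect (Bi w); [left|right].
apply: (sigma_algebraU sG) => //; apply: G_negligible.
exists (Bo `\` Bi); split=> //; last by apply: setSD.
by apply: measurableD; exact: Gm.
Qed.

End scheme.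

(** A theorem of Lusin and Sierpinski. *)
Lemma suslin_measurable (S : set T) : suslin G S -> G S.
Proof. by move=> [E [GE finE ->]]; exact: scheme_measurable. Qed.

End suslin_measurable.

(** * Right-continuous paths on grids *)

Section grid.
Context {R : realType}.

Lemma right_cvg_dist (f : R -> R) (s : R) : f x @[x --> s^'+] --> f s ->
  forall e, 0 < e -> exists2 d, 0 < d &
    forall x, s <= x -> x < s + d -> `|f s - f x| < e.
Proof.
move=> /cvgrPdist_lt fs e e0.
have [d /= d0 dP] := fs e e0; exists d => // x; rewrite le_eqVlt => /predU1P[<-|sx xd].
  by rewrite subrr normr0.
by apply: dP => //=; rewrite ltr0_norm ?subr_lt0// opprB ltrBlDl.
Qed.

Lemma right_cvg_seq (f : R -> R) (s : R) (u : nat -> R) :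
  f x @[x --> s^'+] --> f s -> (forall n, s <= u n) -> u n @[n --> \oo] --> s ->
  f (u n) @[n --> \oo] --> f s.
Proof.
move=> fs su us; apply/cvgrPdist_lt => e e0.
have [d d0 dP] := right_cvg_dist fs e0.
move/cvgrPdist_lt : us => /(_ d d0); apply: filterS => n usn.
apply: dP => //; move: usn; rewrite ltr_distlC => /andP[_].
by rewrite addrC.
Qed.

(** Times are rounded up, so that right-continuous paths are recovered from
    their values on the grids. *)
Definition grid_index (n : nat) (s : R) : nat := `|Num.ceil (n.+1%:R * s)|%N.

Definition grid (n i : nat) : R := i%:R / n.+1%:R.

Lemma grid_indexP n s i : 0 <= s ->
  (grid_index n s == i) = (grid n i - n.+1%:R^-1 < s) && (s <= grid n i).
Proof.
move=> s0; have n0 : (0 < n.+1%:R :> R) by [].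
have ns0 : 0 <= n.+1%:R * s by rewrite mulr_ge0.
rewrite /grid_index /grid.
rewrite -{1}[X in _ - X]mul1r -mulrBl ltr_pdivrMr// ler_pdivlMr// ![s * _]mulrC.
have c0 : (0 <= Num.ceil (n.+1%:R * s)) by rewrite ceil_ge0 (lt_le_trans _ ns0)// ltrN10.
by rewrite -eqz_nat gez0_abs// ceil_eq intrB.
Qed.

Lemma grid_near n s : 0 <= s ->
  s <= grid n (grid_index n s) /\ grid n (grid_index n s) < s + n.+1%:R^-1.
Proof.
move=> s0; have := grid_indexP n (grid_index n s) s0.
by rewrite eqxx ltrBlDr => /esym/andP[].
Qed.

Lemma grid_ge0 n i : 0 <= grid n i.
Proof. by rewrite /grid divr_ge0. Qed.

Lemma grid_cvg s : 0 <= s -> grid n (grid_index n s) @[n --> \oo] --> s.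
Proof.
move=> s0; apply/cvgrPdist_lt => e e0.
apply: filterS (near_infty_natSinv_lt (PosNum e0)) => n /= ne.
have [sg gs] := grid_near n s0.
by rewrite distrC ger0_norm ?subr_ge0// ltrBlDl (lt_trans gs)// ltrD2l.
Qed.

End grid.

(** * Optional sets and measurable projection *)

Section rectangles.
Context {T : Type} {R : realType}.
Implicit Types (G : set_system T) (E : set T).

Definition closed_rectangle G : set_system (R * T) :=
  [set B | exists c d E, G E /\ B = [set p | c <= p.1 <= d /\ E p.2]].

(** For a fixed branch the constraints on the time are closed intervals. If any
    finite number of them have a common point then all of them do, so the time
    can be chosen separately at each finite stage. *)
Lemma suslin_projection G (S : set (R * T)) : sigma_algebra setT G ->
  suslin (closed_rectangle G) S -> suslin G [set w | exists t, S (t, w)].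
Proof.
move=> sG [K [KG finK ->]].
have /choice[c /choice[d /choice[E KE]]] : forall ns : nat * (nat -> nat),
    exists c d E, G E /\ K ns.1 ns.2 = [set p | c <= p.1 <= d /\ E p.2].
  by move=> ns; exact: KG.
pose E' N s := [set w | exists t, forall n, (n < N)%N -> K n s (t, w)].
exists E'; split.
- move=> N s; rewrite (_ : E' N s = [set w |
      (exists t, forall n, (n < N)%N -> c (n, s) <= t <= d (n, s)) /\
      (forall n, (n < N)%N -> E (n, s) w)]).
    apply: (sigma_algebra_and sG); apply: (sigma_algebra_forall sG) => n.
    by apply: (sigma_algebra_implies sG); case: (KE (n, s)).
  apply/seteqP; split=> [w [t tw]|w [[t tw] Ew]].
    split; last by move=> n /tw; have [_ /= ->] := KE (n, s); case.
    by exists t => n /tw; have [_ /= ->] := KE (n, s); case.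
  exists t => n nN; have [_ /= ->] := KE (n, s); split; first exact: tw.
  exact: Ew.
- move=> N s.
  have /choice[m mP] : forall n, exists m, forall s',
      (forall i, (i < m)%N -> s' i = s i) -> K n s' = K n s.
    by move=> n; exact: finK.
  exists (\max_(n < N) m n)%N => s' ss'.
  have KK n : (n < N)%N -> K n s' = K n s.
    move=> nN; apply: mP => i im; apply: ss'; apply: leq_trans im _.
    exact: (@leq_bigmax _ (fun n : 'I_N => m n) (Ordinal nN)).
  by apply/seteqP; split=> w [t tw]; exists t => n nN;
    [rewrite -KK//|rewrite KK//]; exact: tw.
apply/seteqP; split=> [w [t [s Ks]]|w [s Ks]].
  by exists s => N; exists t => n _; exact: Ks.
have cd n m : c (n, s) <= d (m, s).
  have [t tw] := Ks (maxn n m).+1.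
  have := tw n; rewrite ltnS leq_maxl => /(_ isT).
  have := tw m; rewrite ltnS leq_maxr => /(_ isT).
  have [_ /= ->] := KE (n, s); have [_ /= ->] := KE (m, s).
  by move=> [/andP[_ td] _] [/andP[ct _] _]; exact: le_trans td.
have csup : has_sup (range (fun n => c (n, s))).
  split; first by exists (c (0%N, s)), 0%N.
  by exists (d (0%N, s)) => _ [n _ <-].
exists (sup (range (fun n => c (n, s)))), s => n.
have [t tw] := Ks n.+1; have := tw n (ltnSn n).
have [_ /= ->] := KE (n, s); move=> [_ Ew]; split=> //=.
apply/andP; split; first by apply: ub_le_sup; [case: csup|exists n].
by apply: ge_sup => [|_ [m _ <-]//]; case: csup.
Qed.

Lemma suslin_strip G E (c d : R) : G E ->
  suslin (closed_rectangle G) [set p | c < p.1 <= d /\ E p.2].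
Proof.
move=> GE.
rewrite (_ : [set _ | _] =
    \bigcup_k [set p : R * T | c + k.+1%:R^-1 <= p.1 <= d /\ E p.2]).
  by apply: suslin_bigcup => k; apply: suslin_base; exists (c + k.+1%:R^-1), d, E.
apply/seteqP; split=> [[t w] [/= /andP[ct td] Ew]|[t w] [k _ /= [/andP[ct ->] Ew]]].
  have ct0 : 0 < t - c by rewrite subr_gt0.
  have [k _ /(_ k (leqnn k)) /= kc] := near_infty_natSinv_lt (PosNum ct0).
  by exists k => //=; rewrite td andbT -lerBrDl; split=> //; exact: ltW.
by rewrite andbT (lt_le_trans _ ct)// ltrDl invr_gt0.
Qed.

End rectangles.

Section optional_sets.
Context d (T : measurableType d) (R : realType) (P : probability T R).
Variable F : R -> set_system T.
Hypothesis usualF : usual_filtration P F.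

Section at_fixed_time.
Variable t : R.
Hypothesis t0 : 0 <= t.

Let sF : sigma_algebra setT (F t) := filtration_sigma_algebra usualF t0.

Let horizon : set (R * T) := [set p | 0 <= p.1 <= t].

Let suslin_horizon : suslin (closed_rectangle (F t)) horizon.
Proof.
apply: suslin_base; exists 0, t, setT; split; first exact: sigma_algebraT.
by apply/seteqP; split=> [[s w]|[s w] []].
Qed.

Let suslinI (A B : set (R * T)) : suslin (closed_rectangle (F t)) A ->
  suslin (closed_rectangle (F t)) B -> suslin (closed_rectangle (F t)) (A `&` B).
Proof.
move=> sA sB; rewrite (_ : A `&` B = \bigcap_n (if n is 0%N then A else B)).
  by apply: suslin_bigcap => -[].
apply/seteqP; split=> [p [Ap Bp] [|n] _//|p H].
by split; [exact: (H 0%N)|exact: (H 1%N)].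
Qed.

(** The grid point is capped at [t], so that only values of the process known
    at time [t] are looked at. *)
Let suslin_grid_ge (X : R -> T -> R) (n : nat) (b : R) : adapted F X ->
  suslin (closed_rectangle (F t))
    [set p | 0 <= p.1 <= t /\ b <= X (Num.min (grid n (grid_index n p.1)) t) p.2].
Proof.
move=> aX.
rewrite (_ : [set _ | _] = \bigcup_i (horizon `&`
    [set p | grid n i - n.+1%:R^-1 < p.1 <= grid n i /\
             (X (Num.min (grid n i) t) @^-1` `[b, +oo[) p.2])).
  apply: suslin_bigcup => i; apply: suslinI => //; apply: suslin_strip.
  apply: (filtration_nondecreasing usualF) (aX _ _ _ _) => //.
  - by rewrite le_min grid_ge0.
  - by rewrite ge_min lexx orbT.
  - by rewrite le_min grid_ge0.
apply/seteqP; split=> [[s w] /= [/andP[s0 st] bX]|[s w] [i _ /= [/andP[s0 st] [+ +]]]].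
  exists (grid_index n s) => //=; rewrite -grid_indexP// eqxx in_itv/= bX.
  by split=> //; apply/andP.
rewrite -grid_indexP// => /eqP -> /=; rewrite in_itv/= andbT => ->.
by split=> //; apply/andP.
Qed.

Let suslin_gt (X : R -> T -> R) (a : R) : adapted F X -> cadlag X ->
  suslin (closed_rectangle (F t)) [set p | 0 <= p.1 <= t /\ a < X p.1 p.2].
Proof.
move=> aX cX.
rewrite (_ : [set _ | _] = \bigcup_k \bigcup_m \bigcap_n
   [set p | 0 <= p.1 <= t /\
      a + k.+1%:R^-1 <= X (Num.min (grid (m + n) (grid_index (m + n) p.1)) t) p.2]).
  apply: suslin_bigcup => k; apply: suslin_bigcup => m; apply: suslin_bigcap => n.
  exact: suslin_grid_ge.
have Xcvg s w : 0 <= s <= t ->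
    X (Num.min (grid n (grid_index n s)) t) w @[n --> \oo] --> X s w.
  move=> /andP[s0 st]; apply: (right_cvg_seq (f := X ^~ w)).
  - by have [+ _] := cX w; exact.
  - by move=> n; rewrite le_min st; have [-> _] := grid_near n s0.
  - apply: squeeze_cvgr (cvg_cst s) (grid_cvg s0); apply: nearW => n.
    by rewrite le_min st ge_min lexx /= andbT; have [-> _] := grid_near n s0.
apply/seteqP; split=> [[s w] /= [st aXs]|[s w] /= [k _ [m _ H]]].
  have aX0 : 0 < (X s w - a) / 2 by rewrite divr_gt0// subr_gt0.
  have [k _ /(_ k (leqnn k)) /= kc] := near_infty_natSinv_lt (PosNum aX0).
  have /cvgrPdist_lt/(_ _ aX0)[m _ mP] := Xcvg s w st.
  exists k => //; exists m => // n _; split=> //=.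
  have := mP (m + n)%N (leq_addr _ _); rewrite /= ltr_distlC => /andP[+ _].
  by move: kc; move: (k.+1%:R^-1) (X (Num.min _ _) w) => u v; lra.
have [st _] := H 0%N Logic.I; split=> //.
apply: (@lt_le_trans _ _ (a + k.+1%:R^-1)); first by rewrite ltrDl invr_gt0.
have Xsw := Xcvg s w st; rewrite -(cvg_lim _ Xsw)//.
apply: limr_ge; first by apply/cvg_ex; eexists; exact: Xsw.
by exists m => // n /= mn; have [_] := H (n - m)%N Logic.I; rewrite subnKC.
Qed.

(** Suslin sets are not stable under complement. The sets whose two traces are
    Suslin are, and this class contains the generators of the optional
    sigma-algebra. *)
Let good (S : set (R * T)) := suslin (closed_rectangle (F t)) (horizon `&` S) /\
  suslin (closed_rectangle (F t)) (horizon `\` S).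

Let suslin_set0 : suslin (closed_rectangle (F t)) (set0 : set (R * T)).
Proof.
apply: suslin_base; exists 0, 0, set0; split; first by case: sF.
by apply/seteqP; split=> // p [].
Qed.

Let good_sigma : sigma_algebra (time_domain T R) good.
Proof.
split.
- by rewrite /good setI0 setD0.
- move=> S [S1 S2]; split.
    rewrite (_ : _ `&` _ = horizon `\` S)//; apply/seteqP; split=> p; first by move=> [? []].
    by move=> [/andP[p0 pt] nS]; split; [exact/andP|].
  rewrite (_ : _ `\` _ = horizon `&` S)//; apply/seteqP; split=> [p [pt]|p].
    move=> /not_andP[[]|/contrapT//]; by case/andP: pt.
  by move=> [pt Sp]; split=> // -[].
move=> S HS; split.
  by rewrite setI_bigcupr; apply: suslin_bigcup => n; case: (HS n).
rewrite (_ : _ `\` _ = \bigcap_n (horizon `\` S n)).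
  by apply: suslin_bigcap => n; case: (HS n).
apply/seteqP; split=> [p [pt nS] n _|p H]; first by split=> // Sn; apply: nS; exists n.
have [pt _] := H 0%N Logic.I; split=> // -[n _ Sn].
by have [] := H n Logic.I.
Qed.

Lemma optional_suslin S : optional_sigma_algebra F S ->
  suslin (closed_rectangle (F t)) (horizon `&` S).
Proof.
move=> /(_ good) H; suff : good S by case.
apply: H; split; first exact: good_sigma.
move=> _ [X [aX cX [U mU ->]]].
suff {U mU} : @measurable _ R `<=`
    [set U | good (time_domain T R `&` [set p | U (X p.1 p.2)])] by exact.
have -> : @measurable _ R = (@RGenOInfty.G R).-sigma.-measurable.
  exact: RGenOInfty.measurableE.
apply: smallest_sub.
  split.
  - rewrite /= (_ : _ `&` _ = set0); first by case: good_sigma.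
    by apply/seteqP; split=> p [].
  - move=> U /= gU; rewrite (_ : _ `&` _ = time_domain T R `\` (time_domain T R `&` [set p | U (X p.1 p.2)])).
      by case: good_sigma => _ + _; exact.
    apply/seteqP; split=> p; first by move=> [p0 [_ nU]]; split=> // -[].
    by move=> [p0 /not_andP[|]].
  move=> U gU /=; rewrite (_ : _ `&` _ =
      \bigcup_n (time_domain T R `&` [set p | U n (X p.1 p.2)])).
    by case: good_sigma => _ _; exact.
  by apply/seteqP; split=> [p [p0 [n _ Un]]|p [n _ [p0 Un]]]; [exists n|split=> //; exists n].
move=> _ [a ->] /=; split.
  rewrite (_ : _ `&` _ = [set p | 0 <= p.1 <= t /\ a < X p.1 p.2]).
    exact: suslin_gt.
  apply/seteqP; split=> [[s w] /= [st [_]]|[s w] /= [st aXs]].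
    by rewrite in_itv/= andbT.
  by split=> //; split; [case/andP: st|rewrite in_itv/= andbT].
rewrite (_ : _ `\` _ =
    \bigcap_k [set p | 0 <= p.1 <= t /\ - (a + k.+1%:R^-1) < - X p.1 p.2]).
  apply: suslin_bigcap => k; apply: (suslin_gt (X := fun s w => - X s w)).
    move=> s s0 U mU; apply: (aX s s0 (-%R @^-1` U)).
    by rewrite -[X in measurable X]setTI; exact: oppr_measurable.
  move=> w; have [rX lX] := cX w; split=> s s0; first by apply: cvgN; exact: rX.
  by apply: is_cvgN; exact: lX.
apply/seteqP; split=> [[s w] /= [st nX] k _ /=|[s w] H].
  split=> //; rewrite ltrN2 (@le_lt_trans _ _ a)// ?ltrDl// ?invr_gt0//.
  rewrite leNgt; apply/negP => aXs; apply: nX; split; first by case/andP: st.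
  by rewrite /= in_itv/= andbT.
have [st _] := H 0%N Logic.I; split=> // -[_]; rewrite /= in_itv/= andbT => aXs.
have aX0 : 0 < X s w - a by rewrite subr_gt0.
have [k _ /(_ k (leqnn k)) /= kc] := near_infty_natSinv_lt (PosNum aX0).
have [_] := H k Logic.I; rewrite /= ltrN2; move: kc; move: (k.+1%:R^-1) => u; lra.
Qed.

(** The measurable projection that makes the last visit to an optional set an
    adapted process. *)
Lemma optional_projection_measurable S c : optional_sigma_algebra F S ->
  F t [set w | exists s, [/\ 0 <= s, s <= t, c < s & S (s, w)]].
Proof.
move=> /optional_suslin sS.
apply: (suslin_measurable (P := P) sF (filtration_measurable usualF t0)).
  move=> N /(filtration_complete usualF).
  exact: (filtration_nondecreasing usualF).
have sc : suslin (closed_rectangle (F t)) ([set p | c < p.1 <= t /\ setT p.2] `&` (horizon `&` S)).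
  by apply: suslinI => //; apply: suslin_strip; exact: sigma_algebraT.
have := suslin_projection sF sc; congr suslin.
apply/seteqP; split=> w [s /=].
  by move=> [[/andP[cs _] _] [/andP[s0 st] Ss]]; exists s.
by move=> [s0 st cs Ss]; exists s; do 2?split=> //=; exact/andP.
Qed.

End at_fixed_time.
End optional_sets.

(** * Integrals up to null sets *)

Section integral_null_sets.
Context d (T : measurableType d) (R : realType) (mu : {measure set T -> \bar R}).
Implicit Types f g : T -> \bar R.
Local Open Scope ereal_scope.

Import HBNNSimple.

(** The integral is a supremum over simple functions, and each of them can be set
    to zero on a null set that contains [N]. The argument thus covers functions
    whose measurability is not known, such as the Stieltjes integrals of the
    paths of a process. *)
Lemma ge0_le_integral_outside (N : set T) f g : mu.-negligible N ->
  (forall x, 0 <= f x) -> (forall x, 0 <= g x) -> (forall x, ~ N x -> f x <= g x) ->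
  \int[mu]_x f x <= \int[mu]_x g x.
Proof.
move=> [B [mB B0 NB]] f0 g0 fg; rewrite (ge0_integralTE _ f0) (ge0_integralTE _ g0).
apply: ge_ereal_sup => _ [h hf <-].
pose h' := proj_nnsfun h (measurableC mB).
apply: ereal_sup_ubound; exists h' => /=.
  move=> x; rewrite mindicE; have [xB|xB] := boolP (x \in ~` B).
    by rewrite mulr1 (le_trans (hf x))// fg// => Nx; move: xB; rewrite inE => -[]; exact: NB.
  by rewrite mulr0.
rewrite -!integralT_nnsfun; apply: ge0_ae_eq_integral => //.
- by apply/measurable_EFinP; exact: measurable_funTS.
- by apply/measurable_EFinP; exact: measurable_funTS.
- by move=> x _; rewrite lee_fin fun_ge0.
- by move=> x _; rewrite lee_fin fun_ge0.
exists B; split=> // x /= /not_implyP[_]; apply: contra_notP => nBx.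
by rewrite mindicE mem_set ?mulr1.
Qed.

Lemma eq_integral_outside (N : set T) f g : mu.-negligible N ->
  (forall x, ~ N x -> f x = g x) -> \int[mu]_x f x = \int[mu]_x g x.
Proof.
move=> N0 fg; rewrite integralE [RHS]integralE.
by congr (_ - _); apply/eqP; rewrite eq_le; apply/andP; split;
  apply: (ge0_le_integral_outside N0) => // x /fg E; rewrite ?funeposE ?funenegE E.
Qed.

Lemma ge0_le_integralT f g : (forall x, 0 <= f x) -> (forall x, f x <= g x) ->
  \int[mu]_x f x <= \int[mu]_x g x.
Proof.
move=> f0 fg; apply: (ge0_le_integral_outside (negligible_set0 mu)) => // x.
exact: le_trans (fg x).
Qed.

End integral_null_sets.

(** * Cadlag adapted processes *)

Section processes.
Context {T : Type} {R : realType}.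
Variable F : R -> set_system T.

Lemma optional_cadlag (X : R -> T -> R) : adapted F X -> cadlag X ->
  optional_process F X.
Proof.
move=> aX cX U mU; apply: sub_sigma_algebra; exists X; split=> //.
by exists U.
Qed.

Lemma cadlag_comp (f : R -> R) (X : R -> T -> R) : continuous f -> cadlag X ->
  cadlag (fun t w => f (X t w)).
Proof.
move=> cf cX w; have [rX lX] := cX w; split=> t t0.
  by apply: continuous_cvg; [exact: cf|exact: rX].
have /cvg_ex[l Xl] := lX t t0.
by apply/cvg_ex; exists (f l); apply: continuous_cvg => //; exact: cf.
Qed.

Lemma adapted_comp (f : R -> R) (X : R -> T -> R) : measurable_fun setT f ->
  adapted F X -> adapted F (fun t w => f (X t w)).
Proof.
move=> mf aX t t0 U mU; apply: (aX t t0 (f @^-1` U)).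
by rewrite -[X in measurable X]setTI; exact: mf.
Qed.

Lemma cadlag_nondecreasing (X : R -> T -> R) :
  (forall w s t, s <= t -> X s w <= X t w) ->
  (forall w t e, 0 < e -> exists2 u, t < u & X u w < X t w + e) ->
  cadlag X.
Proof.
move=> ndX rX w; split=> t t0.
  apply/cvgrPdist_lt => e e0; have [u tu Xu] := rX w t e e0.
  near=> s; have ts : t < s by near: s; exact: nbhs_right_gt.
  rewrite ler0_norm ?subr_le0 ?ndX ?(ltW ts)// opprB ltrBlDl.
  apply: le_lt_trans Xu; apply: ndX; apply/ltW; near: s.
  exact: nbhs_right_lt.
apply: nondecreasing_at_left_is_cvgr; first by apply: nearW => x y z _ _; exact: ndX.
apply: nearW => x; exists (X t w) => _ [s /= + <-].
by rewrite in_itv/= => /andP[_ /ltW]; exact: ndX.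
Unshelve. all: by end_near. Qed.

Lemma cadlagN (X : R -> T -> R) : cadlag X -> cadlag (fun t w => - X t w).
Proof. by apply: cadlag_comp => x; exact: continuousN. Qed.

Lemma cadlagD (X Y : R -> T -> R) : cadlag X -> cadlag Y ->
  cadlag (fun t w => X t w + Y t w).
Proof.
move=> cX cY w; have [rX lX] := cX w; have [rY lY] := cY w; split=> t t0.
  by apply: cvgD; [exact: rX|exact: rY].
by apply: is_cvgD; [exact: lX|exact: lY].
Qed.

Lemma cadlag_time : cadlag (fun (t : R) (_ : T) => t).
Proof.
move=> w; split=> t t0.
  by apply: cvg_at_right_filter; exact: cvg_id.
by apply/cvg_ex; exists t; apply: cvg_at_left_filter; exact: cvg_id.
Qed.

End processes.

Section measurable_wrt.
Context {T : Type} {R : realType} {G : set_system T}.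
Hypothesis sG : sigma_algebra setT G.

Lemma measurable_wrt_lt (X : T -> R) :
  (forall c, G [set w | X w < c]) -> measurable_wrt G X.
Proof.
move=> GX.
suff : @measurable _ R `<=` [set U | G (X @^-1` U)] by exact.
have -> : @measurable _ R = (@RGenInftyO.G R).-sigma.-measurable.
  exact: RGenInftyO.measurableE.
apply: smallest_sub.
  split.
  - by rewrite /= preimage_set0; case: sG.
  - by move=> U /= GU; rewrite setTD preimage_setC; exact: (sigma_algebraC sG).
  by move=> U GU; rewrite /= preimage_bigcup; case: sG => _ _; exact.
move=> _ [a ->] /=; exact: GX.
Qed.

Lemma measurable_wrt_ltP (X : T -> R) c : measurable_wrt G X -> G [set w | X w < c].
Proof.
by move=> mX; apply: (mX `]-oo, c[%classic); exact: measurable_itv.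
Qed.

End measurable_wrt.

(** * The last exit from an optional set *)

Section last_exit.
Context d (T : measurableType d) (R : realType) (P : probability T R).
Variables (F : R -> set_system T) (usualF : usual_filtration P F).
Variables (Gamma : set (R * T)) (oGamma : optional_sigma_algebra F Gamma).

Let visits (u : R) (w : T) : set R :=
  [set 0] `|` [set s | [/\ 0 <= s, s <= u & Gamma (s, w)]].

Let last_visit (u : R) (w : T) : R := sup (visits u w).

Let visits_sup u w : has_sup (visits u w).
Proof.
split; first by exists 0; left.
exists (Num.max 0 u) => s [->|[_ su _]]; first by rewrite le_max lexx.
by rewrite le_max su orbT.
Qed.

Let last_visit_ge0 u w : 0 <= last_visit u w.
Proof. by apply: ub_le_sup; [case: (visits_sup u w)|left]. Qed.

Let last_visit_le u w : 0 <= u -> last_visit u w <= u.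
Proof.
move=> u0; apply: ge_sup; first by case: (visits_sup u w).
by move=> s [->|[]].
Qed.

Let last_visitS u v w : u <= v -> last_visit u w <= last_visit v w.
Proof.
move=> uv; apply: ge_sup; first by case: (visits_sup u w).
move=> s us; apply: ub_le_sup; first by case: (visits_sup v w).
by case: us => [->|[s0 su Gs]]; [left|right; split=> //; exact: le_trans uv].
Qed.

Let last_visit_gt u w c : 0 <= c ->
  (c < last_visit u w) <-> exists s, [/\ 0 <= s, s <= u, c < s & Gamma (s, w)].
Proof.
move=> c0; split=> [|[s [s0 su cs Gs]]].
  move=> /sup_gt -[|s [->|[s0 su Gs] cs]]; first by case: (visits_sup u w).
    by rewrite ltNge c0.
  by exists s.
apply: (lt_le_trans cs); apply: ub_le_sup; first by case: (visits_sup u w).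
by right.
Qed.

Let last_visit_measurable u c : 0 <= u -> F u [set w | last_visit u w < c].
Proof.
move=> u0; have sF := filtration_sigma_algebra usualF u0.
rewrite (_ : [set w | _] = ~` [set w | forall k : nat, c - k.+1%:R^-1 < last_visit u w]).
  apply: (sigma_algebraC sF); apply: (sigma_algebra_forall sF) => k.
  have [c0|c0] := leP 0 (c - k.+1%:R^-1).
    rewrite [X in F u X](_ : _ = [set w | exists s,
        [/\ 0 <= s, s <= u, c - k.+1%:R^-1 < s & Gamma (s, w)]]).
      exact: (optional_projection_measurable usualF).
    by apply/seteqP; split=> w /=; rewrite last_visit_gt.
  rewrite [X in F u X](_ : _ = setT); first exact: sigma_algebraT.
  by apply/seteqP; split=> w //= _; exact: lt_le_trans c0 _.
apply/seteqP; split=> w /=.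
  move=> lc H; have lc0 : 0 < c - last_visit u w by rewrite subr_gt0.
  have [k _ /(_ k (leqnn k)) /= kc] := near_infty_natSinv_lt (PosNum lc0).
  have := H k; move: kc; move: (k.+1%:R^-1) (last_visit u w) => x y; lra.
move=> /existsNP[k] /negP; rewrite -leNgt => lk; apply: (le_lt_trans lk).
by rewrite gtrBl invr_gt0.
Qed.

(** The path of [last_visit] is increasing but not right-continuous. Its right
    limit is cadlag, and still adapted by right-continuity of the filtration. *)
Let exit_time (t : R) (w : T) : R := inf [set last_visit u w | u in [set u | t < u]].

Let exit_inf t w : has_inf [set last_visit u w | u in [set u | t < u]].
Proof.
split; first by exists (last_visit (t + 1) w), (t + 1) => //=; rewrite ltrDl.
by exists 0 => _ [u _ <-].
Qed.

Let exit_time_le t u w : t < u -> exit_time t w <= last_visit u w.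
Proof. by move=> tu; apply: ge_inf; [case: (exit_inf t w)|exists u]. Qed.

Let exit_time_lt t w c : exit_time t w < c -> exists2 u, t < u & last_visit u w < c.
Proof.
by move=> /inf_lt -[|_ [u tu <-] uc]; [case: (exit_inf t w)|exists u].
Qed.

Let exit_time_ge t w c : (forall u, t < u -> c <= last_visit u w) -> c <= exit_time t w.
Proof.
move=> H; apply: lb_le_inf; first by case: (exit_inf t w).
by move=> _ [u tu <-]; exact: H.
Qed.

Let exit_time_le_t t w : 0 <= t -> exit_time t w <= t.
Proof.
move=> t0; apply/ler_addgt0Pr => e e0.
apply: (le_trans (exit_time_le (u := t + e) _ _)); first by rewrite ltrDl.
by apply: last_visit_le; rewrite addr_ge0// ltW.
Qed.

Let exit_time_cadlag : cadlag exit_time.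
Proof.
have nd w s t : s <= t -> exit_time s w <= exit_time t w.
  by move=> st; apply: exit_time_ge => u tu; apply: exit_time_le; exact: le_lt_trans tu.
apply: cadlag_nondecreasing => // w t e e0.
have [|u tu ue] := @exit_time_lt t w (exit_time t w + e); first by rewrite ltrDl.
exists ((t + u) / 2); first by move: tu; lra.
by apply: le_lt_trans ue; apply: exit_time_le; move: tu; lra.
Qed.

Let exit_time_adapted : adapted F exit_time.
Proof.
move=> t t0; have sF := filtration_sigma_algebra usualF t0.
apply: (measurable_wrt_lt sF) => c.
apply: (filtration_right_continuous usualF) => // s /= ts.
have s0 : 0 <= s by exact: le_trans (ltW ts).
have sFs := filtration_sigma_algebra usualF s0.
have st0 : 0 < s - t by rewrite subr_gt0.
have [N _ /(_ N (leqnn N)) /= Ns] := near_infty_natSinv_lt (PosNum st0).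
rewrite (_ : [set w | _] = [set w | exists n : nat, last_visit (t + (N + n).+1%:R^-1) w < c]).
  apply: (sigma_algebra_exists sFs) => n.
  have Nn : (N + n).+1%:R^-1 <= N.+1%:R^-1 :> R.
    by rewrite lef_pV2 ?posrE// ler_nat ltnS leq_addr.
  have Nn0 : 0 <= t + (N + n).+1%:R^-1 by rewrite addr_ge0.
  apply: (filtration_nondecreasing usualF (s := t + (N + n).+1%:R^-1)) => //.
    by rewrite -lerBrDl (le_trans Nn)// ltW.
  exact: last_visit_measurable.
apply/seteqP; split=> w /=.
  move=> /exit_time_lt[u tu uc]; have ut0 : 0 < u - t by rewrite subr_gt0.
  have [n _ /(_ (N + n)%N (leq_addl _ _)) /= nu] := near_infty_natSinv_lt (PosNum ut0).
  exists n; apply: le_lt_trans uc; apply: last_visitS.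
  by rewrite -lerBrDl ltW.
by move=> [n]; apply: le_lt_trans; apply: exit_time_le; rewrite ltrDl invr_gt0.
Qed.

(** The time elapsed since the last visit, truncated at 1 to be bounded. It is
    the process that detects the end of the set: before the end it may vanish
    at any time, after the end it cannot. *)
Lemma elapsed_process : exists H : R -> T -> R,
  [/\ adapted F H, cadlag H, forall t w, 0 <= t -> 0 <= H t w <= 1,
      forall w t, end_of_set Gamma w = t%:E -> H t w = 0 &
      forall w t s, end_of_set Gamma w = t%:E -> t < s -> Num.min 1 (s - t) <= H s w].
Proof.
exists (fun t w => Num.min 1 (t - exit_time t w)).
have endP w t s : end_of_set Gamma w = t%:E -> Gamma (s, w) -> s <= t.
  by move=> wt Gs; rewrite -lee_fin -wt; apply: ereal_sup_ubound; right; exists s.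
have end_ge0 w t : end_of_set Gamma w = t%:E -> 0 <= t.
  by move=> wt; rewrite -lee_fin -wt; apply: ereal_sup_ubound; left.
have le_end w t u : end_of_set Gamma w = t%:E -> last_visit u w <= t.
  move=> wt; apply: ge_sup; first by case: (visits_sup u w).
  by move=> s [->|[_ _ Gs]]; [exact: end_ge0 wt|exact: endP wt Gs].
have end_le w t : end_of_set Gamma w = t%:E -> t <= exit_time t w.
  move=> wt; apply: exit_time_ge => u tu; rewrite -lee_fin -wt.
  apply: ge_ereal_sup => _ [->|[s Gs <-]]; first by rewrite lee_fin.
  have [s0|s0] := ltP s 0; first by rewrite lee_fin (le_trans (ltW s0)).
  rewrite lee_fin; apply: ub_le_sup; first by case: (visits_sup u w).
  by right; split=> //; rewrite (le_trans _ (ltW tu))//; exact: endP wt Gs.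
have minC : continuous (fun x : R => Num.min 1 x).
  by move=> x; apply: (@continuous_min _ _ (cst 1) id); [exact: cvg_cst|exact: cvg_id].
split.
- apply: (adapted_comp (X := fun t w => t - exit_time t w)).
    exact: continuous_measurable_fun.
  move=> t t0; have sF := filtration_sigma_algebra usualF t0.
  move=> U mU; apply: (exit_time_adapted t0 (U := (fun x => t - x) @^-1` U)).
  rewrite -[X in measurable X]setTI.
  have mB : measurable_fun setT (fun x : R => t - x) by apply: measurable_funB.
  exact: mB.
- apply: (cadlag_comp minC (X := fun t w => t - exit_time t w)).
  by apply: cadlagD; [exact: cadlag_time|exact: cadlagN].
- by move=> t w t0; rewrite ge_min lexx le_min ler01 subr_ge0 exit_time_le_t.
- move=> w t wt; have := exit_time_le_t w (end_ge0 w t wt); have := end_le w t wt.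
  by move=> t1 t2; rewrite (_ : t - _ = 0) ?min_r//; apply/eqP; rewrite subr_eq0 eq_le t1 t2.
move=> w t s wt ts; rewrite le_min !ge_min lexx /=.
rewrite lerD2l lerN2 (_ : exit_time s w <= t) ?orbT//.
by rewrite (le_trans (exit_time_le w (_ : s < s + 1)))// ?ltrDl//; exact: le_end wt.
Qed.

End last_exit.

(** * Stieltjes integrals along grids *)

Section stieltjes.
Context {R : realType}.
Variable f : cumulative R R.
Local Notation dF := (lebesgue_stieltjes_measure f).

Lemma stieltjes_oc (a b : R) : a <= b -> dF `]a, b] = (f b - f a)%:E.
Proof.
move=> ab; rewrite /lebesgue_stieltjes_measure /measure_extension/=.
by rewrite measurable_mu_extE/= ?wlength_itv_bnd//; exact: is_ocitv.
Qed.

Hypothesis f_before0 : forall t : R, t < 0 -> f t = 0.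

(** The mass of the origin is [f 0], because [f] vanishes on the left of it. *)
Lemma stieltjes_0c (b : R) : 0 <= b -> dF `[0, b] = (f b)%:E.
Proof.
move=> b0.
have E : `[0, b]%classic = \bigcap_n `]- n.+1%:R^-1, b]%classic.
  apply/seteqP; split=> x /=.
    rewrite in_itv/= => /andP[x0 xb] n _ /=.
    by rewrite in_itv/= xb (lt_le_trans _ x0)// oppr_lt0 invr_gt0.
  move=> H; rewrite in_itv/=; have := H 0%N Logic.I; rewrite /= in_itv/= => /andP[_ ->].
  rewrite andbT leNgt; apply/negP => x0; have nx0 : 0 < - x by rewrite oppr_gt0.
  have [n _ /(_ n (leqnn n)) /= nx] := near_infty_natSinv_lt (PosNum nx0).
  have := H n Logic.I; rewrite /= in_itv/= => /andP[]; move: nx.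
  by move: (n.+1%:R^-1) => u; lra.
pose B n : set R := `]- n.+1%:R^-1, b]%classic.
have dn n : dF (B n) = (f b)%:E.
  rewrite stieltjes_oc; last by rewrite (le_trans _ b0)// oppr_le0.
  by rewrite [f (- _)]f_before0 ?subr0// oppr_lt0 invr_gt0.
rewrite E -/(B _); have B0 : (dF (B 0%N) < +oo)%E by rewrite dn ltry.
have ndB : {homo B : n m / (n <= m)%N >-> (m <= n)%O}.
  move=> n m nm; apply/subsetPset => x /=; rewrite /B/= !in_itv/= => /andP[mx ->].
  by rewrite andbT (le_lt_trans _ mx)// lerN2 lef_pV2 ?posrE// ler_nat ltnS.
have mB n : measurable (B n) by exact: measurable_itv.
have /cvg_lim <- // := nonincreasing_cvg_mu B0 mB (bigcapT_measurable mB) ndB.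
rewrite (_ : _ \o _ = cst (f b)%:E) ?lim_cst//.
by apply/funext => n; exact: dn.
Qed.

Definition grid_cell (n i : nat) : set R :=
  [set s | 0 <= s /\ grid_index n s = i].

Lemma grid_cellE n i :
  grid_cell n i = `[0, +oo[ `&` `]grid n i - n.+1%:R^-1, grid n i].
Proof.
apply/seteqP; split=> s; rewrite /grid_cell /= !in_itv/= andbT.
  by move=> [s0 /eqP]; rewrite grid_indexP.
by move=> [s0]; rewrite -grid_indexP// => /eqP.
Qed.

Lemma measurable_grid_cell n i : measurable (grid_cell n i).
Proof. by rewrite grid_cellE; apply: measurableI; exact: measurable_itv. Qed.

Lemma bigcup_grid_cell n : \bigcup_i grid_cell n i = `[0, +oo[%classic.
Proof.
apply/seteqP; split=> [s [i _ [s0 _]]|s]; rewrite /= in_itv/= andbT//.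
by move=> s0; exists (grid_index n s).
Qed.

Lemma trivIset_grid_cell n : trivIset setT (grid_cell n).
Proof. by apply/trivIsetP => i j _ _ /eqP ij; apply/seteqP; split=> s// [[_ si] [_ sj]]; apply: ij; rewrite -si. Qed.

Lemma stieltjes_grid_cell n i :
  dF (grid_cell n i) = (f (grid n i) - f (grid n i - n.+1%:R^-1))%:E.
Proof.
have n0 : 0 < n.+1%:R^-1 :> R by rewrite invr_gt0.
rewrite grid_cellE; case: i => [|i].
  rewrite [f (_ - _)]f_before0 ?subr0; last by rewrite /grid mul0r sub0r oppr_lt0.
  rewrite -stieltjes_0c ?grid_ge0//; congr (dF _).
  apply/seteqP; split=> s /=; rewrite !in_itv/= /grid mul0r ?andbT.
    by move=> [-> /andP[]].
  by move=> /andP[s0 ->]; rewrite s0 andbT (lt_le_trans _ s0)// sub0r oppr_lt0.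
rewrite -stieltjes_oc ?gerBl ?invr_ge0//; congr (dF _); apply/setIidPr => s /=.
rewrite !in_itv/= andbT => /andP[+ _] => /ltW; apply: le_trans.
by rewrite /grid -[X in _ - X]mul1r -mulrBl divr_ge0// -natr1 addrK.
Qed.

Lemma measurable_fun_grid n (h : nat -> R) :
  measurable_fun (`[0, +oo[%classic : set R) (fun s : R => h (grid_index n s)).
Proof.
rewrite -(bigcup_grid_cell n); apply/measurable_fun_bigcup => [i|i].
  exact: measurable_grid_cell.
apply: (eq_measurable_fun (cst (h i))) => [s|]; last exact: measurable_cst.
by rewrite inE => -[_ <-].
Qed.

Local Open Scope ereal_scope.

Lemma ge0_stieltjes_grid n (h : R -> R) : (forall i, 0 <= h (grid n i))%R ->
  \int[dF]_(s in `[0%R, +oo[) (h (grid n (grid_index n s)))%:E =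
  \sum_(i <oo) (h (grid n i) * (f (grid n i) - f (grid n i - n.+1%:R^-1)))%:E.
Proof.
move=> h0; rewrite -(bigcup_grid_cell n) ge0_integral_bigcup//; last 4 first.
- by move=> i; exact: measurable_grid_cell.
- rewrite bigcup_grid_cell; apply/measurable_EFinP.
  exact: (@measurable_fun_grid n (fun i => h (grid n i))).
- by move=> s _; rewrite lee_fin.
- exact: trivIset_grid_cell.
apply: eq_eseriesr => i _.
rewrite (eq_integral (cst (h (grid n i))%:E)); last by move=> s; rewrite inE => -[_ ->].
rewrite integral_cst; last exact: measurable_grid_cell.
by rewrite EFinM; congr (_ * _); exact: stieltjes_grid_cell.
Qed.

Lemma measurable_right_continuous (h : R -> R) :
  (forall s, 0 <= s -> h x @[x --> s^'+] --> h s)%R ->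
  measurable_fun (`[0%R, +oo[%classic : set R) h.
Proof.
move=> rh; apply: (measurable_fun_cvg
    (h := fun n s => h (grid n (grid_index n s)))) => [n|s].
  exact: (@measurable_fun_grid n (fun i => h (grid n i))).
rewrite /= in_itv/= andbT => s0; apply: right_cvg_seq; first exact: rh.
  by move=> n; have [] := grid_near n s0.
exact: grid_cvg.
Qed.

(** Fatou's lemma, for the integrands obtained by rounding the time up to the
    grids. Once integrated over paths, the right-hand side only involves
    products of random variables. *)
Lemma stieltjes_grid_fatou (h : R -> R) : (forall s, 0 <= s -> 0 <= h s)%R ->
  (forall s, 0 <= s -> h x @[x --> s^'+] --> h s)%R ->
  \int[dF]_(s in `[0%R, +oo[) (h s)%:E <=
  limn_einf (fun n =>
    \sum_(i <oo) (h (grid n i) * (f (grid n i) - f (grid n i - n.+1%:R^-1)))%:E).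
Proof.
move=> h0 rh.
pose J n := \int[dF]_(s in `[0%R, +oo[) (h (grid n (grid_index n s)))%:E.
rewrite (_ : (fun n => _) = J); last first.
  by apply/funext => n; rewrite /J ge0_stieltjes_grid// => i; exact/h0/grid_ge0.
have mh n : measurable_fun (`[0%R, +oo[%classic : set R)
    (fun s => (h (grid n (grid_index n s)))%:E).
  by apply/measurable_EFinP; exact: (@measurable_fun_grid n (fun i => h (grid n i))).
have h0' n (s : R) : (`[0%R, +oo[%classic : set R) s -> 0 <= (h (grid n (grid_index n s)))%:E.
  by move=> _; rewrite lee_fin h0// grid_ge0.
apply: le_trans (fatou dF (measurable_itv _) mh h0').
rewrite le_eqVlt; apply/orP; left; apply/eqP; apply: eq_integral => s.
rewrite inE/= in_itv/= andbT => s0; apply/esym.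
have [] // := @cvg_limn_einf_sup _ (fun n => (h (grid n (grid_index n s)))%:E) (h s)%:E.
apply: cvg_EFin; first exact: nearW.
apply: right_cvg_seq; first exact: rh.
  by move=> n; have [] := grid_near n s0.
exact: grid_cvg.
Qed.
End stieltjes.

(** * Weighted integrals and random times *)

Lemma measurable_lt_set d (T : measurableType d) (R : realType) (f g : T -> R) :
  measurable_fun setT f -> measurable_fun setT g -> measurable [set x | f x < g x].
Proof.
move=> mf mg; have mfg := measurable_fun_ltr mf mg.
by rewrite -[X in measurable X]setTI; exact: (mfg _ [set true]).
Qed.

Section generalities.
Context d (T : measurableType d) (R : realType).

Lemma limn_einf_le (u : nat -> \bar R) c : (forall n, u n <= c)%E -> (limn_einf u <= c)%E.
Proof.
move=> uc; rewrite limn_einf_lim; apply: lime_le; first exact: is_cvg_einfs.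
apply: nearW => n; apply: le_trans (uc n).
by apply: ereal_inf_lbound; exists n => /=.
Qed.

(** A nonnegative weight is the integral of the indicators of its superlevel
    sets, so Tonelli's theorem slices a weighted integral along them. *)
Lemma ge0_integral_layers (P : {sigma_finite_measure set T -> \bar R}) (V h : T -> R) :
  measurable_fun setT V -> (forall x, 0 <= V x) ->
  measurable_fun setT h -> (forall x, 0 <= h x) ->
  (\int[P]_x (V x * h x)%:E = \int[lebesgue_measure]_(y in `[0%R, +oo[)
     \int[P]_(x in [set x | (y < V x)%R]) (h x)%:E)%E.
Proof.
move=> mV V0 mh h0.
pose below (z : T * R) : R := ((0 <= z.2 < V z.1)%R)%:R.
have mbelow : measurable_fun setT below.
  rewrite (_ : below = \1_([set z : T * R | 0 <= z.2] `&` [set z | z.2 < V z.1])).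
    apply: measurable_indic; apply: measurableI.
      rewrite (_ : [set _ | _] = snd @^-1` `[0, +oo[); last first.
        by apply/seteqP; split=> z /=; rewrite in_itv/= andbT.
      by rewrite -[X in measurable X]setTI; exact: measurable_snd.
    apply: measurable_lt_set; first exact: measurable_snd.
    by apply: measurableT_comp => //; exact: measurable_fst.
  apply/funext => z; rewrite /below indicE; congr (_%:R); congr nat_of_bool.
  apply/idP/idP; last by rewrite inE => -[/= -> ->].
  by move=> /andP[z0 zV]; rewrite inE.
transitivity (\int[lebesgue_measure]_y \int[P]_x (below (x, y) * h x)%:E)%E.
  rewrite -(fubini_tonelli (m1 := P) (m2 := lebesgue_measure)
    (fun z => (below z * h z.1)%:E)); last 2 first.
  - apply/measurable_EFinP; apply: measurable_funM => //.
    by apply: measurableT_comp => //; exact: measurable_fst.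
  - by move=> z; rewrite lee_fin mulr_ge0// /below ler0n.
  apply: eq_integral => x _.
  transitivity (\int[lebesgue_measure]_y ((h x)%:E * (\1_(`[0%R, V x[%classic : set R) y)%:E))%E.
    rewrite ge0_integralZl//; last 2 first.
    - by apply/measurable_EFinP; apply: measurable_indic; exact: measurable_itv.
    - by rewrite lee_fin.
    rewrite integral_indic//= setIT lebesgue_measure_itv/= lte_fin.
    rewrite mulrC EFinM; case: ltP => [V0'|V0']; first by rewrite oppr0 adde0.
    by rewrite (_ : V x = 0)//; apply/eqP; rewrite eq_le V0' V0.
  apply: eq_integral => y _; rewrite -EFinM mulrC; congr (_ * _)%:E.
  rewrite /below indicE/=; congr (_%:R); congr nat_of_bool.
  by apply/idP/idP; rewrite ?inE/= in_itv.
rewrite [RHS]integral_mkcond; apply: eq_integral => y _; rewrite patchE.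
have [y0|y0] := leP 0 (y : R); last first.
  rewrite memNset; last by rewrite /= in_itv/= leNgt y0.
  by apply: integral0_eq => x _; rewrite /below /= leNgt y0 mul0r.
rewrite mem_set; last by rewrite /= in_itv/= y0.
rewrite [RHS]integral_mkcond; apply: eq_integral => x _.
rewrite /below /= y0 /= patchE; case: ifPn; first by rewrite inE /= => ->; rewrite mul1r.
by rewrite notin_setE/= => /negP/negbTE ->; rewrite mul0r.
Qed.

(** This plays the part of taking out what is known: to compare two integrals
    against a weight known in [G], it is enough to compare them on [G]. *)
Lemma ge0_le_integral_weight (P : {sigma_finite_measure set T -> \bar R})
    (G : set_system T) (f g V : T -> R) :
  measurable_fun setT f -> measurable_fun setT g -> measurable_fun setT V ->
  (forall x, 0 <= f x) -> (forall x, 0 <= g x) -> (forall x, 0 <= V x) ->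
  (forall c, G [set x | c < V x]) ->
  (forall B, G B -> measurable B ->
    \int[P]_(x in B) (f x)%:E <= \int[P]_(x in B) (g x)%:E)%E ->
  (\int[P]_x (V x * f x)%:E <= \int[P]_x (V x * g x)%:E)%E.
Proof.
move=> mf mg mV f0 g0 V0 GV fg; rewrite !ge0_integral_layers//.
rewrite integral_mkcond [leRHS]integral_mkcond; apply: ge0_le_integralT => y.
  by apply: erestrict_ge0 => {}y _; apply: integral_ge0 => x _; rewrite lee_fin.
apply: lee_restrict => {}y _; apply: fg => //; exact: measurable_lt_set.
Qed.

(** With the time rounded up to a grid, the process takes on each cell the
    values of a single random variable. *)
Lemma measurable_at_random_time (X : R -> T -> R) (tau : T -> R) :
  (forall t, 0 <= t -> measurable_fun setT (X t)) ->
  (forall w t, 0 <= t -> X s w @[s --> t^'+] --> X t w) ->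
  measurable_fun setT tau -> (forall w, 0 <= tau w) ->
  measurable_fun setT (fun w => X (tau w) w).
Proof.
move=> mX rX mtau tau0.
apply: (measurable_fun_cvg (h := fun n w => X (grid n (grid_index n (tau w))) w)).
  move=> n; rewrite (_ : setT = \bigcup_i (tau @^-1` grid_cell n i)); last first.
    by rewrite -preimage_bigcup bigcup_grid_cell; apply/seteqP; split=> w //= _; rewrite in_itv/= andbT.
  have mc i : measurable (tau @^-1` grid_cell n i).
    by rewrite -[X in measurable X]setTI; apply: mtau => //; exact: measurable_grid_cell.
  apply/measurable_fun_bigcup => i //.
  apply: (eq_measurable_fun (X (grid n i))).
    by move=> w; rewrite inE => -[_ ->].
  by apply: measurable_funTS; apply: mX; exact: grid_ge0.
move=> w _; apply: (right_cvg_seq (f := X ^~ w)); first exact: rX.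
  by move=> n; have [] := grid_near n (tau0 w).
exact: grid_cvg.
Qed.

Lemma ge0_integral0_negligible (P : {measure set T -> \bar R}) (f : T -> R) :
  measurable_fun setT f -> (forall x, 0 <= f x) ->
  (\int[P]_x (f x)%:E <= 0)%E -> P.-negligible [set x | f x != 0].
Proof.
move=> mf f0 If; have mf' : measurable_fun setT (EFin \o f) by exact/measurable_EFinP.
have : (\int[P]_(x in setT) `|(EFin \o f) x| = 0)%E.
  apply/eqP; rewrite eq_le integral_ge0// andbT; apply: le_trans If.
  apply: ge0_le_integralT => // x; by rewrite /= ger0_norm.
move/(ae_eq_integral_abs P measurableT mf'); apply: negligibleS.
by move=> x /= fx H; move/eqP: fx; apply; have := H Logic.I; case.
Qed.

End generalities.

Section density.
Context d (T : measurableType d) (R : realType).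

(** Both sides are sliced along the superlevel sets of [f]. *)
Lemma ge0_integral_density (P : probability T R) (X : T -> R) (p f : R -> R) :
  measurable_fun setT X -> measurable_fun setT p -> (forall x, 0 <= p x) ->
  (forall U, measurable U ->
     P (X @^-1` U) = \int[lebesgue_measure]_(x in U) (p x)%:E)%E ->
  measurable_fun setT f -> (forall x, 0 <= f x) ->
  (\int[P]_w (f (X w))%:E = \int[lebesgue_measure]_x (f x * p x)%:E)%E.
Proof.
move=> mX mp p0 PX mf f0; rewrite ge0_integral_layers//.
transitivity (\int[P]_w (f (X w) * cst 1 w)%:E)%E.
  by apply: eq_integral => w _; rewrite mulr1.
have mfX : measurable_fun setT (f \o X) by exact: measurableT_comp.
rewrite (ge0_integral_layers P (V := f \o X))//; last by move=> w; exact: f0.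
apply: eq_integral => y _.
transitivity (\int[P]_(x in [set x | (y < (f \o X) x)%R]) cst 1%E x)%E => //.
rewrite integral_cst; last exact: measurable_lt_set.
by rewrite mul1e -PX//; exact: measurable_lt_set.
Qed.

End density.

(** * The dual projection after the honest time *)

Lemma honest_time_ge0 d (T : measurableType d) (R : realType)
    (F : R -> set_system T) (L : T -> \bar R) w : honest_time F L -> (0 <= L w)%E.
Proof. by move=> [_ [G _ ->]]; apply: ereal_sup_ubound; left. Qed.

Section dual_projection.
Context (R : realType) (d : measure_display) (T : measurableType d).
Variables (P : probability T R) (F : R -> set_system T).
Hypothesis usualF : usual_filtration P F.
Variable L : T -> \bar R.
Hypotheses (honestL : honest_time F L) (L_finite : P [set w | L w = +oo%E] = 0%E).
Variable A : T -> cumulative R R.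
Hypothesis dualA : dual_optional_projection P F L A.

Local Notation dA w := (lebesgue_stieltjes_measure (A w)).

Lemma adapted_measurable (X : R -> T -> R) t : adapted F X -> 0 <= t ->
  measurable_fun setT (X t).
Proof.
move=> aX t0 _ U mU; rewrite setTI.
by apply: (filtration_measurable usualF t0); exact: aX.
Qed.

Let A_before0 w t : t < 0 -> A w t = 0. Proof. exact: (dual_proj_before0 dualA). Qed.

Let A_nd w s t : s <= t -> A w s <= A w t.
Proof. by move=> st; apply: cumulative_is_nondecreasing. Qed.

Let A_ge0 w t : 0 <= A w t.
Proof.
have [t0|t0] := ltP t 0; first by rewrite A_before0.
rewrite -(A_before0 w (_ : -1 < 0)) ?ltrN10//; apply: A_nd.
by rewrite (le_trans _ t0)// lerN10.
Qed.

Let A_rc w t : A w s @[s --> t^'+] --> A w t.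
Proof. exact: cumulative_is_right_continuous. Qed.

Lemma dual_projection_measurable t : measurable_fun setT (fun w => A w t).
Proof.
have [t0|t0] := ltP t 0.
  by rewrite (_ : (fun _ => _) = cst 0)//; apply/funext => w; exact: A_before0.
exact: (adapted_measurable (dual_proj_adapted dualA)).
Qed.

Let Lf w : R := fine (L w).

Let Lf_ge0 w : 0 <= Lf w. Proof. by apply: fine_ge0; exact: honest_time_ge0 honestL. Qed.

Lemma end_finE w : L w <> +oo%E -> L w = (Lf w)%:E.
Proof.
move=> Loo; rewrite /Lf fineK// fin_numE; apply/andP; split; last exact/eqP.
by apply/eqP => Lw; have := honest_time_ge0 w honestL; rewrite Lw.
Qed.

Let mL : measurable_fun setT L. Proof. by case: honestL. Qed.

Let mLf : measurable_fun setT Lf.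
Proof. by apply: measurableT_comp => //; exact: fine_measurable. Qed.

Lemma negligible_end_infty : P.-negligible [set w | L w = +oo%E].
Proof.
exists [set w | L w = +oo%E]; split=> //.
by rewrite -[X in measurable X]setTI; exact: (mL measurableT (emeasurable_set1 +oo%E)).
Qed.

(** The limit of the dual projection is expressed by its value at the honest
    time, with which it agrees almost surely by [at_infty_terminal]: this value
    is measurable at once and no limit has to be taken. *)
Definition terminal (w : T) : R := A w (fine (L w)).

Lemma measurable_terminal : measurable_fun setT terminal.
Proof.
apply: (measurable_at_random_time (X := fun t w => A w t)) => // t t0.
exact: dual_projection_measurable.
Qed.

Lemma measurable_before_end (delta : R) :
  measurable_fun setT (fun w => A w (Lf w - delta)).
Proof.
apply: (measurable_at_random_time (X := fun t w => A w (t - delta))) => //.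
  by move=> t t0; exact: dual_projection_measurable.
move=> w t t0; apply/cvgrPdist_lt => e e0.
have [r r0 rP] := right_cvg_dist (@A_rc w (t - delta)) e0.
near=> s; apply: rP.
  by rewrite lerD2r ltW//; near: s; exact: nbhs_right_gt.
by rewrite addrAC ltrD2r; near: s; apply: nbhs_right_lt; rewrite ltrDl.
Unshelve. all: by end_near. Qed.

Lemma terminal_ge0 w : 0 <= terminal w. Proof. exact: A_ge0. Qed.

Section bounded_integrand.
Variable H : R -> T -> R.
Hypotheses (aH : adapted F H) (cH : cadlag H).
Hypothesis H0 : forall t w, 0 <= t -> 0 <= H t w.
Hypothesis bH : bounded_process H.

Lemma ge0_dual_projE :
  (\int[P]_w \int[dA w]_(s in `[0%R, +oo[) (H s w)%:E = 'E_P[at_time H L])%E.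
Proof. by apply: (dual_projE dualA) => //; exact: optional_cadlag. Qed.

(** The Stieltjes integral of the path is replaced by sums over a grid, whose
    terms are integrable random variables to which conditioning applies. *)
Lemma dual_projection_grid_fatou :
  ('E_P[at_time H L] <= limn_einf (fun n => \sum_(i <oo)
     \int[P]_w (H (grid n i) w *
        (A w (grid n i) - A w (grid n i - n.+1%:R^-1)))%:E))%E.
Proof.
have D0 n i w : 0 <= A w (grid n i) - A w (grid n i - n.+1%:R^-1).
  by rewrite subr_ge0 A_nd// gerBl invr_ge0.
have HD0 n i w : 0 <= H (grid n i) w * (A w (grid n i) - A w (grid n i - n.+1%:R^-1)).
  by rewrite mulr_ge0// H0// grid_ge0.
have mHD n i : measurable_fun setT (fun w =>
    (H (grid n i) w * (A w (grid n i) - A w (grid n i - n.+1%:R^-1)))%:E).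
  apply/measurable_EFinP; apply: measurable_funM.
    by apply: (adapted_measurable aH); exact: grid_ge0.
  by apply: measurable_funB; exact: dual_projection_measurable.
rewrite -ge0_dual_projE.
apply: (@le_trans _ _ (\int[P]_w limn_einf (fun n => \sum_(i <oo)
    (H (grid n i) w * (A w (grid n i) - A w (grid n i - n.+1%:R^-1)))%:E))%E).
  apply: ge0_le_integralT => w.
    by apply: integral_ge0 => s; rewrite /= in_itv/= andbT => s0; rewrite lee_fin H0.
  apply: (stieltjes_grid_fatou (A_before0 w) (h := H ^~ w)) => s s0; first exact: H0.
  by have [+ _] := cH w; exact.
apply: le_trans (fatou P measurableT _ _) _.
- move=> n; apply: ge0_emeasurable_sum => [i w _ _|i _]; last exact: mHD.
  by rewrite lee_fin.
- by move=> n w _; apply: nneseries_ge0 => i _ _; rewrite lee_fin.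
rewrite le_eqVlt; apply/orP; left; apply/eqP; congr limn_einf; apply/funext => n.
by rewrite integral_nneseries// => i w _; rewrite lee_fin.
Qed.

End bounded_integrand.

Lemma at_time_fine (H : R -> T -> R) w : L w <> +oo%E -> at_time H L w = H (Lf w) w.
Proof. by move=> /end_finE E; rewrite /at_time E. Qed.

(** The process of [elapsed_process] has a null integral against [dA], and it
    is at least [k.+1%:R^-1] on the times between [L + k.+1%:R^-1] and [N]. *)
Let after_end_step (N : nat) (k : nat) :
  P.-negligible [set w | A w (Lf w + k.+1%:R^-1) < A w N%:R].
Proof.
have [_ [Gamma oG LE]] := honestL.
have [H [aH cH H01 HL HgtL]] := elapsed_process usualF oG.
have bH : bounded_process H.
  exists 1 => t w t0; have /andP[h0 h1] := H01 t w t0; by rewrite ger0_norm.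
have EH : ('E_P[at_time H L] = 0)%E.
  rewrite unlock; apply: integral0_eq => w _; rewrite /at_time.
  by case Lw : (L w) => [t| |]//; rewrite HL// -LE.
have HdA := ge0_dual_projE aH cH bH; rewrite EH in HdA.
pose e : R := k.+1%:R^-1; have e0 : 0 < e by rewrite invr_gt0.
have e1 : e <= 1 by rewrite invf_le1// ler1n.
pose f w := e * Num.max 0 (A w N%:R - A w (Lf w + e)).
have mf : measurable_fun setT f.
  apply: measurable_funM => //; apply: measurable_maxr => //.
  apply: measurable_funB; first exact: dual_projection_measurable.
  apply: (measurable_at_random_time (X := fun t w => A w t) (tau := fun w => Lf w + e)) => //.
  - by move=> t _; exact: dual_projection_measurable.
  - exact: measurable_funD.
  - by move=> w; rewrite addr_ge0// ltW.
have f0 w : 0 <= f w by rewrite mulr_ge0 ?(ltW e0)// le_max lexx.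
apply: negligibleS (ge0_integral0_negligible mf f0 _) => [w /= AA|].
  by rewrite mulf_neq0 ?gt_eqF// lt_max subr_gt0 AA orbT.
rewrite -HdA; apply: (ge0_le_integral_outside negligible_end_infty) => w.
- by rewrite lee_fin.
- apply: integral_ge0 => s; rewrite /= in_itv/= andbT => s0.
  by rewrite lee_fin; have /andP[] := H01 s w s0.
move=> /= Lw; have LwE := end_finE Lw.
have [NL|LN] := leP N%:R (Lf w + e).
  rewrite /f max_l ?mulr0; last by rewrite subr_le0 A_nd.
  apply: integral_ge0 => s; rewrite /= in_itv/= andbT => s0.
  by rewrite lee_fin; have /andP[] := H01 s w s0.
have mH : measurable_fun (`[0%R, +oo[%classic : set R) (fun s => (H s w)%:E).
  apply/measurable_EFinP; apply: measurable_right_continuous => s s0.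
  by have [+ _] := cH w; exact.
pose I : set R := `]Lf w + e, N%:R]%classic.
have IE (s : R) : I s -> 0 <= s.
  rewrite /I /= in_itv/= => /andP[+ _] => /ltW; apply: le_trans.
  by rewrite addr_ge0// ltW.
have mI : measurable I by exact: measurable_itv.
have step1 : (\int[dA w]_(s in I) (H s w)%:E <=
    \int[dA w]_(s in `[0%R, +oo[) (H s w)%:E)%E.
  apply: ge0_subset_integral => //.
    by move=> s; rewrite /= in_itv/= andbT => s0; rewrite lee_fin; have /andP[] := H01 s w s0.
  by move=> s /IE; rewrite /= in_itv/= andbT.
apply: le_trans step1.
have step2 : (\int[dA w]_(s in I) cst e%:E s <= \int[dA w]_(s in I) (H s w)%:E)%E.
  apply: ge0_le_integral => //.
  - by move=> s _; rewrite lee_fin ltW.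
  - apply: measurable_funS mH => //; move=> s /IE.
    by rewrite /= in_itv/= andbT.
  move=> s; rewrite /I /= in_itv/= => /andP[Ls sN]; rewrite lee_fin.
  have := HgtL w (Lf w) s; rewrite -LE => /(_ LwE) HgtLs; apply: le_trans (HgtLs _).
    by rewrite le_min e1 lerBrDl ltW.
  by rewrite (le_lt_trans _ Ls)// lerDl ltW.
apply: le_trans step2.
rewrite integral_cst//; rewrite [X in (_ <= _ * X)%E](stieltjes_oc (A w) (ltW LN)).
by rewrite -EFinM lee_fin /f max_r// subr_ge0 A_nd// ltW.
Qed.

(** Countably many null sets rule out any growth at a positive distance after
    the honest time; right-continuity brings the distance to zero. *)
Lemma le_terminal : P.-negligible [set w | ~ forall t, A w t <= terminal w].
Proof.
have neg : P.-negligible (\bigcup_N \bigcup_k [set w | A w (Lf w + k.+1%:R^-1) < A w N%:R]).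
  by apply: negligible_bigcup => N; apply: negligible_bigcup => k; exact: after_end_step.
apply: negligibleS neg => w /= H; apply: contrapT => nw; apply: H => t.
have [N tN] : exists N : nat, t <= N%:R.
  by exists (Num.trunc `|t|).+1; rewrite (le_trans (ler_norm t))// ltW// truncnS_gt.
apply: (le_trans (A_nd w tN)); apply/ler_addgt0Pr => e e0.
have [r r0 rP] := right_cvg_dist (@A_rc w (Lf w)) e0.
have [k _ /(_ k (leqnn k)) /= kr] := near_infty_natSinv_lt (PosNum r0).
have [|Ak] := ltP (A w (Lf w + k.+1%:R^-1)) (A w N%:R).
  by move=> Ak; exfalso; apply: nw; exists N => //; exists k.
apply: (le_trans Ak); have := rP (Lf w + k.+1%:R^-1).
rewrite lerDl invr_ge0 ler0n ltrD2l => /(_ isT kr).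
by rewrite ltr_distlC => /andP[_ /ltW].
Qed.

Lemma at_infty_terminal :
  P.-negligible [set w | at_infty (fun t w => A w t) w <> terminal w].
Proof.
have [N [mN N0 HN]] : P.-negligible ([set w | ~ forall t, A w t <= terminal w] `|` [set w | L w = +oo%E]).
  by apply: negligibleU; [exact: le_terminal|exact: negligible_end_infty].
exists N; split=> // w /= aw; apply: HN; apply: contrapT => /not_orP[/contrapT tw _].
apply: aw; rewrite /at_infty; apply/cvg_lim => //.
apply/cvgrPdist_lt => e e0; near=> t.
rewrite ger0_norm ?subr_ge0//.
suff -> : A w t = terminal w by rewrite subrr.
apply/eqP; rewrite eq_le tw/=; apply: A_nd; near: t.
by apply: nbhs_pinfty_ge; rewrite num_real.
Unshelve. all: by end_near. Qed.

End dual_projection.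

(** * An equation for the law of the terminal value *)

Section terminal_law.
Context (R : realType) (d : measure_display) (T : measurableType d).
Variables (P : probability T R) (F : R -> set_system T).
Hypothesis usualF : usual_filtration P F.
Variable L : T -> \bar R.
Hypotheses (honestL : honest_time F L) (L_finite : P [set w | L w = +oo%E] = 0%E).
Hypothesis L_avoids : avoids_stopping_times P F L.
Variable A : T -> cumulative R R.
Hypothesis dualA : dual_optional_projection P F L A.

Local Notation dA w := (lebesgue_stieltjes_measure (A w)).
Local Notation terminal := (terminal L A).
Local Notation Lf w := (fine (L w)).

Let A_before0 w t : t < 0 -> A w t = 0. Proof. exact: (dual_proj_before0 dualA). Qed.

Let A_nd w s t : s <= t -> A w s <= A w t.
Proof. by move=> st; apply: cumulative_is_nondecreasing. Qed.

Section level.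
Variable a : R.
Hypothesis a0 : 0 < a.

(** The lag [delta] is what turns the upper bound [below_le] into the lower
    bound [le_below]: the lagged integrand is still 1 at the time when the
    level is crossed. *)
Let below (delta s : R) (w : T) : R := ((A w (s - delta) < a)%R)%:R.

Let below01 delta s w : 0 <= below delta s w <= 1.
Proof. by rewrite /below; case: (_ < _); rewrite ?ler01 ?lexx. Qed.

Let below_adapted delta : 0 <= delta -> adapted F (below delta).
Proof.
move=> delta0 t t0; have sF := filtration_sigma_algebra usualF t0.
apply: (measurable_wrt_lt sF) => c.
have mF : F t [set w | A w (t - delta) < a].
  have [td|td] := ltP (t - delta) 0.
    rewrite [X in F t X](_ : _ = setT); first exact: sigma_algebraT.
    by apply/seteqP; split=> w //= _; rewrite A_before0.
  apply: (filtration_nondecreasing usualF td); first by rewrite gerBl.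
  exact: (measurable_wrt_ltP (X := fun w => A w (t - delta)) _ (dual_proj_adapted dualA td)).
rewrite (_ : [set w | _] = [set w | (1 < c :> R) /\ A w (t - delta) < a] `|`
    [set w | (0 < c :> R) /\ (~` [set w | A w (t - delta) < a]) w]).
  apply: (sigma_algebraU sF); apply: (sigma_algebra_and sF) => //.
  exact: (sigma_algebraC sF).
apply/seteqP; split=> w; rewrite /below /=; case: (boolP (_ < a)) => Aa.
- by left.
- by right; split=> //; exact/negP.
- by move=> [[]|[]].
- by move=> [[]|[]].
Qed.

Let below_cadlag delta : cadlag (below delta).
Proof.
have cB : cadlag (fun s w => ((a <= A w (s - delta))%R)%:R : R).
  apply: cadlag_nondecreasing => [w s t st|w t e e0].
    have [aA|] := leP a (A w (s - delta)); last by rewrite ler0n.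
    by rewrite (le_trans aA)// A_nd// lerB.
  have [aA|aA] := leP a (A w (t - delta)).
    exists (t + 1); first by rewrite ltrDl.
    by case: (a <= _) => /=; [rewrite ltrDl|rewrite addr_gt0].
  have Aa0 : 0 < a - A w (t - delta) by rewrite subr_gt0.
  have rc : A w s @[s --> (t - delta)^'+] --> A w (t - delta).
    exact: cumulative_is_right_continuous.
  have [r r0 rP] := right_cvg_dist rc Aa0.
  exists (t + r / 2); first by rewrite ltrDl divr_gt0.
  rewrite (_ : _ <= _ = false) ?add0r//; apply/negbTE; rewrite -ltNge.
  have := rP (t - delta + r / 2); rewrite lerDl divr_ge0 ?ltW// ltrD2l.
  rewrite gtr_pMr// invf_lt1// ltr1n => /(_ isT isT).
  by rewrite ltr_distlC => /andP[_]; rewrite addrAC addrCA subrr addr0.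
have c1 : continuous (fun x : R => 1 - x).
  by move=> x; apply: cvgB; [exact: cvg_cst|exact: cvg_id].
have := cadlag_comp c1 cB; congr cadlag; apply/funext => s; apply/funext => w.
by rewrite /below; case: leP => _; rewrite ?subrr ?subr0.
Qed.

Let below_at_end delta : 0 <= delta ->
  ('E_P[at_time (below delta) L] = P [set w | (A w (Lf w - delta) < a)%R])%E.
Proof.
move=> delta0.
have mX := measurable_before_end usualF honestL dualA delta.
have mS : measurable [set w | A w (Lf w - delta) < a] by exact: measurable_lt_set.
set S := [set w | _] in mS *.
have -> : P S = (\int[P]_w (\1_S w)%:E)%E by rewrite integral_indic// setIT.
rewrite unlock.
apply: (eq_integral_outside (negligible_end_infty honestL L_finite)).
move=> w /= Lw; rewrite (at_time_fine honestL)// /below indicE; congr (_%:R)%:E.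
by congr nat_of_bool; apply/idP/idP; rewrite inE.
Qed.

Let below_dualE delta : 0 <= delta ->
  (\int[P]_w \int[dA w]_(s in `[0%R, +oo[) (below delta s w)%:E =
   P [set w | (A w (Lf w - delta) < a)%R])%E.
Proof.
move=> delta0; rewrite -below_at_end//.
apply: (ge0_dual_projE dualA); [exact: below_adapted|exact: below_cadlag|].
by exists 1 => t w _; have /andP[b0 b1] := below01 delta t w; rewrite ger0_norm.
Qed.

(** In the Riemann sums an increment only counts when the path is still below
    the level at the end of the cell, so the partial sums never exceed it. *)
Let below_le w : (forall t, A w t <= terminal w) ->
  (\int[dA w]_(s in `[0%R, +oo[) (below 0 s w)%:E <= (Num.min a (terminal w))%:E)%E.
Proof.
move=> Aw; apply: (le_trans (stieltjes_grid_fatou (A_before0 w) (h := fun s => below 0 s w) _ _)).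
- by move=> s _; case/andP: (below01 0 s w).
- by move=> s s0; have [+ _] := below_cadlag 0 w; exact.
apply: limn_einf_le => n.
pose u i := below 0 (grid n i) w * (A w (grid n i) - A w (grid n i - n.+1%:R^-1)).
have u0 i : 0 <= u i.
  have /andP[b0 _] := below01 0 (grid n i) w.
  by apply: mulr_ge0 => //; rewrite subr_ge0 A_nd// gerBl invr_ge0.
have uN N : \sum_(i < N) u i <= Num.min a (A w (grid n N - n.+1%:R^-1)).
  elim: N => [|N IH].
    by rewrite big_ord0 le_min (ltW a0)/= A_before0// /grid mul0r sub0r oppr_lt0 invr_gt0.
  have gN : grid n N.+1 - n.+1%:R^-1 = grid n N :> R.
    by rewrite /grid -[X in _ - X]mul1r -mulrBl -natr1 addrK.
  rewrite big_ord_recr/= gN; move: IH; rewrite /u /below subr0 !le_min.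
  move=> /andP[IHa IHA]; have [Aa|Aa] := ltP (A w (grid n N)) a.
    have H : \sum_(i < N) u i + 1 * (A w (grid n N) - A w (grid n N - n.+1%:R^-1)) <= A w (grid n N).
      by rewrite mul1r addrCA gerDl subr_le0.
    by rewrite (le_trans H (ltW Aa)) H.
  rewrite mul0r addr0 IHa/= (le_trans IHA)// A_nd// gerBl.
  by rewrite invr_ge0.
apply: lime_le; first by apply: is_cvg_nneseries => i _ _; rewrite lee_fin; exact: u0.
apply: nearW => N; rewrite big_mkord sumEFin lee_fin (le_trans (uN N))//.
by rewrite le_min !ge_min lexx Aw orbT.
Qed.

Let le_below delta w : 0 < delta ->
  ((Num.min a (terminal w))%:E <= \int[dA w]_(s in `[0%R, +oo[) (below delta s w)%:E)%E.
Proof.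
move=> delta0.
suff [s [s0 As]] : exists s, [/\ 0 <= s, Num.min a (terminal w) <= A w s &
    forall r, r <= s -> A w (r - delta) < a].
  move=> sP; apply: (@le_trans _ _ (A w s)%:E); first by rewrite lee_fin.
  rewrite -(stieltjes_0c (A_before0 w) s0).
  have -> : dA w `[0, s] = (\int[dA w]_(r in (`[0%R, s]%classic : set R)) cst 1%E r)%E.
    by rewrite integral_cst// mul1e.
  have mb : measurable_fun (`[0%R, +oo[%classic : set R) (fun r => (below delta r w)%:E).
    apply/measurable_EFinP; apply: measurable_right_continuous => r r0.
    by have [+ _] := below_cadlag delta w; exact.
  have step : (\int[dA w]_(r in (`[0%R, s]%classic : set R)) (below delta r w)%:E <=
      \int[dA w]_(r in `[0%R, +oo[) (below delta r w)%:E)%E.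
    apply: ge0_subset_integral => //.
      by move=> r _; rewrite lee_fin; case/andP: (below01 delta r w).
    by move=> r; rewrite /= !in_itv/= andbT => /andP[].
  apply: le_trans step; rewrite le_eqVlt; apply/orP; left; apply/eqP.
  apply: eq_integral => r; rewrite inE/= in_itv/= => /andP[_ rs].
  by rewrite /below sP.
have tE : terminal w = A w (Lf w) by [].
have Lw0 : 0 <= Lf w.
  by apply: fine_ge0; exact: honest_time_ge0 honestL.
have [ta|at_] := ltP (terminal w) a.
  exists (Lf w); split; [exact: Lw0|by rewrite tE|].
  move=> r rL; apply: le_lt_trans ta; rewrite tE; apply: A_nd.
  by rewrite (le_trans _ rL)// gerBl ltW.
have ex : exists k : nat, A w (Lf w - k.+1%:R * delta) < a.
  exists (Num.trunc (Lf w / delta)).+1; rewrite A_before0// subr_lt0.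
  rewrite -ltr_pdivrMr//; apply: (lt_trans (truncnS_gt _)); by rewrite ltr_nat.
(* Going back from the honest time by steps of length delta, stop at the last
   point where the path is still above the level. *)
pose k := ex_minn ex.
have [Ak kmin] : A w (Lf w - k.+1%:R * delta) < a /\
    forall j, A w (Lf w - j.+1%:R * delta) < a -> (k <= j)%N.
  by rewrite /k; case: ex_minnP.
have As : a <= A w (Lf w - k%:R * delta).
  case: k Ak kmin => [_ _|k Ak kmin]; first by rewrite mul0r subr0 -tE.
  by rewrite leNgt; apply/negP => /kmin; rewrite ltnn.
exists (Lf w - k%:R * delta); split.
- by rewrite leNgt; apply/negP => s0; move: As; rewrite A_before0// leNgt a0.
- exact: As.
move=> r rs; apply: le_lt_trans Ak; apply: A_nd.
by move: rs; rewrite -natr1 mulrDl mul1r opprD addrA lerD2r.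
Qed.

(** The honest time avoids this stopping time, and equality with it is the only
    obstruction to the continuity of the lagged bound as the lag vanishes. *)
Let hitting (w : T) : \bar R := ereal_inf [set t%:E | t in [set t | 0 <= t /\ a <= A w t]].

Let hitting_le w t : 0 <= t -> (hitting w <= t%:E)%E <-> a <= A w t.
Proof.
move=> t0; split=> [ht|aA]; last by apply: ereal_inf_lbound; exists t.
have rc : A w s @[s --> t^'+] --> A w t by exact: cumulative_is_right_continuous.
apply/ler_addgt0Pr => e e0; have [r r0 rP] := right_cvg_dist rc e0.
have : (hitting w < (t + r)%:E)%E by rewrite (le_lt_trans ht)// lte_fin ltrDl.
move=> /ereal_inf_lt[_ [s [s0 aA] <-]]; rewrite lte_fin => str.
have [st|ts] := leP s t; first by rewrite (le_trans aA)// (le_trans (A_nd w st))// lerDl ltW.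
have := rP s (ltW ts) str; rewrite ltr_distlC => /andP[_ /ltW].
exact: le_trans.
Qed.

Let hitting_stopping : stopping_time F hitting.
Proof.
split=> [w|t t0]; first by apply: le_ereal_inf_tmp => _ [t [t0 _] <-]; rewrite lee_fin.
have sF := filtration_sigma_algebra usualF t0.
rewrite (_ : [set w | _] = ~` [set w | A w t < a]).
  apply: (sigma_algebraC sF); apply: (measurable_wrt_ltP (X := fun w => A w t)).
  exact: (dual_proj_adapted dualA).
by apply/seteqP; split=> w /=; rewrite (hitting_le w t0) leNgt => /negP.
Qed.

(** The integrals of [below 0] and [below delta] enclose the minimum, and their
    expectations are P(A_L < a) and P(A_(L - delta) < a). If the second event
    holds for all [delta] while the first does not, then [A] reaches the level
    exactly at the honest time. *)
Lemma terminal_lt : (P [set w | (terminal w < a)%R] =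
  \int[P]_w (Num.min a (terminal w))%:E)%E.
Proof.
have min0 w : 0 <= Num.min a (terminal w).
  by rewrite le_min (ltW a0) (terminal_ge0 dualA).
apply/eqP; rewrite eq_le; apply/andP; split.
  rewrite (_ : [set w | _] = [set w | A w (Lf w - 0) < a]); last first.
    by apply/seteqP; split=> w; rewrite /= subr0.
  rewrite -below_dualE//.
  apply: (ge0_le_integral_outside (le_terminal usualF honestL L_finite dualA)) => w.
  - by apply: integral_ge0 => s _; rewrite lee_fin; case/andP: (below01 0 s w).
  - by rewrite lee_fin.
  by move=> /contrapT; exact: below_le.
pose B (k : nat) := [set w | A w (Lf w - k.+1%:R^-1) < a].
have ltB k : (\int[P]_w (Num.min a (terminal w))%:E <= P (B k))%E.
  rewrite -below_dualE//; apply: ge0_le_integralT => w; first by rewrite lee_fin.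
  by apply: le_below; rewrite invr_gt0.
have mLf : measurable_fun setT (fun w => Lf w).
  by apply: measurableT_comp; [exact: fine_measurable|case: honestL].
have L0 w : (0 <= L w)%E by exact: honest_time_ge0 honestL.
have mB k : measurable (B k).
  have mX : measurable_fun setT (fun w => A w (Lf w - k.+1%:R^-1)).
    exact: (measurable_before_end usualF honestL dualA).
  exact: measurable_lt_set.
have niB : {homo B : n m / (n <= m)%N >-> (m <= n)%O}.
  move=> n m nm; apply/subsetPset => w; apply: le_lt_trans; apply: A_nd.
  by rewrite lerB// lef_pV2 ?posrE// ler_nat ltnS.
have cB := nonincreasing_cvg_mu (le_lt_trans (probability_le1 P (mB 0%N)) (ltry 1)) mB
  (bigcapT_measurable mB) niB.
apply: (@le_trans _ _ (P (\bigcap_k B k))).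
  rewrite -(cvg_lim _ cB)//; apply: lime_ge; first by apply/cvg_ex; eexists; exact: cB.
  by apply: nearW => k /=.
have mt : measurable [set w | terminal w < a].
  by apply: measurable_lt_set => //; exact: (measurable_terminal usualF honestL dualA).
have mI : measurable (\bigcap_k B k) by exact: bigcapT_measurable.
have neg : P (\bigcap_k B k `\` [set w | terminal w < a]) = 0%E.
  apply: measure_negligible; first by apply: measurableD.
  have negU : P.-negligible ([set w | L w = hitting w] `|` [set w | L w = +oo%E]).
    apply: negligibleU; last exact: (negligible_end_infty honestL L_finite).
    exists [set w | L w = hitting w]; split=> //; last exact: L_avoids hitting_stopping.
    have [hit0 mhit] := hitting_stopping.
    have mh : measurable_fun setT hitting.
      move=> _; apply: (measurability _ (ErealGenOInfty.measurableE R)) => // _ [_ [x ->] <-].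
      rewrite setTI; have [x0|x0] := ltP x 0.
        rewrite (_ : _ @^-1` _ = setT)//; apply/seteqP; split=> w //= _.
        by rewrite in_itv/= andbT (lt_le_trans _ (hit0 w))// lte_fin.
      rewrite (_ : _ @^-1` _ = ~` [set w | (hitting w <= x%:E)%E]).
        by apply: measurableC; apply: (filtration_measurable usualF x0); exact: mhit.
      apply/seteqP; split=> w; rewrite /= in_itv/= andbT ltNge; first by move/negP.
      by move/negP.
    have mL : measurable_fun setT L by case: honestL.
    by rewrite -[X in measurable X]setTI; exact: measurable_eqe.
  apply: negligibleS negU => w [Bw /= /negP]; rewrite -leNgt => aterm.
  have [Lw|Lw] := pselect (L w = +oo%E); [by right|left].
  have LwE := end_finE honestL Lw.
  apply/eqP; rewrite /= eq_le; apply/andP; split; last first.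
    rewrite LwE; apply/hitting_le => //; exact: fine_ge0.
  apply: le_ereal_inf_tmp => _ [s [s0 aA] <-]; rewrite LwE lee_fin.
  apply/ler_addgt0Pr => e e0.
  have [k _ /(_ k (leqnn k)) /= ke] := near_infty_natSinv_lt (PosNum e0).
  have := Bw k Logic.I; rewrite /B /= => Ak.
  rewrite -lerBlDr (le_trans (_ : _ <= Lf w - k.+1%:R^-1))//.
    by rewrite lerB// ltW.
  rewrite leNgt; apply/negP => /ltW/(A_nd w) sL.
  by move: (le_lt_trans (le_trans aA sL) Ak); rewrite ltxx.
rewrite -(setUIDK (\bigcap_k B k) [set w | terminal w < a]).
rewrite measureU//; last 3 first.
- exact: measurableI.
- exact: measurableD.
- by rewrite setDE setIACA setICr setI0.
rewrite [X in (_ + X)%E]neg adde0.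
by apply: le_measure; rewrite ?inE//; exact: measurableI.
Qed.

End level.
End terminal_law.

(** * The exponential law *)

Section exponential_law.
Context {R : realType}.
Local Notation mu := (@lebesgue_measure R).

(** The hypothesis is a discrete form of [h' = - h]. Over a step of length [e]
    the product [h y * expR y] is multiplied by a factor between [1 - e ^+ 2]
    and its inverse, so [n] steps of length [x / n] change it by a term of order
    [x ^+ 2 / n]. *)
Lemma expRN_unique (h : R -> R) : h 0 = 1 -> (forall x, 0 <= h x) ->
  (forall a b, 0 <= a -> a < b ->
     (b - a) * h b <= h a - h b /\ h a - h b <= (b - a) * h a) ->
  forall x, 0 <= x -> h x = expR (- x).
Proof.
move=> h0 hge0 hab x; rewrite le_eqVlt => /predU1P[<-|x0].
  by rewrite h0 oppr0 expR0.
pose k y := h y * expR y.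
have k0 y : 0 <= k y by rewrite mulr_ge0// expR_ge0.
have step y e : 0 <= y -> 0 < e -> e < 1 ->
    k y * (1 - e ^+ 2) <= k (y + e) /\ k (y + e) * (1 - e ^+ 2) <= k y.
  move=> y0 e0 e1; have [] := hab y (y + e) y0; first by rewrite ltrDl.
  rewrite addrAC subrr add0r /k expRD => hu hl.
  have e1N : 0 < 1 - e by rewrite subr_gt0.
  have Ee : 1 + e <= expR e by exact: expR_ge1Dx.
  have EeN : expR e * (1 - e) <= 1.
    have := expR_ge1Dx (- e); rewrite expRN => EN.
    by rewrite mulrC -ler_pdivlMr ?expR_gt0// div1r.
  have Ey := expR_gt0 y; have Ee0 := expR_gt0 e.
  have H1 : h y * (1 - e) <= h (y + e) by move: hl; move: (h y) (h (y + e)) => u v; lra.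
  have H2 : h (y + e) * (1 + e) <= h y by move: hu; move: (h y) (h (y + e)) => u v; lra.
  split.
    have : h y * (1 - e) * (1 + e) <= h (y + e) * expR e.
      apply: ler_pM => //; first by rewrite mulr_ge0// ltW.
      by rewrite addr_ge0// ltW.
    rewrite -(ler_pM2r Ey); move: (h y) (h (y + e)) (expR y) (expR e) => u v p q; lra.
  have : h (y + e) * (1 + e) * (expR e * (1 - e)) <= h y * 1.
    apply: ler_pM => //; first by rewrite mulr_ge0// addr_ge0// ltW.
    by rewrite mulr_ge0// ltW.
  rewrite -(ler_pM2r Ey); move: (h y) (h (y + e)) (expR y) (expR e) => u v p q; lra.
have bound (n : nat) e : 0 < e -> e < 1 ->
    1 - n%:R * e ^+ 2 <= k (n%:R * e) /\ k (n%:R * e) * (1 - n%:R * e ^+ 2) <= 1.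
  move=> e0 e1; elim: n => [|n [IH1 IH2]].
    by rewrite !mul0r subr0 mulr1 /k h0 expR0 mulr1.
  have [] := step (n%:R * e) e _ e0 e1; first by rewrite mulr_ge0// ltW.
  rewrite (_ : n%:R * e + e = n.+1%:R * e); last by rewrite -natr1 mulrDl mul1r.
  have v0 := k0 (n.+1%:R * e); have u0 := k0 (n%:R * e).
  have n0 : 0 <= n%:R :> R by [].
  have q0 : 0 <= e ^+ 2 by rewrite sqr_ge0.
  have q1 : e ^+ 2 <= 1 by rewrite expr_le1// ltW.
  move: (k (n.+1%:R * e)) (k (n%:R * e)) IH1 IH2 v0 u0 => v u + + v0 u0.
  rewrite -natr1; move: (n%:R) (e ^+ 2) n0 q0 q1 => N q N0 q0 q1 IH1 IH2 s1 s2.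
  split; first by nra.
  have [Nq|Nq] := leP 0 (1 - N * q); last by nra.
  have : v * (1 - q) * (1 - N * q) <= u * (1 - N * q) by apply: ler_wpM2r.
  have : 0 <= v * (q * (N * q)) by rewrite !mulr_ge0.
  lra.
have lim n : x < n.+1%:R -> 1 - x ^+ 2 / n.+1%:R <= k x /\ k x * (1 - x ^+ 2 / n.+1%:R) <= 1.
  move=> xn; have := bound n.+1 (x / n.+1%:R).
  have -> : n.+1%:R * (x / n.+1%:R) = x by rewrite mulrC divfK.
  have -> : n.+1%:R * (x / n.+1%:R) ^+ 2 = x ^+ 2 / n.+1%:R :> R.
    by rewrite exprMn exprVn; field.
  by apply; rewrite ?divr_gt0// ltr_pdivrMr// mul1r.
have small e : 0 < e -> exists n : nat, x < n.+1%:R /\ x ^+ 2 / n.+1%:R <= e.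
  move=> e0; exists (Num.trunc (x + x ^+ 2 / e)).
  have := truncnS_gt (x + x ^+ 2 / e); set n := _.+1 => xn.
  have x2 : 0 <= x ^+ 2 / e by rewrite divr_ge0 ?sqr_ge0// ltW.
  split; first by rewrite (le_lt_trans _ xn)// lerDl.
  by rewrite ler_pdivrMr// mulrC -ler_pdivrMr// (le_trans _ (ltW xn))// lerDr ltW.
have : k x = 1.
  apply/eqP; rewrite eq_le; apply/andP; split; apply/ler_addgt0Pr => e e0.
    have [n [xn xe]] := small (e / (1 + e)) (divr_gt0 e0 (addr_gt0 ltr01 e0)).
    have [_ kx] := lim n xn.
    have : k x * (1 - e / (1 + e)) <= 1.
      by apply: le_trans kx; apply: ler_wpM2l => //; rewrite lerB.
    have -> : 1 - e / (1 + e) = (1 + e)^-1.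
      by field; rewrite gt_eqF// addr_gt0.
    by rewrite ler_pdivrMr ?mul1r// addr_gt0.
  have [n [xn xe]] := small e e0; have [kx _] := lim n xn.
  by rewrite -lerBlDr (le_trans _ kx)// lerB.
rewrite /k => kx; apply/(mulIf (lt0r_neq0 (expR_gt0 x))).
by rewrite kx -expRD addNr expR0.
Qed.

Lemma exponential_integralE (f : R -> R) :
  (\int[mu]_x (f x * exponential_pdf 1 x)%:E =
   \int[mu]_(x in `[0%R, +oo[) (expR (- x) * f x)%:E)%E.
Proof.
rewrite [RHS]integral_mkcond; apply: eq_integral => x _; rewrite patchE.
rewrite /exponential_pdf patchE; case: ifPn => _; last by rewrite mulr0.
by rewrite mul1r mulN1r mulrC.
Qed.

Lemma ge0_integral_exponential d (T : measurableType d) (P : probability T R)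
    (X : T -> R) (f : R -> R) : measurable_fun setT X ->
  (forall U, measurable U -> P (X @^-1` U) = exponential_prob 1 U) ->
  measurable_fun setT f -> (forall x, 0 <= f x) ->
  (\int[P]_w (f (X w))%:E = \int[mu]_(x in `[0%R, +oo[) (expR (- x) * f x)%:E)%E.
Proof.
move=> mX PX mf f0; rewrite -exponential_integralE.
apply: ge0_integral_density => //; first exact: measurable_exponential_pdf.
by move=> x; exact: exponential_pdf_ge0.
Qed.

(** Let [h] be the tail function of [X]. The function [min(b, X) - min(a, X)]
    lies between [(b - a) * 1_(b <= X)] and [(b - a) * 1_(a <= X)], so the
    hypothesis turns into the inequalities of [expRN_unique] for [h]. *)
Lemma exponential_lawP d (T : measurableType d) (P : probability T R) (X : T -> R) :
  measurable_fun setT X -> (forall w, 0 <= X w) ->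
  (forall a : R, (0 < a)%R -> P [set w | (X w < a)%R] = \int[P]_w (Num.min a (X w))%:E)%E ->
  forall U, measurable U -> P (X @^-1` U) = exponential_prob 1 U.
Proof.
move=> mX X0 PX.
have mlt a : measurable [set w | X w < a] by exact: measurable_lt_set.
pose h a := fine (P [set w | a <= X w]).
have mge a : measurable [set w | a <= X w].
  rewrite (_ : [set w | _] = ~` [set w | X w < a]); first exact: measurableC.
  by apply/seteqP; split=> w /=; rewrite leNgt => /negP.
have Pfin (S : set T) : measurable S -> P S \is a fin_num by move=> mS; exact: fin_num_measure.
have Plt a : (P [set w | (X w < a)%R] = (1 - h a)%:E)%E.
  have -> : [set w | X w < a] = ~` [set w | a <= X w].
    by apply/seteqP; split=> w /=; rewrite ltNge => /negP.
  by rewrite probability_setC// EFinB /h fineK// Pfin.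
have h0 a : 0 <= h a by exact: fine_ge0.
have h00 : h 0 = 1.
  rewrite /h (_ : [set w | _] = setT) ?probability_setT//.
  by apply/seteqP; split=> w //= _; exact: X0.
have Imin a : 0 <= a -> (\int[P]_w (Num.min a (X w))%:E = (1 - h a)%:E)%E.
  rewrite le_eqVlt => /predU1P[<-|a0]; last by rewrite -Plt PX.
  rewrite h00 subrr; apply: integral0_eq => w _; by rewrite min_l.
have mmin a : measurable_fun setT (fun w => (Num.min a (X w))%:E).
  by apply/measurable_EFinP; exact: measurable_minr.
have min0 a w : 0 <= a -> 0 <= Num.min a (X w) by move=> a0; rewrite le_min a0 X0.
have hE a : 0 <= a -> forall c, 0 <= c ->
   (\int[P]_w (c%:E * (\1_[set w | (a <= X w)%R] w)%:E) = (c * h a)%:E)%E.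
  move=> a0 c c0; rewrite ge0_integralZl//; last by apply/measurable_EFinP; exact: measurable_indic.
  by rewrite integral_indic// setIT EFinM /h fineK// Pfin.
have hexp x : 0 <= x -> h x = expR (- x).
  apply: expRN_unique => // a b a0 ab.
  have b0 : 0 <= b by rewrite (le_trans a0)// ltW.
  have ba0 : 0 <= b - a by rewrite subr_ge0 ltW.
  have diff c (e : R) : 0 <= c -> 0 <= e ->
    (\int[P]_w ((Num.min a (X w))%:E + e%:E * (\1_[set w | (c <= X w)%R] w)%:E) =
      (1 - h a + e * h c)%:E)%E.
    move=> c0 e0; rewrite ge0_integralD//; first by rewrite Imin// hE// EFinD.
    - by move=> w _; rewrite lee_fin min0.
    - by move=> w _; rewrite -EFinM lee_fin mulr_ge0.
    - apply/measurable_EFinP; apply: measurable_funM => //; exact: measurable_indic.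
  split; rewrite -lee_fin.
  - suff : ((1 - h a + (b - a) * h b)%:E <= (1 - h b)%:E)%E by rewrite !lee_fin; lra.
    rewrite -diff// -Imin//; apply: ge0_le_integralT => w.
      by rewrite -EFinM -EFinD lee_fin addr_ge0 ?min0// mulr_ge0.
    rewrite -EFinM -EFinD lee_fin indicE; case: (boolP (w \in _)).
      rewrite inE/= => bX; rewrite (min_l bX) min_l ?mulr1 ?(le_trans (ltW ab))//.
      by rewrite addrC subrK.
    by rewrite mulr0 addr0 => _; rewrite le_min !ge_min lexx (ltW ab) orbT.
  - suff : ((1 - h b)%:E <= (1 - h a + (b - a) * h a)%:E)%E by rewrite !lee_fin; lra.
    rewrite -diff// -Imin//; apply: ge0_le_integralT => w; first by rewrite lee_fin min0.
    rewrite -EFinM -EFinD lee_fin indicE; case: (boolP (w \in _)).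
      rewrite inE/= => aX; rewrite (min_l aX) mulr1 addrC subrK.
      by rewrite ge_min lexx.
    rewrite notin_setE /= => /negP; rewrite -ltNge => Xa.
    by rewrite mulr0 addr0 !min_r// ltW// (lt_trans Xa).
have expN a : 0 < a -> exponential_prob 1 `]-oo, a[ = (1 - expR (- a))%:E.
  move=> a0; have := exponential_prob_itv0c 1 a0; rewrite mulN1r EFinB => <-.
  rewrite /exponential_prob integral_mkcond [RHS]integral_mkcond.
  apply: (@eq_integral_outside _ _ _ lebesgue_measure [set a]).
    by exists [set a]; split=> //; exact: lebesgue_measure_set1.
  move=> x /= xa; rewrite !patchE; have [x0|x0] := leP 0 x.
    congr (if _ then _ else _); apply/idP/idP; rewrite !inE/= !in_itv/= x0/=.
      exact: ltW.
    by rewrite le_eqVlt => /predU1P[].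
  by rewrite lt0_exponential_pdf//; case: ifP; case: ifP.
have expN0 a : a <= 0 -> exponential_prob 1 `]-oo, a[ = 0%E :> \bar R.
  move=> a0; apply: integral0_eq => x; rewrite /= in_itv/= => xa.
  by rewrite lt0_exponential_pdf// (lt_le_trans xa).
have mX' : measurable_fun setT (X : T -> measurableTypeR R) := mX.
pose m1 := measure_function_pushforward__canonical__measure_function_Measure P mX'.
pose m2 := exponential_distribution_exponential_prob__canonical__measure_function_Measure
  (ltr01 : 0 < (1 : R)).
move=> U mU.
suff : m1 U = m2 U by [].
apply: (@measure_unique _ R (measurableTypeR R) (@RGenInftyO.G R) (fun n => `]-oo, n%:R[%classic) _ _ _ _ m1 m2) => //.
- exact: RGenInftyO.measurableE.
- move=> _ _ [a ->] [b ->]; exists (Num.min a b).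
  by apply/seteqP; split=> x /=; rewrite !in_itv/= lt_min => /andP.
- by move=> n; exists n%:R.
- apply/seteqP; split=> // x _; exists (Num.trunc `|x|).+1 => //=.
  by rewrite in_itv/= (le_lt_trans (ler_norm x))// truncnS_gt.
- move=> _ [a ->]; suff : P [set w | X w < a] = exponential_prob 1 `]-oo, a[ by [].
  have [a0|a0] := leP a 0; last by rewrite Plt expN// hexp// ltW.
  rewrite expN0// (_ : [set w | _] = set0) ?measure0//.
  by apply/seteqP; split=> w //=; rewrite ltNge (le_trans a0).
- move=> n; suff : (P (X @^-1` `]-oo, n%:R[%classic) < +oo)%E by [].
  rewrite (le_lt_trans (probability_le1 P _)) ?ltry//.
  by rewrite -[X in measurable X]setTI; apply: mX => //; exact: measurable_itv.
Qed.

End exponential_law.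

(** * Sums of two exponential variables *)

Section gamma.
Context {R : realType}.
Local Notation mu := (@lebesgue_measure R).
Local Open Scope ereal_scope.

Lemma ge0_integral_shift (h : R -> R) (y : R) : continuous h ->
  (forall x, 0 <= h x)%R ->
  \int[mu]_(x in `[0%R, +oo[) (h (x + y)%R)%:E = \int[mu]_(z in `[y, +oo[) (h z)%:E.
Proof.
move=> ch h0; pose S (x : R) : R := (x + y)%R.
have S0 : S 0%R = y by rewrite /S add0r.
have dS : S^`()%classic = cst 1%R.
  by apply/funext => x; rewrite derive1E /S deriveD// derive_id derive_cst addr0.
rewrite -[in RHS]S0 (@increasing_ge0_integration_by_substitutiony _ S h 0%R).
- by apply: eq_integral => x _; rewrite /= dS /= mulr1.
- by move=> u v _ _ uv; rewrite /S ltrD2r.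
- by move=> x _; rewrite dS; exact: cst_continuous.
- by rewrite dS; exact: is_cvg_cst.
- by rewrite dS; exact: is_cvg_cst.
- split; first by move=> x _; rewrite /S; exact: ex_derive.
  by apply: cvg_at_right_filter; apply: cvgD; [exact: cvg_id|exact: cvg_cst].
- apply/cvgryPge => A; near=> x; rewrite /S -lerBlDr; near: x.
  by apply: nbhs_pinfty_ge; rewrite num_real.
- by apply: continuous_subspaceT.
- by move=> x _.
Unshelve. all: by end_near. Qed.

Section nonnegative.
Variable h : R -> R.
Hypotheses (ch : continuous h) (h0 : forall x, (0 <= h x)%R).

Let mh : measurable_fun setT h. Proof. exact: continuous_measurable_fun. Qed.

Let ceh : continuous (fun z => expR (- z) * h z)%R.
Proof.
move=> z; apply: cvgM; last exact: ch.
by apply: continuous_comp; [exact: continuousN|exact: continuous_expR].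
Qed.

Let meh : measurable_fun setT (fun z : R => expR (- z) * h z)%R.
Proof. exact: continuous_measurable_fun ceh. Qed.

Let eh0 z : (0 <= expR (- z) * h z)%R. Proof. by rewrite mulr_ge0// expR_ge0. Qed.

Lemma exponential_inner (y : R) :
  \int[mu]_(x in `[0%R, +oo[) (expR (- x) * expR (- y) * h (x + y))%:E =
  \int[mu]_(z in `[y, +oo[) (expR (- z) * h z)%:E.
Proof.
rewrite -(ge0_integral_shift y ceh eh0); apply: eq_integral => x _.
by rewrite opprD expRD.
Qed.

(** After the substitution [z = x + y] the integrand no longer depends on [y].
    It is integrated over [0 <= y <= z], which weights it by [z]. *)
Lemma exponential_double :
  \int[mu]_(y in `[0%R, +oo[) \int[mu]_(x in `[0%R, +oo[)
     (expR (- x) * expR (- y) * h (x + y))%:E =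
  \int[mu]_(x in `[0%R, +oo[) (expR (- x) * x * h x)%:E.
Proof.
transitivity (\int[mu]_x (Num.max 0%R x * (expR (- x) * h x))%:E).
  have mV : measurable_fun setT (fun x : R => Num.max 0 x)%R.
    by apply: measurable_maxr; [exact: measurable_cst|exact: measurable_id].
  have V0 (x : R) : (0 <= Num.max 0 x)%R by rewrite le_max lexx.
  rewrite (ge0_integral_layers mu mV V0 meh eh0).
  apply: eq_integral => y; rewrite inE/= in_itv/= andbT => y0.
  rewrite exponential_inner -integral_itv_obnd_cbnd; last first.
    by apply/measurable_EFinP; exact: (measurable_funTS meh).
  congr (integral _ _ _); apply/seteqP; split=> x /=; rewrite in_itv/= andbT.
    by move=> yx; rewrite lt_max yx orbT.
  by rewrite lt_max ltNge y0.
rewrite [RHS]integral_mkcond; apply: eq_integral => x _; rewrite patchE.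
have [x0|x0] := leP 0%R x.
  by rewrite mem_set ?mulrA ?[(x * _)%R]mulrC//= in_itv/= x0.
by rewrite memNset ?mul0r//= in_itv/= leNgt x0.
Qed.

Lemma exponential_inner_lty y : (0 <= y)%R ->
  \int[mu]_(x in `[0%R, +oo[) (expR (- x) * h x)%:E < +oo ->
  \int[mu]_(x in `[0%R, +oo[) (expR (- x) * expR (- y) * h (x + y))%:E < +oo.
Proof.
move=> y0; rewrite exponential_inner; apply: le_lt_trans.
apply: ge0_subset_integral => //.
- by apply/measurable_EFinP; exact: (measurable_funTS meh).
- by move=> x _; rewrite lee_fin.
- by move=> x /=; rewrite !in_itv/= !andbT; exact: (le_trans y0).
Qed.

Lemma measurable_exponential_inner : measurable_fun setT
  (fun y : R => \int[mu]_(x in `[0%R, +oo[) (expR (- x) * expR (- y) * h (x + y))%:E).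
Proof.
pose f (z : R * R) : \bar R :=
  (\1_(`[0%R, +oo[%classic : set R) z.1 * (expR (- z.1) * expR (- z.2) * h (z.1 + z.2)))%:E.
have mf : measurable_fun setT f.
  have m1 : measurable_fun setT (fst : R * R -> R) by exact: measurable_fst.
  have m2 : measurable_fun setT (snd : R * R -> R) by exact: measurable_snd.
  have mexp (g : R * R -> R) : measurable_fun setT g ->
      measurable_fun setT (fun z => expR (- g z)%R).
    by move=> mg; apply: measurableT_comp => //; exact: measurable_funN.
  apply/measurable_EFinP; apply: measurable_funM.
    have mi : measurable_fun setT (\1_(`[0%R, +oo[%classic : set R) : R -> R).
      by apply: measurable_indic; exact: measurable_itv.
    exact: (measurableT_comp mi m1).
  apply: measurable_funM; first by apply: measurable_funM; exact: mexp.
  by apply: measurableT_comp => //; exact: measurable_funD.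
have f0 z : 0 <= f z by rewrite lee_fin mulr_ge0// mulr_ge0// mulr_ge0 ?expR_ge0.
have := @measurable_fun_fubini_tonelli_G _ _ (measurableTypeR R) R R mu f mf f0.
congr (measurable_fun setT _); apply/funext => y.
rewrite /fubini_G [RHS]integral_mkcond; apply: eq_integral => x _.
rewrite patchE /f indicE; case: ifPn => xi /=; first by rewrite mul1r.
by rewrite mul0r.
Qed.

Lemma ge0_integral_exponential_sum d (T : measurableType d) (Q : probability T R)
    (e1 e2 : {RV Q >-> R}) :
  standard_exponential e1 -> standard_exponential e2 -> independent_RV e1 e2 ->
  \int[mu]_(x in `[0%R, +oo[) (expR (- x) * h x)%:E < +oo ->
  \int[Q]_w (h (e1 w + e2 w)%R)%:E =
  \int[mu]_(y in `[0%R, +oo[) \int[mu]_(x in `[0%R, +oo[)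
     (expR (- x) * expR (- y) * h (x + y))%:E.
Proof.
move=> E1 E2 ind hfin.
pose f (z : R * R) : \bar R := (h (z.1 + z.2))%:E.
have f0 z : 0 <= f z by rewrite lee_fin.
have mf : measurable_fun setT f.
  apply/measurable_EFinP/measurableT_comp => //; apply: measurable_funD.
    exact: measurable_fst.
  exact: measurable_snd.
have mpair : measurable_fun setT (fun w => (e1 w, e2 w)) by exact: measurable_fun_pair.
transitivity (\int[pushforward Q (fun w => (e1 w, e2 w))]_z f z).
  by rewrite ge0_integral_pushforward.
pose D1 := distribution Q e1; pose D2 := distribution Q e2.
transitivity (\int[D1 \x D2]_z f z).
  apply: eq_measure_integral => X mX _; apply/esym.
  exact: product_measure_unique.
rewrite fubini_tonelli2//.
pose g y := \int[mu]_(x in `[0%R, +oo[) (expR (- x) * h (x + y))%:E.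
have gE y : fubini_G D1 f y = g y.
  rewrite /fubini_G (ge0_integral_distribution e1); last 2 first.
  - by apply: measurableT_comp mf _; exact: measurable_fun_pair.
  - by move=> x; rewrite lee_fin.
  apply: (ge0_integral_exponential (X := e1) (f := fun x => h (x + y)%R)) => //.
  by apply: measurableT_comp => //; exact: measurable_funD.
have g0 y : 0 <= g y by apply: integral_ge0 => x _; rewrite lee_fin mulr_ge0// expR_ge0.
have mg : measurable_fun setT g.
  by rewrite (_ : g = fubini_G D1 f) ?funeqE// ; exact: measurable_fun_fubini_tonelli_G.
have innerE y : \int[mu]_(x in `[0%R, +oo[) (expR (- x) * expR (- y) * h (x + y))%:E =
    (expR (- y))%:E * g y.
  rewrite /g -ge0_integralZl//.
  - by apply: eq_integral => x _; rewrite -EFinM [in RHS]mulrA [in RHS](mulrC (expR (- y))).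
  - apply/measurable_EFinP/measurable_funTS; apply: measurable_funM.
      by apply: measurableT_comp => //; exact: measurable_expR.
    by apply: measurableT_comp => //; exact: measurable_funD.
  - by move=> x _; rewrite lee_fin mulr_ge0// expR_ge0.
have gfin y : (0 <= y)%R -> g y \is a fin_num.
  move=> y0; have := exponential_inner_lty y0 hfin; rewrite innerE.
  rewrite ge0_fin_numE//; case: (g y) => [r _| |//]; first by rewrite ltry.
  by rewrite mulry gtr0_sg ?expR_gt0// mul1e.
(* The inner integral is known to be finite for nonnegative y only. Negative
   values of y are null for the exponential law. *)
transitivity (\int[D2]_y (fine (g y))%:E).
  apply: (@eq_integral_outside _ _ _ D2 [set y | y < 0]%R).
    exists [set y | y < 0]%R; split=> //.
      rewrite (_ : [set y | _] = `]-oo, 0%R[%classic); first exact: measurable_itv.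
      by apply/seteqP; split=> y; rewrite /= in_itv.
    rewrite (_ : [set y | _] = `]-oo, 0%R[%classic); last first.
      by apply/seteqP; split=> y; rewrite /= in_itv.
    rewrite [LHS]E2//; apply: integral0_eq => y; rewrite /= in_itv/= => y0.
    by rewrite lt0_exponential_pdf.
  by move=> y /= /negP; rewrite -leNgt => y0; rewrite gE fineK// gfin.
rewrite (ge0_integral_distribution e2); last 2 first.
- by apply/measurable_EFinP; apply: measurableT_comp mg; exact: fine_measurable.
- by move=> y; rewrite lee_fin fine_ge0.
rewrite (ge0_integral_exponential (X := e2) (f := fine \o g))//.
- apply: eq_integral => y; rewrite inE/= in_itv/= andbT => y0.
  by rewrite innerE EFinM fineK// gfin.
- by apply: measurableT_comp mg; exact: fine_measurable.
- by move=> y; exact: fine_ge0.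
Qed.

End nonnegative.
End gamma.

Section signed.
Context {R : realType}.
Local Notation mu := (@lebesgue_measure R).
Local Open Scope ereal_scope.

Lemma integral_posneg d (T : measurableType d) (m : {measure set T -> \bar R})
    (D : set T) (g : T -> R) :
  \int[m]_(x in D) (g x)%:E =
  \int[m]_(x in D) (Num.max (g x) 0%R)%:E - \int[m]_(x in D) (Num.max (- g x) 0)%R%:E.
Proof.
rewrite integralE; congr (_ - _); apply: eq_integral => x _.
  by rewrite funeposE EFin_max.
by rewrite funenegE EFin_max EFinN.
Qed.

Lemma integral_exponential d (T : measurableType d) (P : probability T R)
    (X : T -> R) (f : R -> R) : measurable_fun setT X ->
  (forall U, measurable U -> P (X @^-1` U) = exponential_prob 1 U) ->
  measurable_fun setT f ->
  \int[P]_w (f (X w))%:E = \int[mu]_(x in `[0%R, +oo[) (expR (- x) * f x)%:E.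
Proof.
move=> mX PX mf; rewrite integral_posneg [RHS]integral_posneg.
have mm : measurable_fun setT (fun x => Num.max (f x) 0)%R by exact: measurable_maxr.
have mn : measurable_fun setT (fun x => Num.max (- f x) 0)%R.
  by apply: measurable_maxr => //; exact: measurable_funN.
have pos0 (g : R -> R) x : (0 <= Num.max (g x) 0)%R by rewrite le_max lexx orbT.
rewrite (ge0_integral_exponential mX PX mm (pos0 f)).
rewrite (ge0_integral_exponential mX PX mn (pos0 (fun x => - f x)%R)).
by congr (_ - _); apply: eq_integral => x _; rewrite maxr_pMr ?expR_ge0// ?mulr0// mulrN.
Qed.

Variable phi : R -> R.
Hypothesis cphi : continuous phi.
Hypothesis phi_fin : \int[mu]_(x in `[0%R, +oo[) (`|phi x| * expR (- x))%:E < +oo.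
Hypothesis xphi_fin : \int[mu]_(x in `[0%R, +oo[) (x * `|phi x| * expR (- x))%:E < +oo.

Let pos (x : R) : R := (Num.max (phi x) 0)%R.
Let neg (x : R) : R := (Num.max (- phi x) 0)%R.

Let cpos : continuous pos.
Proof.
by move=> x; apply: (@continuous_max _ _ phi (cst 0%R)); [exact: cphi|exact: cvg_cst].
Qed.

Let cneg : continuous neg.
Proof.
move=> x; apply: (@continuous_max _ _ (fun x => - phi x)%R (cst 0%R)).
  by apply: cvgN; exact: cphi.
exact: cvg_cst.
Qed.

Let pos0 x : (0 <= pos x)%R. Proof. by rewrite le_max lexx orbT. Qed.
Let neg0 x : (0 <= neg x)%R. Proof. by rewrite le_max lexx orbT. Qed.
Let pos_le x : (pos x <= `|phi x|)%R. Proof. by rewrite ge_max normr_ge0 ler_norm. Qed.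
Let neg_le x : (neg x <= `|phi x|)%R.
Proof. by rewrite ge_max normr_ge0 -normrN ler_norm. Qed.

Let fin1 (h : R -> R) : continuous h -> (forall x, 0 <= h x <= `|phi x|)%R ->
  \int[mu]_(x in `[0%R, +oo[) (expR (- x) * h x)%:E < +oo.
Proof.
move=> ch hphi; apply: le_lt_trans phi_fin.
rewrite integral_mkcond [leRHS]integral_mkcond; apply: ge0_le_integralT => x.
  apply: erestrict_ge0 => {}x _; rewrite lee_fin mulr_ge0 ?expR_ge0//.
  by have /andP[] := hphi x.
apply: lee_restrict => {}x _; rewrite lee_fin mulrC ler_wpM2r ?expR_ge0//.
by have /andP[] := hphi x.
Qed.

Let fin2 (h : R -> R) : continuous h -> (forall x, 0 <= h x <= `|phi x|)%R ->
  \int[mu]_(x in `[0%R, +oo[) (expR (- x) * x * h x)%:E < +oo.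
Proof.
move=> ch hphi; apply: le_lt_trans xphi_fin.
rewrite integral_mkcond [leRHS]integral_mkcond; apply: ge0_le_integralT => x.
  apply: erestrict_ge0 => {}x; rewrite /= in_itv/= andbT => x0.
  by rewrite lee_fin !mulr_ge0 ?expR_ge0//; have /andP[] := hphi x.
apply: lee_restrict => {}x; rewrite /= in_itv/= andbT => x0.
rewrite lee_fin -mulrA mulrC ler_wpM2r ?expR_ge0// ler_wpM2l//.
by have /andP[] := hphi x.
Qed.

Let posP x : (0 <= pos x <= `|phi x|)%R. Proof. by rewrite pos0 pos_le. Qed.
Let negP x : (0 <= neg x <= `|phi x|)%R. Proof. by rewrite neg0 neg_le. Qed.

Let double (h : R -> R) := fun y : R => \int[mu]_(x in `[0%R, +oo[)
  (expR (- x) * expR (- y) * h (x + y)%R)%:E.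

Let double_integrable (h : R -> R) : continuous h -> (forall x, 0 <= h x <= `|phi x|)%R ->
  mu.-integrable (`[0%R, +oo[%classic : set R) (double h).
Proof.
move=> ch hphi; have h0 x : (0 <= h x)%R by have /andP[] := hphi x.
apply/integrableP; split.
  by apply: measurable_funTS; exact: measurable_exponential_inner.
have E : \int[mu]_(y in `[0%R, +oo[) `|double h y| = \int[mu]_(y in `[0%R, +oo[) double h y.
  apply: eq_integral => y _; rewrite gee0_abs//; apply: integral_ge0 => x _.
  by rewrite lee_fin !mulr_ge0 ?expR_ge0.
by rewrite E exponential_double//; exact: fin2.
Qed.

Lemma integral_exponential_double :
  \int[mu]_(y in `[0%R, +oo[) \int[mu]_(x in `[0%R, +oo[)
     (expR (- x) * expR (- y) * phi (x + y)%R)%:E =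
  \int[mu]_(x in `[0%R, +oo[) (expR (- x) * x * phi x)%:E.
Proof.
transitivity (\int[mu]_(y in `[0%R, +oo[) (double pos y - double neg y)).
  apply: eq_integral => y _; rewrite integral_posneg.
  by congr (_ - _); apply: eq_integral => x _;
    rewrite /pos /neg maxr_pMr ?mulr_ge0 ?expR_ge0// ?mulr0// mulrN.
transitivity (\int[mu]_(y in `[0%R, +oo[) double pos y - \int[mu]_(y in `[0%R, +oo[) double neg y).
  by apply: integralB => //; exact: double_integrable.
rewrite /double !exponential_double// [RHS]integral_posneg.
by congr (_ - _); apply: eq_integral => x; rewrite inE/= in_itv/= andbT => x0;
  rewrite /pos /neg maxr_pMr ?mulr_ge0 ?expR_ge0// ?mulr0// mulrN.
Qed.

Lemma integral_exponential_sum d (T : measurableType d) (Q : probability T R)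
    (e1 e2 : {RV Q >-> R}) :
  standard_exponential e1 -> standard_exponential e2 -> independent_RV e1 e2 ->
  \int[Q]_w (phi (e1 w + e2 w)%R)%:E =
  \int[mu]_(x in `[0%R, +oo[) (expR (- x) * x * phi x)%:E.
Proof.
move=> E1 E2 ind; rewrite integral_posneg.
rewrite (ge0_integral_exponential_sum cpos pos0 E1 E2 ind (fin1 cpos posP)).
rewrite (ge0_integral_exponential_sum cneg neg0 E1 E2 ind (fin1 cneg negP)).
rewrite !exponential_double// [RHS]integral_posneg.
by congr (_ - _); apply: eq_integral => x; rewrite inE/= in_itv/= andbT => x0;
  rewrite /pos /neg maxr_pMr ?mulr_ge0 ?expR_ge0// ?mulr0// mulrN.
Qed.

End signed.

(** * Conditional expectations *)

Section truncation.
Context d (T : measurableType d) (R : realType) (P : {measure set T -> \bar R}).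

Lemma ge0_integral_le_truncation (f : T -> R) (G : \bar R) :
  measurable_fun setT f -> (forall x, 0 <= f x) ->
  (forall n : nat, \int[P]_x (Num.min (f x) n%:R)%:E <= G)%E ->
  (\int[P]_x (f x)%:E <= G)%E.
Proof.
move=> mf f0 H.
have := @fatou _ _ _ P _ measurableT (fun n x => (Num.min (f x) n%:R)%:E).
move=> /(_ _ _); set lhs := (X in (X <= _)%E); suff -> : lhs = (\int[P]_x (f x)%:E)%E.
  move=> F; apply: (le_trans (F _ _)) => [n|n x _|].
  - by apply/measurable_EFinP; exact: measurable_minr.
  - by rewrite lee_fin le_min f0 ler0n.
  exact: limn_einf_le.
apply: eq_integral => x _.
have [] // := @cvg_limn_einf_sup _ (fun n => (Num.min (f x) n%:R)%:E) (f x)%:E.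
apply: cvg_near_cst; exists (Num.trunc (f x)).+1 => // n /= fn.
by rewrite /= min_l// (le_trans (ltW (truncnS_gt _)))// ler_nat.
Qed.

End truncation.

Lemma measurable_wrt_sub_gt {T : Type} {R : realType} (G : set_system T)
    (X Y : T -> R) c : sigma_algebra setT G ->
  measurable_wrt G X -> measurable_wrt G Y -> G [set w | c < X w - Y w].
Proof.
move=> sG mX mY.
rewrite (_ : [set w | _] = [set w | exists q : rat,
    ((X @^-1` `]ratr q, +oo[) `&` (Y @^-1` `]-oo, ratr q - c[)) w]).
  apply: (sigma_algebra_exists sG) => q; apply: (sigma_algebraI sG).
    by apply: (mX `]_, +oo[%classic); exact: measurable_itv.
  by apply: (mY `]-oo, _[%classic); exact: measurable_itv.
apply/seteqP; split=> w /=.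
  rewrite ltrBrDl => /rat_in_itvoo[q]; rewrite in_itv/= => /andP[yq qx].
  by exists q; rewrite !in_itv/= andbT qx ltrBrDr.
move=> [q]; rewrite !in_itv/= andbT => -[qx yq].
by rewrite ltrBrDr (lt_trans _ qx)// addrC -ltrBrDr.
Qed.

Lemma measurable_wrt_sub {T : Type} {R : realType} (G : set_system T) (X Y : T -> R) :
  sigma_algebra setT G -> measurable_wrt G X -> measurable_wrt G Y ->
  measurable_wrt G (fun w => X w - Y w).
Proof.
move=> sG mX mY; apply: (measurable_wrt_lt sG) => c.
have := measurable_wrt_sub_gt (- c) sG mY mX; congr G.
by apply/seteqP; split=> w /=; rewrite ltrNl opprB.
Qed.

Lemma opp_integral d (T : measurableType d) (R : realType)
    (P : {measure set T -> \bar R}) (B : set T) (g : T -> R) :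
  measurable B -> P.-integrable B (EFin \o g) ->
  (\int[P]_(w in B) (- g w)%:E = - \int[P]_(w in B) (g w)%:E)%E.
Proof. by move=> mB ig; exact: (integralN (integrable_add_def mB ig)). Qed.

Section cond_expectation_theory.
Context (R : realType) (d : measure_display) (T : measurableType d).
Variables (P : probability T R) (G : set_system T).
Hypotheses (sG : sigma_algebra setT G) (Gm : G `<=` measurable).
Variables (X Z : T -> R).
Hypotheses (mX : measurable_fun setT X) (iX : P.-integrable setT (EFin \o X)).
Hypothesis condZ : cond_expectation P G X Z.

Lemma cond_expectationN :
  cond_expectation P G (fun w => - X w) (fun w => - Z w).
Proof.
have [mZ iZ EZ] := condZ; split.
- move=> U mU; apply: (mZ (-%R @^-1` U)).
  by rewrite -[X in measurable X]setTI; exact: oppr_measurable.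
- by have := integrableN iZ.
move=> B GB; have mB := Gm GB.
by rewrite !opp_integral ?EZ//; exact: integrableS iZ || exact: integrableS iX.
Qed.

Lemma cond_expectationB (Y : T -> R) : measurable_wrt G Y ->
  P.-integrable setT (EFin \o Y) ->
  cond_expectation P G (fun w => X w - Y w) (fun w => Z w - Y w).
Proof.
move=> mY iY; have [mZ iZ EZ] := condZ; split.
- exact: measurable_wrt_sub.
- by have := integrableB measurableT iZ iY.
move=> B GB; have mB := Gm GB.
have EB (f : T -> R) : P.-integrable setT (EFin \o f) ->
    (\int[P]_(w in B) (f w - Y w)%:E =
     \int[P]_(w in B) (f w)%:E - \int[P]_(w in B) (Y w)%:E)%E.
  move=> if_; transitivity (\int[P]_(w in B) ((EFin \o f) \- (EFin \o Y)) w)%E; first by [].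
  by apply: integralB => //; [exact: integrableS if_|exact: integrableS iY].
by rewrite !EB// EZ.
Qed.

(** On the part of [B] where [Z + c] is positive, an event of [G], the variables
    [Z] and [X] have the same integral, and [X + c] is below its positive
    part. *)
Lemma jensen_pos_part B c : G B ->
  (\int[P]_(w in B) (Num.max (Z w + c) 0)%:E <=
   \int[P]_(w in B) (Num.max (X w + c) 0)%:E)%E.
Proof.
move=> GB; have [mZ iZ EZ] := condZ.
pose C := B `&` (Z @^-1` `]- c, +oo[).
have GC : G C.
  by apply: (sigma_algebraI sG) => //; apply: mZ; exact: measurable_itv.
have mB := Gm GB; have mC := Gm GC.
have CB : C `<=` B by move=> w [].
have E1 : (\int[P]_(w in B) (Num.max (Z w + c) 0)%:E = \int[P]_(w in C) (Z w + c)%:E)%E.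
  rewrite integral_mkcond [RHS]integral_mkcond; apply: eq_integral => w _.
  rewrite !patchE; have [wB|wB] := boolP (w \in B); last first.
    by rewrite ifF//; apply: contraNF wB; rewrite !inE => /CB.
  have [wC|wC] := boolP (w \in C).
    move: wC; rewrite inE /C /= in_itv/= andbT => -[_ cZ].
    by rewrite max_l// -lerBlDr sub0r ltW.
  rewrite max_r//; move: wC wB; rewrite notin_setE inE /C/= in_itv/= andbT => nC Bw.
  by rewrite -lerBrDr sub0r leNgt; apply/negP => cZ; apply: nC.
have iZC : P.-integrable C (EFin \o Z) by apply: integrableS iZ.
have iXC : P.-integrable C (EFin \o X) by apply: integrableS iX.
have icC : P.-integrable C (EFin \o cst c) by exact: finite_measure_integrable_cst.
rewrite E1; have -> : (\int[P]_(w in C) (Z w + c)%:E = \int[P]_(w in C) (X w + c)%:E)%E.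
  transitivity (\int[P]_(w in C) ((EFin \o Z) w + (EFin \o cst c) w))%E; first by [].
  by rewrite integralD// [X in (X + _)%E](EZ C GC) -integralD.
apply: (@le_trans _ _ (\int[P]_(w in C) (Num.max (X w + c) 0)%:E)%E).
  apply: le_integral => //.
  - by have := integrableD mC iXC icC.
  - have iXc := integrableD mC iXC icC.
    have := integrable_funepos mC iXc; congr (integrable _ _ _).
    by apply/funext => w; rewrite funeposE EFin_max.
  - by move=> w _; rewrite lee_fin le_max lexx.
apply: ge0_subset_integral => //.
  apply/measurable_EFinP; apply: measurable_funTS; apply: measurable_maxr => //.
  exact: measurable_funD.
by move=> w _; rewrite lee_fin le_max lexx orbT.
Qed.

End cond_expectation_theory.

Lemma jensen_abs (R : realType) d (T : measurableType d) (P : probability T R)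
    (G : set_system T) (X Z : T -> R) B :
  sigma_algebra setT G -> G `<=` measurable ->
  measurable_fun setT X -> P.-integrable setT (EFin \o X) ->
  cond_expectation P G X Z -> G B ->
  (\int[P]_(w in B) `|Z w|%:E <= \int[P]_(w in B) `|X w|%:E)%E.
Proof.
move=> sG Gm mX iX condZ GB; have mB := Gm _ GB.
have mZ : measurable_fun setT Z.
  by move=> _ U mU; rewrite setTI; apply: Gm; case: condZ => mZ _ _; exact: mZ.
have mNX : measurable_fun setT (fun w => - X w) by exact: measurable_funN.
have iNX : P.-integrable setT (EFin \o (fun w => - X w)) by have := integrableN iX.
have absE (f : T -> R) : measurable_fun setT f ->
    (\int[P]_(w in B) `|f w|%:E = \int[P]_(w in B) (Num.max (f w + 0) 0)%:E +
       \int[P]_(w in B) (Num.max (- f w + 0) 0)%:E)%E.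
  move=> mf; rewrite -ge0_integralD//.
  - apply: eq_integral => w _; rewrite -EFinD !addr0; congr _%:E.
    have [m0|m0] := leP 0 (f w).
      by rewrite ger0_norm// max_r ?addr0// oppr_le0.
    by rewrite ltr0_norm// max_l ?add0r// oppr_ge0 ltW.
  - by move=> w _; rewrite lee_fin le_max lexx orbT.
  - apply/measurable_EFinP; apply: measurable_funTS; apply: measurable_maxr => //.
    exact: measurable_funD.
  - by move=> w _; rewrite lee_fin le_max lexx orbT.
  - apply/measurable_EFinP; apply: measurable_funTS; apply: measurable_maxr => //.
    by apply: measurable_funD => //; exact: measurable_funN.
rewrite !absE//; apply: leeD; first exact: (jensen_pos_part sG Gm mX iX condZ).
exact: (jensen_pos_part sG Gm mNX iNX (cond_expectationN Gm iX condZ)).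
Qed.

(** * The martingale at the honest time *)

Section martingale_at_end.
Context (R : realType) (d : measure_display) (T : measurableType d).
Variables (P : probability T R) (F : R -> set_system T).
Hypothesis usualF : usual_filtration P F.
Variable L : T -> \bar R.
Hypotheses (honestL : honest_time F L) (L_finite : P [set w | L w = +oo%E] = 0%E).
Hypothesis L_avoids : avoids_stopping_times P F L.
Variable A : T -> cumulative R R.
Hypothesis dualA : dual_optional_projection P F L A.

Local Notation terminal := (terminal L A).

Let A_before0 w t : t < 0 -> A w t = 0. Proof. exact: (dual_proj_before0 dualA). Qed.

Let A_nd w s t : s <= t -> A w s <= A w t.
Proof. by move=> st; apply: cumulative_is_nondecreasing. Qed.

Let mterm : measurable_fun setT terminal := measurable_terminal usualF honestL dualA.

(** By [terminal_lt], the truncations at [n] have mean P(A_L < n). *)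
Lemma terminal_mean_le1 : (\int[P]_w (terminal w)%:E <= 1)%E.
Proof.
apply: ge0_integral_le_truncation => // [|n]; first exact: (terminal_ge0 dualA).
case: n => [|n].
  rewrite integral0_eq// => w _; rewrite min_r//; exact: (terminal_ge0 dualA).
under eq_integral do rewrite minC.
rewrite -(terminal_lt usualF honestL L_finite L_avoids dualA)//.
apply: probability_le1; rewrite (_ : [set w | _] = terminal @^-1` `]-oo, n.+1%:R[).
  by rewrite -[X in measurable X]setTI; apply: mterm => //; exact: measurable_itv.
by apply/seteqP; split=> w; rewrite /= in_itv.
Qed.

(** An increment of the dual projection over a cell of the grid is known at the
    end of the cell, where [H] can be exchanged for [g]. The increments then
    add up to a value of the path, which is at most the terminal one. *)
Lemma expectation_at_end_le (H : R -> T -> R) (g : T -> R) :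
  adapted F H -> cadlag H -> (forall t w, 0 <= t -> 0 <= H t w) -> bounded_process H ->
  measurable_fun setT g -> (forall w, 0 <= g w) ->
  (forall t : R, (0 <= t)%R -> forall B, F t B ->
     \int[P]_(w in B) (H t w)%:E <= \int[P]_(w in B) (g w)%:E)%E ->
  ('E_P[at_time H L] <= \int[P]_w (g w * terminal w)%:E)%E.
Proof.
move=> aH cH H0 bH mg g0 Hg.
apply: (le_trans (dual_projection_grid_fatou usualF dualA aH cH H0 bH)).
apply: limn_einf_le => n.
pose D i w := A w (grid n i) - A w (grid n i - n.+1%:R^-1).
have D0 i w : 0 <= D i w by rewrite subr_ge0 A_nd// gerBl invr_ge0.
have mA t := dual_projection_measurable usualF dualA t.
have mD i : measurable_fun setT (D i) by apply: measurable_funB; exact: mA.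
have wrtA t s : 0 <= t -> s <= t -> measurable_wrt (F t) (fun w => A w s).
  move=> t0 st U mU; have sF := filtration_sigma_algebra usualF t0.
  have [s0|s0] := ltP s 0.
    rewrite (_ : _ @^-1` U = [set w : T | U 0 /\ setT w]).
      by apply: (sigma_algebra_and sF); exact: sigma_algebraT.
    by apply/seteqP; split=> w /=; rewrite A_before0// => -[].
  by apply: (filtration_nondecreasing usualF s0 st); exact: (dual_proj_adapted dualA s0).
have step i : (\int[P]_w (H (grid n i) w * D i w)%:E <= \int[P]_w (g w * D i w)%:E)%E.
  have gi0 := @grid_ge0 R n i.
  have E (f : T -> R) : (\int[P]_w (f w * D i w)%:E = \int[P]_w (D i w * f w)%:E)%E.
    by apply: eq_integral => w _; rewrite mulrC.
  rewrite !E; apply: (@ge0_le_integral_weight _ T R P (F (grid n i))) => //.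
  - exact: (adapted_measurable usualF aH).
  - by move=> w; exact: H0.
  - move=> c; apply: measurable_wrt_sub_gt.
    + exact: (filtration_sigma_algebra usualF).
    + exact: wrtA.
    + by apply: wrtA => //; rewrite gerBl invr_ge0.
  - by move=> B FB _; exact: Hg.
have HD0 i w : 0 <= H (grid n i) w * D i w by rewrite mulr_ge0// H0// grid_ge0.
apply: lime_le.
  by apply: is_cvg_nneseries => i _ _; apply: integral_ge0 => w _; rewrite lee_fin.
apply: nearW => N; rewrite big_mkord.
apply: (@le_trans _ _ (\sum_(i < N) \int[P]_w (g w * D i w)%:E)%E).
  by apply: lee_sum => i _; exact: step.
rewrite -(ge0_integral_sum P measurableT (f := fun (i : 'I_N) w => (g w * D i w)%:E)); last 2 first.
- by move=> i; apply/measurable_EFinP; exact: measurable_funM.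
- by move=> i w _; rewrite lee_fin mulr_ge0.
apply: (ge0_le_integral_outside (le_terminal usualF honestL L_finite dualA)) => w.
- by apply: sume_ge0 => i _; rewrite lee_fin mulr_ge0.
- by rewrite lee_fin mulr_ge0//; exact: (terminal_ge0 dualA).
move=> /contrapT Aw; rewrite sumEFin lee_fin -mulr_sumr ler_wpM2l//.
suff -> : \sum_(i < N) D i w = A w (grid n N - n.+1%:R^-1) by exact: Aw.
elim: N => [|N IH].
  by rewrite big_ord0 A_before0// /grid mul0r sub0r oppr_lt0 invr_gt0.
rewrite big_ord_recr/= IH /D addrC subrK; congr (A w _).
by rewrite /grid -[X in _ - X]mul1r -mulrBl -[N.+1%:R]natr1 addrK.
Qed.

Section closed_martingale.
Variables (X : T -> R) (M : R -> T -> R).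
Hypothesis mX : measurable_fun setT X.
Hypothesis iX : P.-integrable setT (EFin \o X).
Hypothesis iXS : P.-integrable setT (fun w => (X w * terminal w)%:E).
Hypotheses (cM : cadlag M) (condM : forall t, 0 <= t -> cond_expectation P (F t) X (M t)).

Let aM : adapted F M. Proof. by move=> t t0; case: (condM t0). Qed.

Let mF t B : 0 <= t -> F t B -> measurable B.
Proof. by move=> t0; exact: (filtration_measurable usualF t0). Qed.

Let Y w := M (fine (L w)) w.

Lemma measurable_at_end : measurable_fun setT Y.
Proof.
apply: (measurable_at_random_time (tau := fun w => fine (L w))).
- by move=> t t0; exact: (adapted_measurable usualF aM).
- by move=> w t t0; have [+ _] := cM w; exact.
- by apply: measurableT_comp; [exact: fine_measurable|case: honestL].
- by move=> w; apply: fine_ge0; exact: honest_time_ge0 honestL.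
Qed.

(** The truncation at [n] makes the integrand bounded, and the conditional
    Jensen inequality compares it with the positive part of [X + c]. *)
Lemma pos_part_at_end c :
  (\int[P]_w (Num.max (Y w + c) 0)%:E <=
   \int[P]_w (Num.max (X w + c) 0 * terminal w)%:E)%E.
Proof.
have mYc : measurable_fun setT (fun w => Num.max (Y w + c) 0).
  apply: measurable_maxr => //; apply: measurable_funD => //.
  exact: measurable_at_end.
apply: ge0_integral_le_truncation => // [w|n]; first by rewrite le_max lexx orbT.
pose psi x := Num.min (Num.max (x + c) 0) n%:R.
have cpsi : continuous psi.
  move=> x; apply: (@continuous_min _ _ (fun x => Num.max (x + c) 0) (cst n%:R)).
    apply: (@continuous_max _ _ (fun x => x + c) (cst 0)); last exact: cvg_cst.
    by apply: cvgD; [exact: cvg_id|exact: cvg_cst].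
  exact: cvg_cst.
have psi0 x : 0 <= psi x by rewrite le_min ler0n le_max lexx orbT.
have -> : (\int[P]_w (Num.min (Num.max (Y w + c) 0) n%:R)%:E =
    'E_P[at_time (fun t w => psi (M t w)) L])%E.
  rewrite unlock; apply: (eq_integral_outside (negligible_end_infty honestL L_finite)).
  by move=> w Lw; rewrite (at_time_fine honestL).
apply: expectation_at_end_le.
- by apply: adapted_comp aM; exact: continuous_measurable_fun.
- exact: cadlag_comp.
- by move=> t w _; exact: psi0.
- by exists n%:R => t w _; rewrite ger0_norm// ge_min lexx orbT.
- by apply: measurable_maxr => //; exact: measurable_funD.
- by move=> w; rewrite le_max lexx orbT.
move=> t t0 B FB; apply: le_trans (jensen_pos_part (filtration_sigma_algebra usualF t0)
  (filtration_measurable usualF t0) mX iX (condM t0) c FB).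
rewrite integral_mkcond [leRHS]integral_mkcond; apply: ge0_le_integralT => w.
  by apply: erestrict_ge0 => {}w _; rewrite lee_fin.
by apply: lee_restrict => {}w _; rewrite lee_fin ge_min lexx.
Qed.

Lemma pos_part_at_end_lty : (\int[P]_w (Num.max (Y w) 0)%:E < +oo)%E.
Proof.
have := pos_part_at_end 0; under eq_integral do rewrite addr0.
move=> H; apply: (le_lt_trans H); have /integrableP[_] := iXS; apply: le_lt_trans.
apply: ge0_le_integralT => w.
  by rewrite lee_fin mulr_ge0 ?(terminal_ge0 dualA)// le_max lexx orbT.
rewrite /= lee_fin normrM addr0 (ger0_norm (terminal_ge0 dualA w)).
by rewrite ler_wpM2r ?(terminal_ge0 dualA)// ge_max normr_ge0 ler_norm.
Qed.

(** In [pos_part_at_end n] the shift adds at least [n] on the left and, as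
    [max(X + n, 0) = max(X, - n) + n], only [n] times the mean of the terminal
    value on the right, which is at most [n]. The remaining integrals of
    [max(X, - n) * terminal] converge by domination. *)
Lemma expectation_at_end_le_terminal : P.-integrable setT (EFin \o Y) ->
  (\int[P]_w (Y w)%:E <= \int[P]_w (X w * terminal w)%:E)%E.
Proof.
move=> iY; pose Z (n : nat) w := Num.max (X w) (- n%:R) * terminal w.
have iS : P.-integrable setT (fun w => (terminal w)%:E).
  apply/integrableP; split; first exact/measurable_EFinP.
  under eq_integral do rewrite /= ger0_norm ?(terminal_ge0 dualA)//.
  by rewrite (le_lt_trans terminal_mean_le1)// ltry.
have mZ n : measurable_fun setT (Z n).
  by apply: measurable_funM => //; exact: measurable_maxr.
have Zle n w : `|Z n w| <= `|X w * terminal w|.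
  rewrite !normrM ler_wpM2r//; have [Xn|Xn] := leP (- n%:R) (X w); first by [].
  have X0 : X w < 0 by rewrite (lt_le_trans Xn)// oppr_le0.
  by rewrite normrN normr_nat ltr0_norm// lerNr ltW.
have iZ n : P.-integrable setT (fun w => (Z n w)%:E).
  apply: le_integrable iXS => //; first exact/measurable_EFinP.
  by move=> w _; rewrite lee_fin.
have YZ n : (\int[P]_w (Y w)%:E <= \int[P]_w (Z n w)%:E)%E.
  have in_ : P.-integrable setT (EFin \o cst n%:R) by exact: finite_measure_integrable_cst.
  have n_fin : (n%:R%:E : \bar R) \is a fin_num by [].
  rewrite -(leeD2rE _ _ n_fin).
  have -> : (\int[P]_w (Y w)%:E + n%:R%:E = \int[P]_w (Y w + n%:R)%:E)%E.
    transitivity (\int[P]_w ((EFin \o Y) w + (EFin \o cst n%:R) w))%E; last by [].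
    rewrite integralD//; congr (_ + _)%E.
    by rewrite /= integral_cst// [X in (_ * X)%E](probability_setT P) mule1.
  apply: (@le_trans _ _ (\int[P]_w (Num.max (Y w + n%:R) 0)%:E)%E).
    have iYn := integrableD measurableT iY in_.
    apply: le_integral => //.
    - have := integrable_funepos measurableT iYn; congr (integrable _ _ _).
      by apply/funext => w; rewrite funeposE EFin_max.
    - by move=> w _; rewrite lee_fin le_max lexx.
  apply: (le_trans (pos_part_at_end n%:R)).
  have -> : (\int[P]_w (Num.max (X w + n%:R) 0 * terminal w)%:E =
      \int[P]_w (Z n w)%:E + n%:R%:E * \int[P]_w (terminal w)%:E)%E.
    rewrite -integralZl// -integralD//; last exact: integrableZl.
    apply: eq_integral => w _; rewrite /Z -EFinM -EFinD -mulrDl; congr (_ * _)%:E.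
    by rewrite addr_maxl addNr.
  rewrite leeD2l//; rewrite -[leRHS]mule1; apply: lee_wpmul2l => //.
  exact: terminal_mean_le1.
have Zcvg : (\int[P]_w (Z n w)%:E)%E @[n --> \oo] --> (\int[P]_w (X w * terminal w)%:E)%E.
  have gZ n w : setT w -> (`|(Z n w)%:E| <= `|(X w * terminal w)%:E|)%E by rewrite lee_fin.
  have Zw w : setT w -> (Z n w)%:E @[n --> \oo] --> (X w * terminal w)%:E.
    move=> _; apply: cvg_near_cst; exists (Num.trunc `|X w|).+1 => // n /= Xn.
    rewrite /Z max_l// lerNl (le_trans (ler_norm _))// normrN.
    by rewrite (le_trans (ltW (truncnS_gt _)))// ler_nat.
  apply: (@dominated_cvg _ _ _ P _ measurableT _ _
    (fun w => `|(X w * terminal w)%:E|%E) _ Zw _ _ gZ) => //.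
  - by move=> n; exact/measurable_EFinP.
  - exact: integrable_abse.
rewrite -(cvg_lim _ Zcvg)//; apply: lime_ge; first by apply/cvg_ex; eexists; exact: Zcvg.
exact: nearW.
Qed.

End closed_martingale.

(** The two inequalities come from the martingale and its opposite. *)
Lemma expectation_at_end (X : T -> R) (M : R -> T -> R) :
  measurable_fun setT X -> P.-integrable setT (EFin \o X) ->
  P.-integrable setT (fun w => (X w * terminal w)%:E) ->
  cadlag M -> (forall t, 0 <= t -> cond_expectation P (F t) X (M t)) ->
  ('E_P[at_time M L] = \int[P]_w (X w * terminal w)%:E)%E.
Proof.
move=> mX iX iXS cM condM.
have mNX : measurable_fun setT (fun w => - X w) by exact: measurable_funN.
have iNX : P.-integrable setT (EFin \o (fun w => - X w)).
  by have := integrableN iX.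
have NXS w : (- X w * terminal w)%:E = (- (X w * terminal w)%:E)%E by rewrite mulNr.
have iNXS : P.-integrable setT (fun w => (- X w * terminal w)%:E).
  by have := integrableN iXS; congr (integrable _ _ _); apply/funext => w; rewrite NXS.
have cNM := cadlagN cM.
have condNM t : 0 <= t -> cond_expectation P (F t) (fun w => - X w) (fun w => - M t w).
  by move=> t0; apply: (cond_expectationN (filtration_measurable usualF t0) iX); exact: condM.
have mY := measurable_at_end cM condM.
have iY : P.-integrable setT (EFin \o (fun w => M (fine (L w)) w)).
  apply/integrableP; split; first exact/measurable_EFinP.
  have -> : (\int[P]_w `|(EFin \o (fun w => M (fine (L w)) w)) w| =
      \int[P]_w ((Num.max (M (fine (L w)) w) 0)%:E + (Num.max (- M (fine (L w)) w) 0)%:E))%E.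
    apply: eq_integral => w _; rewrite -EFinD /=; congr _%:E.
    have [m0|m0] := leP 0 (M (fine (L w)) w).
      by rewrite ger0_norm// max_r ?addr0// oppr_le0.
    by rewrite ltr0_norm// max_l ?add0r// oppr_ge0 ltW.
  rewrite ge0_integralD//; last 4 first.
  - by move=> w _; rewrite lee_fin le_max lexx orbT.
  - by apply/measurable_EFinP; exact: measurable_maxr.
  - by move=> w _; rewrite lee_fin le_max lexx orbT.
  - by apply/measurable_EFinP; apply: measurable_maxr => //; exact: measurable_funN.
  apply: lte_add_pinfty; first exact: (pos_part_at_end_lty mX iX iXS cM condM).
  exact: (pos_part_at_end_lty mNX iNX iNXS cNM condNM).
have -> : ('E_P[at_time M L] = \int[P]_w (M (fine (L w)) w)%:E)%E.
  rewrite unlock; apply: (eq_integral_outside (negligible_end_infty honestL L_finite)).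
  by move=> w Lw; rewrite (at_time_fine honestL).
apply/eqP; rewrite eq_le; apply/andP; split.
  exact: expectation_at_end_le_terminal.
have iNY : P.-integrable setT (EFin \o (fun w => - M (fine (L w)) w)).
  by have := integrableN iY.
have := expectation_at_end_le_terminal mNX iNX iNXS cNM condNM iNY.
have -> : (\int[P]_w (- X w * terminal w)%:E = - \int[P]_w (X w * terminal w)%:E)%E.
  by under eq_integral do rewrite mulNr; rewrite opp_integral.
by rewrite opp_integral// leeN2.
Qed.

End martingale_at_end.

(** * Convergence of the closed martingale *)

Section martingale_convergence.
Context (R : realType) (d : measure_display) (T : measurableType d).
Variables (P : probability T R) (F : R -> set_system T).
Hypothesis usualF : usual_filtration P F.
Variables (X : T -> R) (M : R -> T -> R).
Hypotheses (mX : measurable_fun setT X) (iX : P.-integrable setT (EFin \o X)).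
Hypotheses (cM : cadlag M) (condM : forall t, 0 <= t -> cond_expectation P (F t) X (M t)).

Section maximal.
Variables (s eps : R) (Y : T -> R).
Hypotheses (s0 : 0 <= s) (eps0 : 0 < eps).
Hypotheses (mY : measurable_wrt (F s) Y) (iY : P.-integrable setT (EFin \o Y)).

Let mYT : measurable_fun setT Y.
Proof. by move=> _ U mU; rewrite setTI; apply: (filtration_measurable usualF s0); exact: mY. Qed.

Let exceed t := [set w | eps < `|M t w - Y w|].

Let exceed_F t : s <= t -> F t (exceed t).
Proof.
move=> st; have t0 : 0 <= t by exact: le_trans st.
have sF := filtration_sigma_algebra usualF t0.
have mYt : measurable_wrt (F t) Y by move=> U mU; apply: (filtration_nondecreasing usualF s0 st); exact: mY.
have mMt : measurable_wrt (F t) (M t) by case: (condM t0).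
rewrite (_ : exceed t = [set w | eps < M t w - Y w] `|` [set w | eps < Y w - M t w]).
  by apply: (sigma_algebraU sF); exact: measurable_wrt_sub_gt.
apply/seteqP; split=> w; rewrite /exceed /= ltr_normr opprB; first by move=> /orP.
by move=> [->|->]; rewrite ?orbT.
Qed.

Let jensen t B : s <= t -> F t B ->
  (\int[P]_(w in B) `|M t w - Y w|%:E <= \int[P]_(w in B) `|X w - Y w|%:E)%E.
Proof.
move=> st FB; have t0 : 0 <= t by exact: le_trans st.
have mYt : measurable_wrt (F t) Y by move=> U mU; apply: (filtration_nondecreasing usualF s0 st); exact: mY.
apply: (jensen_abs (filtration_sigma_algebra usualF t0) (filtration_measurable usualF t0) _ _ _ FB).
- exact: measurable_funB.
- by have := integrableB measurableT iX iY.
exact: (cond_expectationB (filtration_sigma_algebra usualF t0)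
  (filtration_measurable usualF t0) iX (condM t0) mYt iY).
Qed.

(** Doob's maximal inequality along an increasing sequence of times: on the
    event that the level is first exceeded at a given time, the conditional
    expectation is compared with the closing variable. *)
Let maximal_sequence (u : nat -> R) : (forall i j, (i <= j)%N -> u i <= u j) ->
  s <= u 0%N ->
  (eps%:E * P (\bigcup_i exceed (u i)) <= \int[P]_w `|X w - Y w|%:E)%E.
Proof.
move=> ndu su; have sui i : s <= u i by exact: le_trans (ndu 0%N i _).
have u0 i : 0 <= u i by exact: le_trans (sui i).
have mD i : measurable (exceed (u i)).
  exact: (filtration_measurable usualF (u0 i) (exceed_F (sui i))).
pose B := seqDU (fun i => exceed (u i)).
have FB i : F (u i) (B i).
  have sF := filtration_sigma_algebra usualF (u0 i).
  rewrite /B /seqDU setDE; apply: (sigma_algebraI sF); first exact: exceed_F.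
  apply: (sigma_algebraC sF).
  rewrite (_ : \big[_/_]_(k < i) _ = [set w | exists k : nat, (k < i)%N /\ exceed (u k) w]); last first.
    by rewrite -(bigcup_mkord i (fun k => exceed (u k))); apply/seteqP; split=> w [k];
      [move=> ki ?|move=> [? ?]]; exists k.
  apply: (sigma_algebra_exists sF) => k; have [ki|ik] := ltnP k i.
    apply: (sigma_algebra_and sF).
    apply: (filtration_nondecreasing usualF (u0 k) (ndu k i (ltnW ki))).
    exact: exceed_F.
  rewrite (_ : (fun _ => _) = set0); first by case: sF.
  by apply/seteqP; split=> w [].
have mB i : measurable (B i) by exact: (filtration_measurable usualF (u0 i)).
have tB : trivIset setT B by exact: trivIset_seqDU.
have UB : \bigcup_i exceed (u i) = \bigcup_i B i by rewrite -seqDU_bigcup_eq.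
have mabs (Z : T -> R) : measurable_fun setT Z -> measurable_fun setT (fun w => `|Z w - Y w|).
  by move=> mZ; apply: measurableT_comp => //; exact: measurable_funB.
have mU : measurable (\bigcup_i B i) by exact: bigcupT_measurable.
apply: (@le_trans _ _ (\int[P]_(w in \bigcup_i B i) `|X w - Y w|%:E)%E); last first.
  by apply: ge0_subset_integral => //; apply/measurable_EFinP; exact: mabs.
rewrite UB ge0_integral_bigcup//; last first.
  by apply/measurable_EFinP; apply: measurable_funTS; exact: mabs.
rewrite measure_semi_bigcup// -nneseriesZl; last by move=> i _.
apply: lee_nneseries => [i _ _|i _]; first by rewrite mule_ge0// lee_fin ltW.
apply: le_trans (jensen (sui i) (FB i)).
rewrite -integral_cst//; apply: ge0_le_integral => //.
- by move=> w _; rewrite lee_fin ltW.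
- apply/measurable_EFinP; apply: measurable_funTS; apply: mabs => _ U mU'.
  by rewrite setTI; apply: (filtration_measurable usualF (u0 i)); case: (condM (u0 i)) => mM _ _; exact: mM.
by move=> w [Bw _]; rewrite lee_fin ltW.
Qed.

(** By right-continuity the level is exceeded at some point of a dyadic grid as
    soon as it is exceeded at all. The grids are nested, so the events of the
    maximal inequality increase to an event that covers all exceeding paths. *)
Lemma maximal_inequality : exists U, [/\ measurable U,
  [set w | exists2 t, s <= t & eps < `|M t w - Y w|] `<=` U &
  (eps%:E * P U <= \int[P]_w `|X w - Y w|%:E)%E].
Proof.
pose u k i : R := s + grid (2 ^ k).-1 i.
have pk k : ((2 ^ k).-1.+1 = 2 ^ k)%N by rewrite prednK// expn_gt0.
pose U k := \bigcup_i exceed (u k i).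
have su k i : s <= u k i by rewrite lerDl grid_ge0.
have mU k : measurable (U k).
  apply: bigcupT_measurable => i.
  have u0 : 0 <= u k i by exact: le_trans (su k i).
  exact: (filtration_measurable usualF u0 (exceed_F (su k i))).
have ndU : {homo U : n m / (n <= m)%N >-> (n <= m)%O}.
  apply/nondecreasing_seqP => k; apply/subsetPset => w [i _ wi].
  exists (i.*2) => //; rewrite (_ : u k.+1 i.*2 = u k i)//.
  rewrite /u /grid !pk expnS -muln2 mulnC !natrM; congr (s + _).
  by rewrite -mulf_div divff ?mul1r.
exists (\bigcup_k U k); split.
- exact: bigcupT_measurable.
- move=> w [t st wt]; have ts0 : 0 <= t - s by rewrite subr_ge0.
  have t0 : 0 <= t by exact: le_trans st.
  have cvt : M (s + grid n (grid_index n (t - s))) w @[n --> \oo] --> M t w.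
    apply: (right_cvg_seq (f := M ^~ w)); first by have [+ _] := cM w; exact.
      by move=> n; have [+ _] := grid_near n ts0; rewrite lerBlDl.
    suff : s + grid n (grid_index n (t - s)) @[n --> \oo] --> s + (t - s).
      by rewrite [s + (t - s)]addrC subrK.
    by apply: cvgD; [exact: cvg_cst|exact: grid_cvg].
  have e0 : 0 < `|M t w - Y w| - eps by rewrite subr_gt0.
  have /cvgrPdist_lt/(_ _ e0)[N _ NP] := cvt.
  exists N => //; exists (grid_index (2 ^ N).-1 (t - s)) => //.
  have := NP (2 ^ N).-1; rewrite /= -ltnS pk ltn_expl// => /(_ isT).
  rewrite /exceed /= -/(u N _) => H.
  have := ler_distD (M (u N (grid_index (2 ^ N).-1 (t - s))) w) (M t w) (Y w).
  by rewrite /u in H *; move: H; set a := `|_|; set b := `|_|; set c := `|_|; lra.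
have bound k : (eps%:E * P (U k) <= \int[P]_w `|X w - Y w|%:E)%E.
  apply: maximal_sequence => [i j ij|]; last exact: su.
  by rewrite lerD2l /grid ler_pM2r ?invr_gt0// ler_nat.
have cU := nondecreasing_cvg_mu mU (bigcupT_measurable _ mU) ndU (mu := P).
rewrite -(cvg_lim _ cU)//.
have cU' : (eps%:E * (P \o U) n)%E @[n --> \oo] --> (eps%:E * P (\bigcup_k U k))%E.
  by apply: cvgeZl => //; exact: cU.
rewrite (cvg_lim _ cU)// -(cvg_lim _ cU')//.
apply: lime_le; first by apply/cvg_ex; eexists; exact: cU'.
exact: nearW.
Qed.

End maximal.

Hypothesis approxX : forall e, 0 < e -> exists s Y, [/\ 0 <= s,
  measurable_wrt (F s) Y, P.-integrable setT (EFin \o Y) &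
  (\int[P]_w `|X w - Y w|%:E <= e%:E)%E].

Let oscillates eps := [set w | forall s, 0 <= s -> exists2 t, s <= t & eps + eps < `|M t w - X w|].

(** With [Y] close to [X] in mean, [M] stays close to [Y] by the maximal
    inequality and [X] is close to [Y] by Markov's. *)
Let oscillates_negligible eps : 0 < eps -> P.-negligible (oscillates eps).
Proof.
move=> eps0.
have H (e : R) : 0 < e -> exists W, [/\ measurable W, oscillates eps `<=` W & (P W <= e%:E)%E].
  move=> e0; have ee0 : 0 < eps * (e / 2) by rewrite mulr_gt0// divr_gt0.
  have [s [Y [s0 mY iY XY]]] := approxX ee0.
  have [U [mU UM PU]] := maximal_inequality s0 eps0 mY iY.
  have mYT : measurable_fun setT Y.
    by move=> _ V mV; rewrite setTI; apply: (filtration_measurable usualF s0); exact: mY.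
  have mabs : measurable_fun setT (fun w => `|X w - Y w|).
    by apply: measurableT_comp => //; exact: measurable_funB.
  pose V := [set w | eps < `|X w - Y w|].
  have mV : measurable V by exact: measurable_lt_set.
  have PV : (eps%:E * P V <= \int[P]_w `|X w - Y w|%:E)%E.
    rewrite -integral_cst//; apply: (@le_trans _ _ (\int[P]_(w in V) `|X w - Y w|%:E)%E).
      apply: ge0_le_integral => //.
      - by move=> w _; rewrite lee_fin ltW.
      - by apply/measurable_EFinP; exact: measurable_funTS.
      - by move=> w Vw; rewrite lee_fin ltW.
    apply: ge0_subset_integral => //; exact/measurable_EFinP.
  have half (S : set T) : (eps%:E * P S <= \int[P]_w `|X w - Y w|%:E)%E -> (P S <= (e / 2)%:E)%E.
    move=> PS; rewrite -(lee_pmul2l (_ : eps%:E \is a fin_num))// -EFinM.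
    exact: le_trans XY.
  exists (U `|` V); split; first exact: measurableU.
    move=> w /(_ s s0)[t st wt]; have [Vw|/negP] := pselect (V w); first by right.
    rewrite -leNgt => Vw; left; apply: UM; exists t => //.
    have := ler_distD (Y w) (M t w) (X w); rewrite [`|Y w - _|]distrC.
    by move: wt Vw; set a := `|_|; set b := `|_|; set c := `|_|; lra.
  rewrite (le_trans (measureU2 _ mU mV))//.
  by rewrite (le_trans (leeD (half U PU) (half V PV)))// -EFinD lee_fin -splitr.
have /choice[W WP] : forall n : nat, exists W, [/\ measurable W, oscillates eps `<=` W & (P W <= (n.+1%:R^-1)%:E)%E].
  by move=> n; apply: H; rewrite invr_gt0.
exists (\bigcap_n W n); split.
- by apply: bigcapT_measurable => n; case: (WP n).
- apply/eqP; rewrite eq_le measure_ge0 andbT; apply/lee_addgt0Pr => e e0; rewrite add0e.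
  have [n _ /(_ n (leqnn n)) /= ne] := near_infty_natSinv_lt (PosNum e0).
  have [mW _ PW] := WP n.
  apply: (@le_trans _ _ (P (W n))).
    apply: le_measure; rewrite ?inE//; last exact: bigcap_inf.
    by apply: bigcapT_measurable => k; case: (WP k).
  by rewrite (le_trans PW)// lee_fin ltW.
by move=> w ow n _; case: (WP n) => _ + _; exact.
Qed.

Lemma closed_martingale_cvg :
  P.-negligible [set w | at_infty M w <> X w].
Proof.
have neg : P.-negligible (\bigcup_k oscillates k.+1%:R^-1).
  by apply: negligible_bigcup => k; apply: oscillates_negligible; rewrite invr_gt0.
apply: negligibleS neg => w /= nMX; apply: contrapT => no; apply: nMX.
apply/cvg_lim => //; apply/cvgrPdist_lt => e e0.
have e20 : 0 < e / 2 by rewrite divr_gt0.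
have [k _ /(_ k (leqnn k)) /= ke] := near_infty_natSinv_lt (PosNum e20).
have : ~ oscillates k.+1%:R^-1 w by move=> ok; apply: no; exists k.
move=> /existsNP[s /not_implyP[s0 Hs]].
near=> t; rewrite distrC; have st : s <= t.
  by near: t; apply: nbhs_pinfty_ge; rewrite num_real.
rewrite ltNge; apply/negP => eM; apply: Hs; exists t => //.
by apply: lt_le_trans eM; move: ke; move: (k.+1%:R^-1) => u; lra.
Unshelve. all: by end_near. Qed.

End martingale_convergence.

Lemma dominated_small d (T : measurableType d) (R : realType)
    (P : {measure set T -> \bar R}) (f : nat -> T -> R) (g : T -> R) (N : set T) :
  (forall n, measurable_fun setT (f n)) -> (forall n w, 0 <= f n w <= g w) ->
  P.-integrable setT (EFin \o g) -> P.-negligible N ->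
  (forall w, ~ N w -> \forall n \near \oo, f n w = 0) ->
  forall e, 0 < e -> exists n, (\int[P]_w (f n w)%:E <= e%:E)%E.
Proof.
move=> mf fg ig N0 fN e e0.
have [_ _ cv] : [/\ P.-integrable setT (cst 0%E : T -> \bar R),
  [sequence (\int[P]_(w in setT) (`|(f n w)%:E - cst 0 w|))%E]_n @ \oo --> 0%E &
  [sequence (\int[P]_(w in setT) (f n w)%:E)%E]_n @ \oo --> (\int[P]_(w in setT) cst 0 w)%E].
  apply: (@dominated_convergence _ _ _ P _ measurableT (fun n w => (f n w)%:E) _ (EFin \o g)) => //.
  - by move=> n; exact/measurable_EFinP.
  - apply: negligibleS N0 => w /= nw; apply: contrapT => /fN fw0; apply: nw => _.
    by apply: cvg_near_cst; apply: filterS fw0 => n ->.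
  - apply/nearW => w n _ /=; have /andP[f0 fgw] := fg n w.
    by rewrite lee_fin ger0_norm.
rewrite integral0 in cv.
have /cvg_ballP/(_ e e0)[n _ /(_ n (leqnn n))] : (fine \o [sequence (\int[P]_(w in setT) (f n w)%:E)%E]_n) @ \oo --> (0 : R).
  exact: fine_cvg.
move=> H; exists n.
have ifin : (\int[P]_w (f n w)%:E)%E \is a fin_num.
  apply: integrable_fin_num => //; apply: le_integrable ig => //.
    exact/measurable_EFinP.
  move=> w _; rewrite /= lee_fin; have /andP[f0 fgw] := fg n w.
  by rewrite ger0_norm// (le_trans fgw)// ler_norm.
rewrite -(fineK ifin) lee_fin; move: H; rewrite /ball /= sub0r normrN => /ltW.
exact: le_trans (ler_norm _).
Qed.

Section clamp.
Context {R : realType}.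
Definition clamp (k x : R) := Num.max (- k) (Num.min x k).

Lemma clamp_id k x : `|x| <= k -> clamp k x = x.
Proof. by rewrite ler_norml => /andP[kx xk]; rewrite /clamp (min_l xk) max_r. Qed.

Lemma clamp_le k x : 0 <= k -> `|clamp k x| <= k.
Proof.
move=> k0; rewrite ler_norml /clamp le_max lexx /= ge_max ge_min lexx orbT andbT.
by rewrite (le_trans _ k0)// oppr_le0.
Qed.

Lemma clamp_dist k x : 0 <= k -> `|x - clamp k x| <= `|x|.
Proof.
move=> k0; have [xk|kx] := leP `|x| k; first by rewrite clamp_id// subrr normr0.
rewrite /clamp; have [x0|x0] := leP 0 x.
  move: kx; rewrite ger0_norm// => kx; rewrite (min_r (ltW kx)) max_r; last first.
    by rewrite (le_trans _ k0)// oppr_le0.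
  by rewrite ger0_norm ?subr_ge0 ?(ltW kx)// gerBl.
move: kx; rewrite ltr0_norm// => kx.
rewrite min_l; last by rewrite (le_trans (ltW x0)).
rewrite max_l; last by rewrite lerNr ltW.
by rewrite opprK ler0_norm; move: kx; lra.
Qed.

Lemma continuous_clamp k : continuous (clamp k).
Proof.
move=> x; apply: (@continuous_max _ _ (cst (- k)) (fun x => Num.min x k)).
  exact: cvg_cst.
by apply: (@continuous_min _ _ id (cst k)); [exact: cvg_id|exact: cvg_cst].
Qed.

Lemma measurable_clamp k : measurable_fun setT (clamp k).
Proof. exact: continuous_measurable_fun (@continuous_clamp k). Qed.
End clamp.

Section terminal_approximation.
Context (R : realType) (d : measure_display) (T : measurableType d).
Variables (P : probability T R) (F : R -> set_system T).
Hypothesis usualF : usual_filtration P F.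
Variable L : T -> \bar R.
Hypotheses (honestL : honest_time F L) (L_finite : P [set w | L w = +oo%E] = 0%E).
Variable A : T -> cumulative R R.
Hypothesis dualA : dual_optional_projection P F L A.
Variable psi : R -> R.
Hypothesis cpsi : continuous psi.

Local Notation S := (terminal L A).
Let X w := psi (S w).

Let mpsi : measurable_fun setT psi. Proof. exact: continuous_measurable_fun. Qed.

Let mX : measurable_fun setT X.
Proof. by apply: measurableT_comp => //; exact: (measurable_terminal usualF honestL dualA). Qed.

Hypothesis iX : P.-integrable setT (EFin \o X).

(** A path of the dual projection is constant after the honest time, so the
    variables [psi (A w n%:R)] are eventually equal to [X w]. They are clamped
    in order to be dominated. *)
Lemma terminal_approximation e : 0 < e -> exists s Y, [/\ 0 <= s,
  measurable_wrt (F s) Y, P.-integrable setT (EFin \o Y) &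
  (\int[P]_w `|X w - Y w|%:E <= e%:E)%E].
Proof.
move=> e0; have e20 : 0 < e / 2 by rewrite divr_gt0.
have mabs (f g : T -> R) : measurable_fun setT f -> measurable_fun setT g ->
    measurable_fun setT (fun w => `|f w - g w|).
  by move=> mf mg; apply: measurableT_comp => //; exact: measurable_funB.
have mclamp k (f : T -> R) : measurable_fun setT f ->
    measurable_fun setT (fun w => clamp k (f w)).
  by move=> mf; apply: measurableT_comp => //; exact: measurable_clamp.
have [k Xk] : exists k : nat, (\int[P]_w `|X w - clamp k%:R (X w)|%:E <= (e / 2)%:E)%E.
  apply: (@dominated_small _ _ _ P _ (fun w => `|X w|) set0) => //.
  - by move=> n; apply: mabs => //; exact: mclamp.
  - by move=> n w; rewrite normr_ge0 clamp_dist.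
  - exact: integrable_norm.
  - exact: negligible_set0.
  move=> w _; exists (Num.trunc `|X w|).+1 => // n /= Xn.
  by rewrite clamp_id ?subrr ?normr0// (le_trans (ltW (truncnS_gt _)))// ler_nat.
pose Y (n : nat) w := clamp k%:R (psi (A w n%:R)).
have mA n : measurable_fun setT (fun w => A w n).
  exact: (dual_projection_measurable usualF dualA).
have mY n : measurable_fun setT (Y n) by apply: mclamp; exact: measurableT_comp.
have [n Yn] : exists n, (\int[P]_w `|clamp k%:R (X w) - Y n w|%:E <= (e / 2)%:E)%E.
  apply: (@dominated_small _ _ _ P _ (cst (k%:R + k%:R))
    ([set w | ~ forall t, A w t <= S w] `|` [set w | L w = +oo%E])) => //.
  - by move=> n; apply: mabs => //; exact: mclamp.
  - move=> n w; rewrite normr_ge0 /= (le_trans (ler_normB _ _))//.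
    by rewrite lerD// clamp_le.
  - exact: finite_measure_integrable_cst.
  - apply: negligibleU; first exact: (le_terminal usualF honestL L_finite dualA).
    exact: (negligible_end_infty honestL L_finite).
  move=> w /not_orP[/contrapT Aw _]; exists (Num.trunc `|fine (L w)|).+1 => // n /= Ln.
  suff E : A w n%:R = S w by rewrite /Y E /X subrr normr0.
  apply/eqP; rewrite eq_le Aw /=; apply: cumulative_is_nondecreasing.
  by rewrite (le_trans (ler_norm _))// (le_trans (ltW (truncnS_gt _)))// ler_nat.
exists n%:R, (Y n); split=> //.
- move=> U mU; have mc : measurable_fun setT (fun x => clamp k%:R (psi x)).
    by apply: measurableT_comp => //; exact: measurable_clamp.
  have n0 : 0 <= n%:R :> R by [].
  apply: (dual_proj_adapted dualA n0 (U := (fun x => clamp k%:R (psi x)) @^-1` U)).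
  by rewrite -[X in measurable X]setTI; exact: mc.
- apply: (le_integrable measurableT _ _ (finite_measure_integrable_cst P k%:R measurableT)).
    exact/measurable_EFinP.
  by move=> w _; rewrite /= lee_fin normr_nat clamp_le.
apply: (@le_trans _ _ (\int[P]_w (`|X w - clamp k%:R (X w)|%:E + `|clamp k%:R (X w) - Y n w|%:E))%E).
  apply: ge0_le_integralT => w; first by rewrite lee_fin.
  by rewrite -EFinD lee_fin ler_distD.
rewrite ge0_integralD//.
- by rewrite (le_trans (leeD Xk Yn))// -EFinD lee_fin -splitr.
- by apply/measurable_EFinP; apply: mabs => //; exact: mclamp.
- by apply/measurable_EFinP; apply: mabs => //; exact: mclamp.
Qed.

End terminal_approximation.

(** * Expectations at the honest time and at infinity *)

Theorem proposition5p8
  (R : realType)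
  (d : measure_display) (T : measurableType d) (P : probability T R)
  (F : R -> set_system T) (usualF : usual_filtration P F)
  (L : T -> \bar R) (honestL : honest_time F L)
  (L_neq0 : P [set w | L w = 0%E] = 0%E)
  (L_finite : P [set w | L w = +oo%E] = 0%E)
  (L_avoids : avoids_stopping_times P F L)
  (A : T -> cumulative R R) (dualA : dual_optional_projection P F L A)
  (phi : R -> R)
  (phi_continuous : {within `[0, +oo[%classic, continuous phi})
  (phi_integrable : (\int[lebesgue_measure]_(x in `[0%R, +oo[)
     (`|phi x| * expR (- x))%:E < +oo)%E)
  (xphi_integrable : (\int[lebesgue_measure]_(x in `[0%R, +oo[)
     (x * `|phi x| * expR (- x))%:E < +oo)%E)
  (M : R -> T -> R)
  (martM : closed_martingale P F
     (fun w => phi (at_infty (fun t w => A w t) w)) M)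
  (d' : measure_display) (T' : measurableType d') (Q : probability T' R)
  (e1 e2 : {RV Q >-> R})
  (exp_e1 : standard_exponential e1) (exp_e2 : standard_exponential e2)
  (indep_e : independent_RV e1 e2) :
  ([/\ 'E_P[at_time M L] =
         \int[lebesgue_measure]_(y in `[0%R, +oo[)
           \int[lebesgue_measure]_(x in `[0%R, +oo[)
             (expR (- x) * expR (- y) * phi (x + y)%R)%:E,
       \int[lebesgue_measure]_(y in `[0%R, +oo[)
           \int[lebesgue_measure]_(x in `[0%R, +oo[)
             (expR (- x) * expR (- y) * phi (x + y)%R)%:E =
         'E_Q[fun w => phi (e1 w + e2 w)%R] &
       'E_Q[fun w => phi (e1 w + e2 w)%R] =
         \int[lebesgue_measure]_(x in `[0%R, +oo[)
           (expR (- x) * x * phi x)%:E] /\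
   [/\ 'E_P[at_infty M] =
         \int[lebesgue_measure]_(x in `[0%R, +oo[) (expR (- x) * phi x)%:E &
       \int[lebesgue_measure]_(x in `[0%R, +oo[) (expR (- x) * phi x)%:E =
         'E_Q[fun w => phi (e1 w)]])%E.
Proof.
pose S := terminal L A.
have mS : measurable_fun setT S := measurable_terminal usualF honestL dualA.
have S0 w : 0 <= S w := terminal_ge0 dualA w.
have lawS : forall U, measurable U -> P (S @^-1` U) = exponential_prob 1 U.
  apply: exponential_lawP => // a a0.
  exact: (terminal_lt usualF honestL L_finite L_avoids dualA a0).
(* A continuous extension of phi to the whole line. *)
pose psi x := phi (Num.max x 0).
have psiE x : 0 <= x -> psi x = phi x by move=> x0; rewrite /psi max_l.
have cpsi : continuous psi.
  move=> x; have x0 : `[0, +oo[%classic (Num.max x 0) :> Prop.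
    by rewrite /= in_itv/= andbT le_max lexx orbT.
  have cphi : phi y @[y --> within `[0, +oo[%classic (nbhs (Num.max x 0))] --> psi x.
    have := phi_continuous (Num.max x 0).
    by rewrite (nbhs_subspace_in x0).
  apply: cvg_comp cphi => U /=; rewrite /within/= => nU.
  have cmax : Num.max y 0 @[y --> x] --> Num.max x 0.
    by apply: (@continuous_max R R id (cst 0) x); [exact: cvg_id|exact: cvg_cst].
  move: (cmax _ nU); apply: (@filterS _ (nbhs x)) => y /=; apply.
  by rewrite in_itv/= andbT le_max lexx orbT.
have mpsi : measurable_fun setT psi by exact: continuous_measurable_fun.
have psi_fin : (\int[lebesgue_measure]_(x in `[0%R, +oo[) (`|psi x| * expR (- x))%:E < +oo)%E.
  apply: le_lt_trans phi_integrable; rewrite le_eqVlt; apply/predU1P; left.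
  by apply: eq_integral => x; rewrite inE/= in_itv/= andbT => x0; rewrite psiE.
have xpsi_fin : (\int[lebesgue_measure]_(x in `[0%R, +oo[) (x * `|psi x| * expR (- x))%:E < +oo)%E.
  apply: le_lt_trans xphi_integrable; rewrite le_eqVlt; apply/predU1P; left.
  by apply: eq_integral => x; rewrite inE/= in_itv/= andbT => x0; rewrite psiE.
have doubleE : (\int[lebesgue_measure]_(y in `[0%R, +oo[)
           \int[lebesgue_measure]_(x in `[0%R, +oo[)
             (expR (- x) * expR (- y) * phi (x + y)%R)%:E =
    \int[lebesgue_measure]_(x in `[0%R, +oo[) (expR (- x) * x * phi x)%:E)%E.
  transitivity (\int[lebesgue_measure]_(x in `[0%R, +oo[) (expR (- x) * x * psi x)%:E)%E.
    rewrite -integral_exponential_double//; apply: eq_integral => y.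
    rewrite inE/= in_itv/= andbT => y0; apply: eq_integral => x.
    by rewrite inE/= in_itv/= andbT => x0; rewrite psiE// addr_ge0.
  by apply: eq_integral => x; rewrite inE/= in_itv/= andbT => x0; rewrite psiE.
have neg_neg (e : {RV Q >-> R}) : standard_exponential e -> Q.-negligible [set w | e w < 0].
  move=> expe; exists (e @^-1` `]-oo, 0[%classic); split.
  - exact: measurable_funPTI.
  - have := expe `]-oo, 0[%classic (measurable_itv _); rewrite /distribution /pushforward => ->.
    apply: integral0_eq => x; rewrite /= in_itv/= => x0.
    by rewrite lt0_exponential_pdf.
  - by move=> w /= ew; rewrite in_itv.
have sumE : ('E_Q[fun w => phi (e1 w + e2 w)%R] =
    \int[lebesgue_measure]_(x in `[0%R, +oo[) (expR (- x) * x * phi x)%:E)%E.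
  transitivity (\int[lebesgue_measure]_(x in `[0%R, +oo[) (expR (- x) * x * psi x)%:E)%E.
    rewrite -(integral_exponential_sum cpsi psi_fin exp_e1 exp_e2 indep_e) unlock.
    apply: (eq_integral_outside (negligibleU (neg_neg _ exp_e1) (neg_neg _ exp_e2))).
    move=> w /not_orP[/negP + /negP]; rewrite -!leNgt => e10 e20.
    by rewrite psiE// addr_ge0.
  by apply: eq_integral => x; rewrite inE/= in_itv/= andbT => x0; rewrite psiE.
have singleE : (\int[lebesgue_measure]_(x in `[0%R, +oo[) (expR (- x) * phi x)%:E =
    \int[lebesgue_measure]_(x in `[0%R, +oo[) (expR (- x) * psi x)%:E)%E.
  by apply: eq_integral => x; rewrite inE/= in_itv/= andbT => x0; rewrite psiE.
pose X w := psi (S w).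
have mX : measurable_fun setT X by exact: measurableT_comp.
have iX : P.-integrable setT (EFin \o X).
  apply/integrableP; split; first exact/measurable_EFinP.
  have mn : measurable_fun setT (fun x => `|psi x|) by exact: measurableT_comp.
  rewrite (integral_exponential mS lawS mn); under eq_integral do rewrite mulrC.
  exact: psi_fin.
have iXS : P.-integrable setT (fun w => (X w * terminal L A w)%:E).
  have mXS : measurable_fun setT (fun x => psi x * x) by exact: measurable_funM.
  apply/integrableP; split.
    by apply/measurable_EFinP; exact: (measurableT_comp mXS mS).
  have mn : measurable_fun setT (fun x => `|psi x * x|) by exact: measurableT_comp.
  rewrite (integral_exponential mS lawS mn).
  apply: le_lt_trans xpsi_fin; rewrite le_eqVlt; apply/predU1P; left.
  apply: eq_integral => x; rewrite inE/= in_itv/= andbT => x0.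
  by rewrite normrM (ger0_norm x0) mulrC [(_ * x)%R]mulrC.
have [cM condM0] := martM.
(* The closing variable is phi of a limit of paths; it is replaced by X, which
   differs from it on a null set. *)
have XE : P.-negligible [set w | at_infty (fun t w => A w t) w <> terminal L A w].
  exact: (at_infty_terminal usualF honestL L_finite dualA).
have condM t : 0 <= t -> cond_expectation P (F t) X (M t).
  move=> t0; have [mM iM EM] := condM0 t t0; split=> // B FB; rewrite EM//.
  rewrite integral_mkcond [RHS]integral_mkcond.
  apply: (eq_integral_outside XE) => w /= /contrapT Aw.
  by rewrite !patchE Aw /X psiE.
have cvgM := closed_martingale_cvg usualF mX iX cM condM
  (terminal_approximation usualF honestL L_finite dualA cpsi iX).
split; split.
- rewrite doubleE (expectation_at_end usualF honestL L_finite L_avoids dualA mX iX iXS cM condM).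
  have mXS : measurable_fun setT (fun x => psi x * x) by exact: measurable_funM.
  rewrite (integral_exponential mS lawS mXS).
  apply: eq_integral => x; rewrite inE/= in_itv/= andbT => x0.
  rewrite psiE//; congr EFin; ring.
- by rewrite doubleE sumE.
- exact: sumE.
- rewrite singleE -(integral_exponential mS lawS mpsi) unlock.
  by apply: (eq_integral_outside cvgM) => w /contrapT ->.
have PE1 U : measurable U -> Q (e1 @^-1` U) = exponential_prob 1 U by exact: exp_e1.
have me1 : measurable_fun setT e1 by [].
rewrite singleE -(integral_exponential me1 PE1 mpsi) unlock.
apply: (eq_integral_outside (neg_neg _ exp_e1)) => w /negP.
by rewrite -leNgt => e10; rewrite psiE.
Qed.
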